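(* Let $d\ge1$ and $\psi\in C_0^\infty(-1,1)$. For $\kappa\in\mathbb{R}$, $\varepsilon>0$ and $(x,t)\in\mathbb{R}^d\times\mathbb{R}$ let $$\mathcal J_{\kappa,\varepsilon}(x,t)=\int_{\mathbb{R}^d}e^{i(x\cdot\xi+t\langle\xi\rangle)}\,\psi(\varepsilon|\xi|)\,(1+|\xi|^2)^{-\frac{d+1}4-i\kappa}\,d\xi.$$ There exist constants $C<\infty$ and $N>0$ such that $$|\kappa\,\mathcal J_{\kappa,\varepsilon}(x,t)|\le C(1+|\kappa|)^N|t|^{-\frac{d-1}2}$$ for all $\kappa\in\mathbb{R}$, $\varepsilon>0$ and $(x,t)\in\mathbb{R}^d\times\mathbb{R}$.
   Context: $\langle\xi\rangle=(1+|\xi|^2)^{1/2}$. The constants $C,N$ may depend on $d$ and $\psi$ but not on $\kappa,\varepsilon,x,t$. When $t=0$ and $d\ge2$ the right-hand side is interpreted as $+\infty$. *)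

(* Defs.v *)
From HB Require Import structures.
From mathcomp Require Import all_boot all_order all_algebra.
From mathcomp Require Import all_classical all_reals all_analysis.
From mathcomp.real_closed Require Export complex.

Set Implicit Arguments.
Unset Strict Implicit.
Unset Printing Implicit Defensive.
Import Order.TTheory GRing.Theory Num.Theory.
Import numFieldNormedType.Exports.

Local Open Scope classical_set_scope.
Local Open Scope ring_scope.
Local Open Scope complex_scope.

(* R^d; the sigma-algebra of the library on tuples is the one generated by the
   coordinate maps, i.e. the Borel sigma-algebra of R^d. *)
Notation Rn R d := (d.-tuple (measurableTypeR R)).

Section lebesgue_measure_step.
Context (R : realType) (d : nat).
Variable mu : {sigma_finite_measure set (Rn R d) -> \bar R}.

Definition Rn_cons (p : measurableTypeR R * Rn R d) : Rn R d.+1 :=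
  [tuple of p.1 :: p.2].

Lemma measurable_Rn_cons : measurable_fun [set: _] Rn_cons.
Proof.
exact: (@measurable_cons _ _ _ _ fst d snd measurable_fst measurable_snd).
Qed.

Definition lebesgue_cons : set (Rn R d.+1) -> \bar R :=
  pushforward (@lebesgue_measure R \x mu)%E Rn_cons.

Let lebesgue_cons0 : lebesgue_cons set0 = 0%E.
Proof. by rewrite /lebesgue_cons /pushforward preimage_set0 measure0. Qed.

Let lebesgue_cons_ge0 A : (0 <= lebesgue_cons A)%E.
Proof. exact: (measure_ge0 (@lebesgue_measure R \x mu)%E). Qed.

Let lebesgue_cons_sigma_additive : semi_sigma_additive lebesgue_cons.
Proof.
move=> F mF tF mUF; rewrite /lebesgue_cons /pushforward preimage_bigcup.
have mG i : measurable (Rn_cons @^-1` F i).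
  by rewrite -[_ @^-1` _]setTI; exact: measurable_Rn_cons.
apply: measure_semi_sigma_additive => //.
- apply/trivIsetP => i j _ _ ij; rewrite -preimage_setI.
  by move/trivIsetP: tF => -> //; rewrite preimage_set0.
- exact: bigcup_measurable.
Qed.

HB.instance Definition _ := isMeasure.Build _ _ _ lebesgue_cons
  lebesgue_cons0 lebesgue_cons_ge0 lebesgue_cons_sigma_additive.

Let lebesgue_cons_sigma_finite : sigma_finite setT lebesgue_cons.
Proof.
have /sigma_finiteP[F [TF ndF Foo]] := sigma_finiteT (@lebesgue_measure R).
have /sigma_finiteP[G [TG ndG Goo]] := sigma_finiteT mu.
exists (fun k => [set v | F k (thead v) /\ G k [tuple of behead v]]).
  rewrite predeqE => v; split=> // _.
  have [i _ Fi] : (\bigcup_i F i) (thead v) by rewrite -TF.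
  have [j _ Gj] : (\bigcup_i G i) [tuple of behead v] by rewrite -TG.
  exists (maxn i j) => //; split.
  - by move: (thead v) Fi; exact/subsetPset/ndF/leq_maxl.
  - by move: [tuple of behead v] Gj; exact/subsetPset/ndG/leq_maxr.
move=> k; have [mF Fk] := Foo k; have [mG Gk] := Goo k; split.
  apply: measurableI.
  - by rewrite -[X in measurable X]setTI; exact: measurable_tnth.
  - by rewrite -[X in measurable X]setTI; exact: measurable_behead.
rewrite /lebesgue_cons /pushforward (_ : _ @^-1` _ = F k `*` G k); last first.
  have tailE p : [tuple of behead (Rn_cons p)] = p.2 :> Rn R d.
    exact: val_inj.
  by rewrite predeqE => p; rewrite /preimage /= tailE.
by rewrite product_measure1E// lte_mul_pinfty// ge0_fin_numE.
Qed.

HB.instance Definition _ := Measure_isSigmaFinite.Build _ _ _ lebesgue_cons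
  lebesgue_cons_sigma_finite.

End lebesgue_measure_step.

(* d-dimensional Lebesgue measure: the d-fold product of the one-dimensional
   one, transported along R x R^d ~ R^(d+1); for d = 0, the unit mass. *)
Fixpoint lebesgue_measure_Rn (R : realType) (d : nat) :
    {sigma_finite_measure set (Rn R d) -> \bar R} :=
  match d with
  | 0 => \d_([tuple] : Rn R 0)
  | d'.+1 => lebesgue_cons (lebesgue_measure_Rn R d')
  end.

Section real_and_complex_notions.
Context (R : realType).

Definition dotRn (d : nat) (x xi : Rn R d) : R :=
  \sum_(i < d) tnth x i * tnth xi i.

Definition normRn (d : nat) (xi : Rn R d) : R := Num.sqrt (dotRn xi xi).

Definition japanese_bracket (d : nat) (xi : Rn R d) : R :=
  Num.sqrt (1 + normRn xi ^+ 2).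

(* e^z = e^(Re z) (cos (Im z) + i sin (Im z)). *)
Definition Cexp (z : R[i]) : R[i] :=
  (expR (complex.Re z) * cos (complex.Im z)) +i*
  (expR (complex.Re z) * sin (complex.Im z)).

(* a ^ z for a real base a > 0 and a complex exponent z. *)
Definition Cpow (a : R) (z : R[i]) : R[i] := Cexp (z * (ln a)%:C).

Definition smooth (f : R -> R) : Prop :=
  forall (n : nat) (s : R), derivable (derive1n n f) s 1.

Definition top_support (f : R -> R[i]) : set R := closure [set s | f s != 0].

(* Complex-valued test functions on ]-1, 1[, extended by 0 to R. *)
Definition test_function (psi : R -> R[i]) : Prop :=
  [/\ smooth (fun s => complex.Re (psi s)),
      smooth (fun s => complex.Im (psi s)),
      compact (top_support psi)
    & top_support psi `<=` `]-1, 1[ ].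

Definition Cintegral (d : nat) (f : Rn R d -> R[i]) : R[i] :=
  (\int[lebesgue_measure_Rn R d]_xi complex.Re (f xi)) +i*
  (\int[lebesgue_measure_Rn R d]_xi complex.Im (f xi)).

Definition calJ (d : nat) (psi : R -> R[i]) (kappa eps : R)
    (x : Rn R d) (t : R) : R[i] :=
  Cintegral (fun xi : Rn R d =>
    Cexp (0 +i* (dotRn x xi + t * japanese_bracket xi))
    * psi (eps * normRn xi)
    * Cpow (1 + normRn xi ^+ 2)
        ((- (d.+1%:R / 4)) +i* (- kappa))).

(* The right-hand side C (1 + |kappa|)^N |t|^(-(d-1)/2), which is +oo when t = 0
   and d >= 2 (where powR would give 0). For d = 1 the exponent is 0, and
   0 `^ 0 = 1. *)
Definition dispersive_bound (d : nat) (C N kappa t : R) : \bar R :=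
  if (2 <= d)%N && (t == 0) then +oo%E
  else (C * (1 + `|kappa|) `^ N * `|t| `^ (- (d.-1%:R / 2)))%:E.

End real_and_complex_notions.

(* Main.v *)
Require Import Defs.
From HB Require Import structures.
From mathcomp Require Import all_boot all_order all_algebra.
From mathcomp Require Import all_classical all_reals all_analysis.
From mathcomp Require Import measurable_realfun.
From mathcomp.real_closed Require Import complex.
From mathcomp Require Import ring lra.

(** Write [w] for the Japanese bracket of [xi], [n = d - 1], [p = n / 2] and
    [k = 2 * kappa]. After separating real and imaginary parts, everything
    reduces to the real integral over R^d of
    [cos (x . xi + t w - k ln w + th) * w ^ (- p - 1) * psi (eps |xi|)], which,
    multiplied by [|k|], must be at most [C (1 + |k|) ^ N |t| ^ (- p)]; reversing
    the phase, one may take [t > 0].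

    By rotation invariance ([ge0_integral_polarize]) [x . xi] can be replaced by
    [|x| eta], where [eta] is one coordinate of [xi]; the other coordinates [v]
    enter only through [w = sqrt (m ^ 2 + |v| ^ 2)], where [m] is the bracket of
    [eta]. The substitution [z ^ 2 = t (w - m)] for [|v|]
    ([ge0_integral_radial]) has a Jacobian proportional to [t ^ (- p)] and turns
    [t w] into [t m + z ^ 2]. What remains is an integral over [(eta, z)], to be
    bounded by a power of [1 + |k|] over [|k|], uniformly in [t], [eps], [x].

    For [z >= 1], integration by parts against [cos (z ^ 2)] gains [z ^ (- 2)] and
    costs at most a factor [k], so finitely many of them make the power of [z]
    integrable ([tail_bound]). The amplitudes that arise form an algebra of
    symbols in [s = z ^ 2 / t = w - m], stable under [s d/ds]. It is then enough
    to bound, for each fixed [s >= 0], the integral over [eta] of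
    [cos (y eta + t m + th) * cos (k ln (m + s) + th')] times an amplitude
    ([oscillating_bound]).

    There the coordinate is [X = eta + m], for which [y eta + t m = a X + b / X]
    and [d eta / m = d X / X]. On the half-line the amplitude is [1 / m] times a
    function whose variation is bounded uniformly in [s] and [eps], and so is
    the part of the amplitude and of [cos (k ln (m + s))] that is left after
    extracting [cos (k ln X)] and [sin (k ln X)]. By the layer-cake formula one
    is left with integrals of [cos (a X + b / X + k ln X + th) / m] over
    intervals ([core_estimate]). The logarithmic derivative of the phase is
    [g = a X - b / X + k]. Where [|g| >= |k| / 2], van der Corput's argument gives
    a multiple of [1 / |k|]; where [|g| < |k| / 2], the ratio of any two values of
    [X] in an interval is bounded by an absolute constant ([resonance_ratio]), so
    the integral of [1 / X] is bounded. The total [C (1 + 1 / |k|)] does not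
    depend on [a] and [b], and the factor [kappa] in the theorem absorbs
    [1 / |k|]. *)

Set Implicit Arguments.
Unset Strict Implicit.
Unset Printing Implicit Defensive.
Import Order.TTheory GRing.Theory Num.Theory.
Import numFieldNormedType.Exports.

Local Open Scope classical_set_scope.
Local Open Scope ring_scope.

(** * Calculus on the line *)

Section calculus.
Context {R : realType}.
Notation mu := (@lebesgue_measure R).
Implicit Types (f F : R -> R) (a b : R).

Lemma is_derive_continuous F (x dF : R) : is_derive x 1 F dF -> {for x, continuous F}.
Proof.
by move=> dFx; apply/differentiable_continuous/derivable1_diffP; exact: ex_derive.
Qed.

Lemma is_derive_compR (f g : R -> R) (x df dg : R) :
  is_derive x 1 g dg -> is_derive (g x) 1 f df ->
  is_derive x 1 (fun y => f (g y)) (df * dg).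
Proof.
move=> Hg Hf; have -> : (fun y => f (g y)) = f \o g by [].
by apply: is_derive_eq; rewrite /GRing.scale/= mulrC.
Qed.

Lemma is_derive_powR (a s : R) : 0 < s ->
  is_derive s 1 (fun y : R => y `^ a) (a * s `^ (a - 1)).
Proof.
move=> s0; apply: DeriveDef; first by apply: derivable_powR; rewrite in_itv/= s0.
by rewrite -derive1E powR_derive1// in_itv/= s0.
Qed.

Lemma powRB1 (a s : R) : 0 < s -> s `^ (a - 1) = s `^ a / s.
Proof.
move=> s0; rewrite -(powR_inv1 (ltW s0)) -powRD//.
by rewrite lt0r_neq0// implybT.
Qed.

Lemma is_derive_shift (c s : R) : is_derive s 1 (fun s => c + s) 1.
Proof.
have := is_deriveD (is_derive_cst c s (1:R)) (is_derive_id s (1:R)); rewrite add0r.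
exact.
Qed.

Lemma is_derive_inv (f : R -> R) (s df : R) : f s != 0 -> is_derive s 1 f df ->
  is_derive s 1 (fun s => (f s)^-1) (- df / f s ^+ 2).
Proof.
move=> f0 H.
have := is_deriveV f0 H.
by rewrite (_ : - (f s ^- 2) *: df = - df / f s ^+ 2)// /GRing.scale/=; ring.
Qed.

Lemma continuous_itv_integrable f a b :
  (forall x, a <= x <= b -> {for x, continuous f}) ->
  mu.-integrable `[a, b] (EFin \o f).
Proof.
move=> cf; apply: continuous_compact_integrable; first exact: segment_compact.
apply: continuous_in_subspaceT => x; rewrite inE/= in_itv/= => xab.
exact: cf.
Qed.

Lemma continuous_bounded_itv (f : R -> R) (a b : R) : continuous f ->
  exists2 A : R, 0 <= A & forall x, a <= x <= b -> `|f x| <= A.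
Proof.
move=> cf; have [ab|ba] := leP a b; last first.
  by exists 0 => // x /andP[ax xb]; have := le_trans ax xb; rewrite leNgt ba.
have cn : {within `[a, b], continuous (fun x => `|f x|)}.
  apply: continuous_subspaceT => x.
  by apply: continuous_comp; [exact: cf|exact: norm_continuous].
have [c _ Hc] := EVT_max ab cn.
by exists `|f c| => // x xab; apply: Hc; rewrite in_itv.
Qed.

Lemma Rintegral_FTC F f a b : a <= b ->
  (forall x, a <= x <= b -> is_derive x 1 F (f x)) ->
  (forall x, a <= x <= b -> {for x, continuous f}) ->
  \int[mu]_(x in `[a, b]) f x = F b - F a.
Proof.
rewrite le_eqVlt => /predU1P[<- _ _|ab dF cf].
  by rewrite set_itv1 Rintegral_set1 subrr.
rewrite /Rintegral (@continuous_FTC2 _ f F)//.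
- apply: continuous_in_subspaceT => x; rewrite inE/= in_itv/= => xab.
  exact: cf.
- have cF x : a <= x <= b -> {for x, continuous F}.
    by move=> /dF; exact: is_derive_continuous.
  split.
  + move=> x; rewrite in_itv/= => /andP[ax xb].
    by have /@ex_derive := dF x (introT andP (conj (ltW ax) (ltW xb))).
  + by apply: cvg_at_right_filter; apply: cF; rewrite lexx ltW.
  + by apply: cvg_at_left_filter; apply: cF; rewrite lexx ltW.
- move=> x; rewrite in_itv/= => /andP[ax xb].
  by rewrite derive1E; apply: derive_val; apply: dF; rewrite !ltW.
Qed.

End calculus.

Section integrable_real.
Context d (T : measurableType d) (R : realType).
Variable m : {measure set T -> \bar R}.
Implicit Types (D : set T) (f g : T -> R).

Lemma integrableRD D f g : measurable D ->
  m.-integrable D (EFin \o f) -> m.-integrable D (EFin \o g) ->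
  m.-integrable D (EFin \o (fun x => f x + g x)).
Proof. by move=> mD fi gi; apply: eq_integrable (integrableD mD fi gi). Qed.

Lemma integrableRB D f g : measurable D ->
  m.-integrable D (EFin \o f) -> m.-integrable D (EFin \o g) ->
  m.-integrable D (EFin \o (fun x => f x - g x)).
Proof. by move=> mD fi gi; apply: eq_integrable (integrableB mD fi gi). Qed.

Lemma integrableRZl D k f : measurable D ->
  m.-integrable D (EFin \o f) -> m.-integrable D (EFin \o (fun x => k * f x)).
Proof. by move=> mD fi; apply: eq_integrable (integrableZl mD k fi). Qed.

End integrable_real.

(** * The layer-cake bound *)

Section layer_cake.
Context d (T : measurableType d) (R : realType).
Variable m : {sigma_finite_measure set T -> \bar R}.

(** Writing [alpha x] as the length of the set of levels below it exchanges a
    weighted integral for an average of integrals over superlevel sets. *)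
Lemma layer_cake_bound (f alpha : T -> R) (M K : R) : 0 <= M ->
  m.-integrable setT (EFin \o f) -> measurable_fun setT alpha ->
  (forall x, 0 <= alpha x <= M) ->
  (forall l : R, 0 <= l -> `|\int[m]_(x in [set x | l < alpha x]) f x| <= K) ->
  `|\int[m]_x (f x * alpha x)| <= M * K.
Proof.
move=> M0 intf mal al0M HK.
have mf : measurable_fun setT f by move/integrableP : intf => [/measurable_EFinP].
pose mu := (@lebesgue_measure R).
pose A : set (T * measurableTypeR R) := [set z | (0 <= z.2) && (z.2 < alpha z.1)].
have mA : measurable A.
  have mb : measurable_fun [set: T * measurableTypeR R]
      (fun z => (0 <= z.2) && (z.2 < alpha z.1)).
    apply: measurable_and; [apply: measurable_fun_ler|apply: measurable_fun_ltr] => //.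
    exact: measurableT_comp.
  have := mb measurableT [set true] Logic.I; rewrite setTI.
  by congr measurable; apply/seteqP; split.
have Ax x : [set y | A (x, y)] = `[0, alpha x[%classic.
  by apply/seteqP; split => y; rewrite /A/= in_itv.
have Ai x y : \1_A (x, y) = \1_(`[0, alpha x[%classic) y :> R.
  by rewrite -Ax !indicE; congr (_%:R)%R; apply/idP/idP; rewrite !inE.
have muA x : mu `[0, alpha x[%classic = (alpha x)%:E.
  rewrite /mu lebesgue_measure_itv/= lte_fin.
  have /andP[] := al0M x; rewrite le_eqVlt => /predU1P[<- _|-> _]; first by rewrite ltxx.
  by rewrite -EFinB subr0.
pose g z : \bar R := (f z.1 * \1_A z)%:E.
have mg : measurable_fun setT g.
  apply/measurable_EFinP; apply: measurable_funM; first exact: measurableT_comp.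
  exact: measurable_indic.
have gx (h : T -> R) x : (\int[mu]_y (h x * \1_A (x, y))%:E = (h x * alpha x)%:E)%E.
  under eq_integral do rewrite Ai EFinM.
  rewrite integralZl//; last first.
    apply/integrableP; split.
      by apply/measurable_EFinP; exact: measurable_indic.
    under eq_integral do rewrite /= ger0_norm//.
    by rewrite integral_indic//= setIT -/mu muA ltry.
  by rewrite integral_indic//= setIT -/mu muA EFinM.
have ig : (m \x mu)%E.-integrable setT g.
  apply/integrable12ltyP => //.
  rewrite (eq_integral (fun x => (`|f x| * alpha x)%:E)); last first.
    move=> x _ /=; rewrite -(gx (fun x => `|f x|)); apply: eq_integral => y _.
    by rewrite /g/= normrM (ger0_norm (_ : 0 <= \1_A _))// indicE.
  apply: (@le_lt_trans _ _ (\int[m]_x (M%:E * `|(EFin \o f) x|)))%E.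
    apply: ge0_le_integral => //.
    - by move=> x _; rewrite lee_fin mulr_ge0//; have /andP[] := al0M x.
    - apply/measurable_EFinP; apply: measurable_funM => //.
      exact: measurableT_comp.
    - by apply: measurable_funeM; do 2 apply: measurableT_comp => //.
    - move=> x _; rewrite /= -EFinM lee_fin mulrC ler_wpM2r//.
      by have /andP[] := al0M x.
  rewrite ge0_integralZl//; last by do 2 apply: measurableT_comp => //.
  by rewrite lte_mul_pinfty//; have /integrableP[] := intf.
have := Fubini ig.
rewrite (eq_integral (fun x => (f x * alpha x)%:E)); last first.
  by move=> x _ /=; rewrite -gx.
move=> FB.
have inner l : (\int[m]_x g (x, l) =
   (if 0 <= l then \int[m]_(x in [set x | l < alpha x]) f x else 0)%:E)%E.
  have mS : measurable [set x | l < alpha x].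
    rewrite (_ : [set x | _] = setT `&` (alpha @^-1` `]l, +oo[)).
      exact: mal.
    by apply/seteqP; split => x; rewrite /= in_itv/= andbT => // -[].
  rewrite /Rintegral /g; case: ifP => l0; last first.
    by apply: integral0_eq => x _; rewrite indicE memNset ?mulr0// /A/= l0.
  rewrite fineK; last first.
    by apply: integrable_fin_num => //; exact: integrableS intf.
  rewrite [RHS]integral_mkcond; apply: eq_integral => x _.
  rewrite /g indicE restrict_EFin; congr EFin; rewrite /patch.
  case: ifPn => [|/negP] /[!inE]/= lx.
    by rewrite mem_set ?mulr1// /A/= l0.
  by rewrite memNset ?mulr0// /A/= => /andP[].
have bnd : (`|\int[m]_x (f x * alpha x)%:E| <= (M * K)%:E)%E.
  rewrite FB.
  have ml : measurable_fun setT (fun l => \int[m]_x g (x, l))%E.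
    exact: (measurable_fubini_G ig).
  apply: (le_trans (le_abse_integral _ _ _)) => //.
  apply: (@le_trans _ _ (\int[mu]_l (K * \1_(`[0%R, M[%classic) l)%:E))%E; last first.
    under eq_integral do rewrite EFinM.
    have K0 : 0 <= K by apply: le_trans (HK 0 (lexx _)); exact: normr_ge0.
    rewrite ge0_integralZl//.
    - rewrite integral_indic//= setIT lebesgue_measure_itv/= lte_fin.
      case: ltP => _; first by rewrite -EFinB subr0 -EFinM mulrC.
      by rewrite mule0 lee_fin mulr_ge0.
    - by apply/measurable_EFinP; exact: measurable_indic.
  apply: ge0_le_integral => //.
  - exact: measurableT_comp.
  - by apply/measurable_EFinP; apply: measurable_funM => //; exact: measurable_indic.
  - move=> l _; rewrite inner lee_fin indicE.
    case: ifPn => l0; last first.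
      by rewrite normr0 mulr_ge0//; apply: le_trans (HK 0 (lexx _)); exact: normr_ge0.
    have [lM|Ml] := ltP l M.
      by rewrite mem_set ?mulr1 ?HK//= in_itv/= l0 lM.
    rewrite (_ : [set x | l < alpha x] = set0); last first.
      apply/seteqP; split => x //=; rewrite ltNge; have /andP[_ /le_trans->//] := al0M x.
    by rewrite Rintegral_set0 normr0 memNset ?mulr0//= in_itv/= l0 ltNge Ml.
rewrite -lee_fin; apply: le_trans bnd; rewrite /Rintegral.
case: (\int[m]_x _)%E => [r||] //=; by rewrite ?leey// normr0 lee_fin.
Qed.

End layer_cake.

(** * The coordinate x + <x> *)

Section bracket.
Context {R : realType}.
Implicit Types x y : R.

Definition bracket x : R := Num.sqrt (1 + x ^+ 2).
(** [exp (arsinh x)]; it linearizes [y * x + t * bracket x] into a combination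
    of itself and its inverse. *)
Definition expash x : R := x + bracket x.
(** [sinh (ln y)], the inverse of [expash]. *)
Definition logsinh y : R := (y - y^-1) / 2.

Lemma bracket_sqr x : bracket x ^+ 2 = 1 + x ^+ 2.
Proof. by rewrite sqr_sqrtr// addr_ge0// sqr_ge0. Qed.

Lemma bracket_gt0 x : 0 < bracket x.
Proof. by rewrite sqrtr_gt0 ltr_pwDl// sqr_ge0. Qed.

Lemma bracket_ge1 x : 1 <= bracket x.
Proof. by rewrite -[leLHS]sqrtr1 ler_wsqrtr// lerDl sqr_ge0. Qed.

Lemma bracket_mono x y : 0 <= x -> x <= y -> bracket x <= bracket y.
Proof. by move=> x0 xy; rewrite ler_wsqrtr// lerD2l ler_sqr// nnegrE (le_trans x0). Qed.

Lemma ltr_bracket x : `|x| < bracket x.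
Proof. by rewrite -sqrtr_sqr ltr_sqrt ?ltrDr// ltr_pwDl// sqr_ge0. Qed.

Lemma expash_gt0 x : 0 < expash x.
Proof.
by have := ltr_bracket x; rewrite ltr_norml /expash => /andP[]; lra.
Qed.

Lemma expashV x : (expash x)^-1 = bracket x - x.
Proof.
apply: (mulfI (lt0r_neq0 (expash_gt0 x))); rewrite mulfV ?lt0r_neq0 ?expash_gt0//.
by rewrite /expash; have := bracket_sqr x; nra.
Qed.

Lemma expashK : cancel expash logsinh.
Proof. by move=> x; rewrite /logsinh expashV /expash; field. Qed.

Lemma logsinhK y : 0 < y -> expash (logsinh y) = y.
Proof.
move=> y0; rewrite /expash /bracket.
have -> : 1 + logsinh y ^+ 2 = ((y + y^-1) / 2) ^+ 2.
  by rewrite /logsinh; field; rewrite lt0r_neq0.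
rewrite sqrtr_sqr ger0_norm /logsinh; first by field; rewrite lt0r_neq0.
by rewrite divr_ge0// addr_ge0// ?invr_ge0 ltW.
Qed.

Lemma ltr_expash : {homo expash : x y / x < y}.
Proof.
move=> x y xy; rewrite ltNge; apply/negP => yx.
have := expashK x; have := expashK y; rewrite /logsinh.
have := yx; rewrite -(lef_pV2 (expash_gt0 x) (expash_gt0 y)).
by lra.
Qed.

Lemma ler_expash : {mono expash : x y / x <= y}.
Proof. exact/le_mono/ltr_expash. Qed.

Lemma is_derive_bracket x : is_derive x 1 bracket (x / bracket x).
Proof.
have p0 : 0 < 1 + x ^+ 2 by rewrite ltr_pwDl// sqr_ge0.
have -> : bracket = (@Num.sqrt R) \o (fun x => 1 + x ^+ 2) by [].
have H1 : is_derive x 1 (fun x : R => 1 + x ^+ 2) (2 * x).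
  by apply: is_derive_eq; rewrite /GRing.scale/=; ring.
have H2 := is_derive1_sqrt p0.
apply: is_derive_eq.
rewrite /GRing.scale/= -/(bracket x).
by field; rewrite lt0r_neq0 ?bracket_gt0.
Qed.

Lemma continuous_bracket : continuous bracket.
Proof.
by move=> x; exact: is_derive_continuous (is_derive_bracket x).
Qed.

Lemma is_derive_expash x : is_derive x 1 expash (expash x / bracket x).
Proof.
have H := is_derive_bracket x.
rewrite /expash; apply: is_derive_eq.
by field; rewrite lt0r_neq0 ?bracket_gt0.
Qed.

Lemma continuous_expash : continuous expash.
Proof.
by move=> x; exact: is_derive_continuous (is_derive_expash x).
Qed.

End bracket.

(** * A van der Corput estimate *)

Section intervals.
Context {R : realType}.
Notation mu := (@lebesgue_measure R).

Lemma Rintegral_interval_bound (f : R -> R) (S : set R) (a b K : R) :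
  0 <= K -> mu.-integrable `[a, b] (EFin \o f) ->
  is_interval S -> S `<=` `[a, b] ->
  (forall c d, a <= c -> c <= d -> d <= b -> `|\int[mu]_(x in `[c, d]) f x| <= K) ->
  `|\int[mu]_(x in S) f x| <= K.
Proof.
move=> K0 fi iS Sab H.
have [->|/set0P S0] := eqVneq S set0; first by rewrite Rintegral_set0 normr0.
have lS : has_lbound S by exists a => x /Sab/=; rewrite in_itv/= => /andP[].
have uS : has_ubound S by exists b => x /Sab/=; rewrite in_itv/= => /andP[].
have ac : a <= inf S by apply: lb_le_inf => // x /Sab/=; rewrite in_itv/= => /andP[].
have db : sup S <= b by apply: ge_sup => // x /Sab/=; rewrite in_itv/= => /andP[].
have cd : inf S <= sup S.
  by have [x Sx] := S0; rewrite (@le_trans _ _ x)//; [exact: ge_inf|exact: ub_le_sup].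
have := RhullK; move=> /(_ R S).
rewrite inE => /(_ iS) SE.
rewrite -[X in Rintegral _ X]SE.
have icd : mu.-integrable `[inf S, sup S] (EFin \o f).
  by apply: integrableS fi => //; apply: subset_itv; rewrite bnd_simp.
have ii b1 b2 : mu.-integrable [set` Interval (BSide b1 (inf S)) (BSide b2 (sup S))] (EFin \o f).
  apply: integrableS icd => //; apply: subset_itv; rewrite bnd_simp//.
suff -> : \int[mu]_(x in [set` Rhull S]) f x = \int[mu]_(x in `[inf S, sup S]) f x by exact: H.
rewrite /Rhull; case: ifPn => [_|/asboolP]//; case: ifPn => [_|/asboolP]//.
case: (~~ _) => /=; case: `[< _ >]; rewrite ?Rintegral_itv_obnd_cbnd ?Rintegral_itv_bndo_bndc//.
Qed.

(** Van der Corput's estimate for a monotone [g]: away from the resonant set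
    [|g| < delta] the integrand is the exact derivative of [sin phi] times the
    weight [1 / g], whose superlevel sets are intervals because [g] is monotone. *)
Lemma van_der_corput (phi g m : R -> R) (a b lo hi delta C : R) :
  a <= b -> lo <= hi -> 0 < delta ->
  (forall x : R, is_derive x 1 phi (g x / m x)) ->
  continuous m -> (forall x, 0 < m x) -> continuous g ->
  {in `[a, b] &, {homo g : x y / x <= y}} ->
  (forall x, a <= x <= b -> `|g x| < delta -> lo <= x <= hi) ->
  \int[mu]_(x in `[lo, hi]) (m x)^-1 <= C ->
  `|\int[mu]_(x in `[a, b]) (cos (phi x) / m x)| <= C + 4 / delta.
Proof.
move=> ab lohi d0 dphi cm m0 cg ndg box intC.
have cphi : continuous phi.
  by move=> x; exact: is_derive_continuous (dphi x).
have cminv : continuous (fun x => (m x)^-1).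
  by move=> x; apply: cvgV; [rewrite lt0r_neq0|exact: cm].
have mi x : 0 <= (m x)^-1 by rewrite invr_ge0 ltW.
pose f x := cos (phi x) * (g x / m x).
have cf : continuous f.
  move=> x; apply: cvgM; last by apply: cvgM; [exact: cg|exact: cminv].
  by apply: continuous_comp; [exact: cphi|exact: continuous_cos].
have dsin (x : R) : is_derive x 1 (fun x => sin (phi x)) (f x).
  have -> : (fun x => sin (phi x)) = sin \o phi by [].
  have H := dphi x; apply: is_derive_eq.
  by rewrite /GRing.scale/= /f mulrC.
have intf c d : mu.-integrable `[c, d] (EFin \o f).
  by apply: continuous_itv_integrable => x _; exact: cf.
have f2 c d : a <= c -> c <= d -> d <= b -> `|\int[mu]_(x in `[c, d]) f x| <= 2.
  move=> _ cd _; rewrite (@Rintegral_FTC _ (fun x => sin (phi x)))//; last by move=> x _; exact: cf.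
  have := sin_max (phi d); have := sin_max (phi c); rewrite !ler_norml.
  by move=> /andP[? ?] /andP[? ?]; apply/andP; split; lra.
have fS S : is_interval S -> S `<=` `[a, b] -> `|\int[mu]_(x in S) f x| <= 2.
  by move=> iS Sab; apply: (@Rintegral_interval_bound _ _ a b).
pose D : set (measurableTypeR R) := `[a, b]%classic.
have mD : measurable D by exact: measurable_itv.
have mg : measurable_fun setT g by exact: continuous_measurable_fun.
have half (h : R -> R) : measurable_fun setT h ->
   (forall x, D x -> 0 < h x -> delta <= `|g x| /\ h x = `|g x|^-1) ->
   (forall x, 0 <= h x) ->
   (forall l, 0 <= l -> is_interval (D `&` [set x | l < h x])) ->
  `|\int[mu]_(x in D) (f x * h x)| <= 2 / delta.
  move=> mh hg h0 ih.
  rewrite Rintegral_mkcond.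
  rewrite (_ : _ \_ D = fun x => (f \_ D) x * (h \_ D) x); last first.
    by apply/funext => x; rewrite /patch; case: ifP => //; rewrite mul0r.
  rewrite mulrC; apply: layer_cake_bound.
  - by rewrite invr_ge0 ltW.
  - rewrite -restrict_EFin; apply/(integrable_restrict _ _ measurableT) => //.
    by rewrite setTI; exact: intf.
  - by apply/(measurable_restrictT _ mD); exact: measurable_funS mh.
  - move=> x; rewrite /patch; case: ifPn => [/set_mem Dx|]; last by rewrite lexx invr_ge0 ltW.
    rewrite h0/=; have := h0 x; rewrite le_eqVlt => /predU1P[<-|hx]; first by rewrite invr_ge0 ltW.
    have [gd ->] := hg x Dx hx; rewrite lef_pV2// posrE//.
    exact: lt_le_trans gd.
  - move=> l l0.
    rewrite (_ : [set x | _] = D `&` [set x | l < h x]); last first.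
      apply/seteqP; split => x /=; rewrite /patch.
        by case: ifPn => [/set_mem Dx //|_]; rewrite ltNge l0.
      by move=> [Dx lx]; rewrite mem_set.
    rewrite [X in `|X|](_ : _ = \int[mu]_(x in D `&` [set x | l < h x]) f x).
      apply: fS; first exact: ih.
      by move=> x [].
    by apply: eq_Rintegral => x /set_mem[Dx _]; rewrite /patch mem_set.
(* The integral is split according to [g >= delta], [g <= - delta] and
   [|g| < delta]. *)
pose h1 x := if delta <= g x then (g x)^-1 else 0.
pose h2 x := if g x <= - delta then (- g x)^-1 else 0.
have minv (h : R -> R) : measurable_fun setT h -> measurable_fun setT (fun x => h x `^ (-1)).
  by move=> mh; apply: (measurableT_comp (measurable_powR _)).
have mh1 : measurable_fun setT h1.
  rewrite (_ : h1 = fun x => if delta <= g x then g x `^ (-1) else 0).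
    by apply: measurable_fun_ifT => //; [exact: measurable_fun_ler|exact: minv].
  apply/funext => x; rewrite /h1; case: ifP => // dg.
  by rewrite powR_inv1// (le_trans (ltW d0)).
have mh2 : measurable_fun setT h2.
  rewrite (_ : h2 = fun x => if g x <= - delta then (- g x) `^ (-1) else 0).
    apply: measurable_fun_ifT => //; first exact: measurable_fun_ler.
    by apply: minv; exact: measurableT_comp.
  apply/funext => x; rewrite /h2; case: ifP => // dg.
  by rewrite powR_inv1//; lra.
have H1 : `|\int[mu]_(x in D) (f x * h1 x)| <= 2 / delta.
  apply: half => //.
  - move=> x Dx; rewrite /h1; case: ifPn => [dg _|]; last by rewrite ltxx.
    by rewrite ger0_norm// (le_trans _ dg)// ltW.
  - by move=> x; rewrite /h1; case: ifPn => // dg; rewrite invr_ge0 (le_trans _ dg)// ltW.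
  - move=> l l0 x y [Dx lx] [Dy ly] z /andP[xz zy].
    have Dz : D z.
      by move: Dx Dy; rewrite /D/= !in_itv/= => /andP[ax _] /andP[_ yb]; rewrite (le_trans ax)// (le_trans zy).
    split => //=; move: lx ly; rewrite /= /h1.
    case: ifPn => [gx _|_]; last by rewrite ltNge l0.
    case: ifPn => [gy lgy|_]; last by rewrite ltNge l0.
    have gxz : g x <= g z by apply: ndg.
    have gzy : g z <= g y by apply: ndg.
    rewrite (le_trans gx gxz) (lt_le_trans lgy)// lef_pV2 ?posrE; lra.
have H2 : `|\int[mu]_(x in D) (f x * h2 x)| <= 2 / delta.
  apply: half => //.
  - move=> x Dx; rewrite /h2; case: ifPn => [dg _|]; last by rewrite ltxx.
    rewrite ler0_norm; last by lra.
    by split; [lra|].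
  - by move=> x; rewrite /h2; case: ifPn => // dg; rewrite invr_ge0; lra.
  - move=> l l0 x y [Dx lx] [Dy ly] z /andP[xz zy].
    have Dz : D z.
      by move: Dx Dy; rewrite /D/= !in_itv/= => /andP[ax _] /andP[_ yb]; rewrite (le_trans ax)// (le_trans zy).
    split => //=; move: lx ly; rewrite /= /h2.
    case: ifPn => [gx lgx|_]; last by rewrite ltNge l0.
    case: ifPn => [gy lgy|_]; last by rewrite ltNge l0.
    have gxz : g x <= g z by apply: ndg.
    have gzy : g z <= g y by apply: ndg.
    rewrite (le_trans gzy gy) (lt_le_trans lgx)// lef_pV2 ?posrE; lra.
pose h3 x := (if `|g x| < delta then cos (phi x) / m x else 0).
have mcm : measurable_fun setT (fun x => cos (phi x) / m x).
  apply: continuous_measurable_fun => x; apply: cvgM; last exact: cminv.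
  by apply: continuous_comp; [exact: cphi|exact: continuous_cos].
have mh3 : measurable_fun setT h3.
  apply: measurable_fun_ifT => //.
  by apply: measurable_fun_ltr => //; exact: measurableT_comp.
have iminv c d : mu.-integrable `[c, d] (EFin \o (fun x => (m x)^-1)).
  by apply: continuous_itv_integrable => x _; exact: cminv.
have ih3 : mu.-integrable D (EFin \o h3).
  apply: le_integrable (iminv a b) => //.
    by apply/measurable_EFinP; exact: measurable_funTS.
  move=> x _; rewrite lee_fin /h3 (ger0_norm (mi x)).
  case: ifP => _; last by rewrite normr0.
  by rewrite normrM (ger0_norm (mi x)) ler_piMl// cos_max.
have H3 : `|\int[mu]_(x in D) h3 x| <= C.
  apply: (le_trans (le_normr_Rintegral _ ih3)) => //.
  apply: le_trans intC.
  rewrite [leLHS]Rintegral_mkcond [leRHS]Rintegral_mkcond.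
  apply: le_Rintegral => //.
  - rewrite -restrict_EFin; apply/(integrable_restrict _ _ measurableT) => //.
    by rewrite setTI; exact: integrable_norm.
  - rewrite -restrict_EFin; apply/(integrable_restrict _ _ measurableT) => //.
    by rewrite setTI; exact: iminv.
  - move=> x _; rewrite /patch; case: ifPn => [/set_mem Dx|_]; last first.
      by case: ifP.
    rewrite /h3; case: ifPn => [gd|_]; last first.
      by rewrite normr0; case: ifP.
    rewrite mem_set; last by rewrite /= in_itv/=; apply: box => //; move: Dx; rewrite /D/= in_itv.
    by rewrite normrM (ger0_norm (mi x)) ler_piMl// cos_max.
have di : 0 <= delta^-1 by rewrite invr_ge0 ltW.
have ifh (h : R -> R) : measurable_fun setT h -> (forall x, `|h x| <= delta^-1) -> mu.-integrable D (EFin \o (fun x => f x * h x)).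
  move=> mh hd.
  have : mu.-integrable D (EFin \o (fun x => f x * delta^-1)).
    by apply: continuous_itv_integrable => x _; apply: cvgM; [exact: cf|exact: cvg_cst].
  apply: le_integrable => //.
    by apply/measurable_EFinP; apply: measurable_funTS; apply: measurable_funM => //; exact: continuous_measurable_fun.
  by move=> x _; rewrite lee_fin !normrM (ger0_norm di) ler_wpM2l.
have ih1 : mu.-integrable D (EFin \o (fun x => f x * h1 x)).
  apply: ifh => // x; rewrite /h1; case: ifP => [dg|_]; last by rewrite normr0.
  have g0 := lt_le_trans d0 dg; rewrite ger0_norm ?lef_pV2 ?posrE// invr_ge0 ltW//.
have ih2 : mu.-integrable D (EFin \o (fun x => f x * h2 x)).
  apply: ifh => // x; rewrite /h2; case: ifP => [dg|_]; last by rewrite normr0 invr_ge0 ltW.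
  rewrite ger0_norm ?invr_ge0 ?lef_pV2 ?posrE; lra.
rewrite [X in `|X|](_ : _ = \int[mu]_(x in D) (f x * h1 x - f x * h2 x + h3 x)); last first.
  apply: eq_Rintegral => x _; rewrite /f /h1 /h2 /h3.
  have mx := m0 x.
  case: (leP delta (g x)) => dg.
    rewrite ifF; last by apply/negbTE; rewrite -ltNge; lra.
    rewrite ifF; last by apply/negbTE; rewrite -leNgt (le_trans dg)// ler_norm.
    by field; rewrite !lt0r_neq0// (lt_le_trans d0).
  case: (leP (g x) (- delta)) => dg'.
    rewrite ifF; last by apply/negbTE; rewrite -leNgt ler0_norm; lra.
    have gx0 : g x != 0 by rewrite lt_eqF//; lra.
    have mx0 : m x != 0 by rewrite lt0r_neq0.
    by field; rewrite gx0 mx0.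
  by rewrite ifT ?ltr_norml ?dg' ?dg// !mulr0 subr0 add0r.
rewrite RintegralD// ?RintegralB//; last first.
  exact: integrableRB.
apply: (le_trans (ler_normD _ _)); rewrite addrC; apply: lerD => //.
apply: (le_trans (ler_normB _ _)).
have -> : 4 / delta = 2 / delta + 2 / delta by field; rewrite lt0r_neq0.
exact: lerD.
Qed.

End intervals.

(** * The phase a X + b / X + k ln X *)

Section core.
Context {R : realType}.
Notation mu := (@lebesgue_measure R).
Implicit Types a b k th x y : R.

Definition phase a b k th x : R :=
  a * expash x + b / expash x + k * ln (expash x) + th.

(** [bracket x] times the derivative of [phase]. *)
Definition speed a b k x : R := a * expash x - b / expash x + k.

Lemma is_derive_phase a b k th x :
  is_derive x 1 (phase a b k th) (speed a b k x / bracket x).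
Proof.
have X0 := expash_gt0 x; have m0 := bracket_gt0 x.
have H := is_derive_expash x.
have XV : is_derive x 1 (fun x => (expash x)^-1) (- (expash x) ^- 2 *: (expash x / bracket x)).
  by apply: is_deriveV; rewrite lt0r_neq0.
have L : is_derive x 1 (fun x => ln (expash x)) ((expash x)^-1 * (expash x / bracket x)).
  have -> : (fun x => ln (expash x)) = (@ln R) \o expash by [].
  by have := is_derive1_ln X0 => L; apply: is_derive_eq; rewrite /GRing.scale/= mulrC.
rewrite /phase; apply: is_derive_eq.
rewrite /GRing.scale/= /speed.
by field; rewrite !lt0r_neq0.
Qed.

Lemma continuous_speed a b k : continuous (speed a b k).
Proof.
move=> x; apply: cvgD; last exact: cvg_cst.
apply: cvgB; first by apply: cvgM; [exact: cvg_cst|exact: continuous_expash].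
apply: cvgM; first exact: cvg_cst.
by apply: cvgV; [rewrite lt0r_neq0 ?expash_gt0|exact: continuous_expash].
Qed.

Lemma Rintegral_inv_bracket a b : a <= b ->
  \int[mu]_(x in `[a, b]) (bracket x)^-1 = ln (expash b) - ln (expash a).
Proof.
move=> ab; apply: (@Rintegral_FTC _ (fun x => ln (expash x))) => // x _.
  have := is_derive_phase 0 0 1 0 x.
  rewrite /phase /speed !mul0r sub0r oppr0 add0r mul1r.
  by congr is_derive; apply/funext => y; rewrite /phase !mul0r !add0r mul1r addr0.
by apply: cvgV; [rewrite lt0r_neq0 ?bracket_gt0|exact: continuous_bracket].
Qed.

Lemma logsinh_mono x y : 0 < x -> x <= y -> logsinh x <= logsinh y.
Proof.
by move=> x0 xy; rewrite -ler_expash !logsinhK// (lt_le_trans x0).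
Qed.

(** [G X = a X - b / X] satisfies [G X + G Y = (X + Y) (a - b / (X Y))], while
    at the geometric mean [G (sqrt (X Y)) = sqrt (X Y) (a - b / (X Y))]; so if
    all three values have the same sign and are comparable, so are [X] and [Y]. *)
Lemma resonance_ratio a b k x y : k != 0 -> x <= y ->
  (forall z, x <= z <= y -> `|speed a b k z| < `|k| / 2) ->
  expash y <= 36 * expash x.
Proof.
move=> k0 xy H.
have X0 := expash_gt0 x; have Y0 := expash_gt0 y.
pose X := Num.sqrt (expash x); pose Y := Num.sqrt (expash y).
have eX : expash x = X ^+ 2 by rewrite sqr_sqrtr// ltW.
have eY : expash y = Y ^+ 2 by rewrite sqr_sqrtr// ltW.
have Xp : 0 < X by rewrite sqrtr_gt0.
have Yp : 0 < Y by rewrite sqrtr_gt0.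
have XY : X <= Y by rewrite ler_wsqrtr// ler_expash.
pose z := logsinh (X * Y).
have ez : expash z = X * Y by rewrite logsinhK// mulr_gt0.
have xzy : x <= z <= y.
  by rewrite -(ler_expash x) -(ler_expash z y) ez eX eY !expr2 ler_pM2l// ler_pM2r// XY.
have := H _ xzy; have := H x; have := H y; rewrite !lexx xy => /(_ isT) + /(_ isT).
rewrite /speed ez eX eY !ltr_norml.
set q := a - b / (X ^+ 2 * Y ^+ 2).
have E1 : a * (X * Y) - b / (X * Y) = X * Y * q by rewrite /q; field; rewrite !lt0r_neq0.
have E2 : (a * X ^+ 2 - b / X ^+ 2) + (a * Y ^+ 2 - b / Y ^+ 2) = (X ^+ 2 + Y ^+ 2) * q.
  by rewrite /q; field; rewrite !lt0r_neq0.
rewrite E1 => /andP[Hy1 Hy2] /andP[Hx1 Hx2] /andP[Hz1 Hz2].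
suff h6 : Y <= 6 * X by nra.
have XYp : 0 < X * Y by rewrite mulr_gt0.
have S0 : 0 < X ^+ 2 + Y ^+ 2 by rewrite addr_gt0// exprn_gt0.
(* Each of the three values is between [|k| / 2] and [3 |k| / 2] in size, so the
   sum of two is at most six times the third. *)
have big : X ^+ 2 + Y ^+ 2 <= 6 * (X * Y).
  rewrite leNgt; apply/negP => lt6.
  have [kp|kn|k00] := ltgtP 0 k; last by rewrite -k00 eqxx in k0.
  - rewrite gtr0_norm// in Hy1 Hy2 Hx1 Hx2 Hz1 Hz2.
    have qn : q < 0.
      by rewrite -(pmulr_rlt0 _ XYp); lra.
    have : (X ^+ 2 + Y ^+ 2) * q < 6 * (X * Y) * q by rewrite ltr_nM2r.
    by move: E2; lra.
  - rewrite ltr0_norm// in Hy1 Hy2 Hx1 Hx2 Hz1 Hz2.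
    have qp : 0 < q.
      by rewrite -(pmulr_rgt0 _ XYp); lra.
    have : 6 * (X * Y) * q < (X ^+ 2 + Y ^+ 2) * q by rewrite ltr_pM2r.
    by move: E2; lra.
by rewrite -(ler_pM2r Yp); have := sqr_ge0 X; move: big; rewrite !expr2; lra.
Qed.

Definition core_bound k : R := 2 * ln 36 + 8 / `|k|.

(** By [resonance_ratio] the resonant set lies in an interval whose measure for
    [dx / bracket x], that is for [d (ln X)], is [2 ln 36]. *)
Lemma core_monotone a b k th c d : k != 0 -> c <= d ->
  {in `[c, d] &, {homo speed a b k : x y / x <= y}} ->
  `|\int[mu]_(x in `[c, d]) (cos (phase a b k th x) / bracket x)| <= core_bound k.
Proof.
move=> k0 cd nd.
have d0 : 0 < `|k| / 2 by rewrite divr_gt0// normr_gt0.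
have -> : core_bound k = 2 * ln 36 + 4 / (`|k| / 2).
  by rewrite /core_bound; field; rewrite normr_eq0.
have l36 : 0 <= ln 36 :> R by rewrite ln_ge0// ler1n.
have [[x0 /andP[cx0 x0d] gx0]|none] :=
    pselect (exists2 x, c <= x <= d & `|speed a b k x| < `|k| / 2); last first.
  apply: (@van_der_corput _ _ (speed a b k) _ c d 0 0) => //.
  - exact: is_derive_phase.
  - exact: continuous_bracket.
  - exact: bracket_gt0.
  - exact: continuous_speed.
  - by move=> x xcd gx; exfalso; apply: none; exists x.
  - by rewrite Rintegral_inv_bracket// subrr mulr_ge0.
have X0 := expash_gt0 x0.
have Xd : 0 < expash x0 / 36 by rewrite divr_gt0.
have Xm : 0 < expash x0 * 36 by rewrite mulr_gt0.
have lohi : logsinh (expash x0 / 36) <= logsinh (expash x0 * 36).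
  by apply: logsinh_mono => //; lra.
apply: (@van_der_corput _ _ (speed a b k) _ c d (logsinh (expash x0 / 36)) (logsinh (expash x0 * 36))) => //.
- exact: is_derive_phase.
- exact: continuous_bracket.
- exact: bracket_gt0.
- exact: continuous_speed.
- move=> x /andP[cx xd] gx; rewrite -(ler_expash _ x) -(ler_expash x) !logsinhK//.
  have conv u v z : c <= u -> v <= d -> `|speed a b k u| < `|k| / 2 ->
      `|speed a b k v| < `|k| / 2 -> u <= z <= v -> `|speed a b k z| < `|k| / 2.
    move=> cu vd; rewrite !ltr_norml => /andP[u1 u2] /andP[v1 v2] /andP[uz zv].
    have Iz w : u <= w -> w <= v -> w \in `[c, d].
      by move=> uw wv; rewrite in_itv/= (le_trans cu)// (le_trans wv).
    have uz' := nd _ _ (Iz u (lexx _) (le_trans uz zv)) (Iz _ uz zv) uz.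
    have zv' := nd _ _ (Iz _ uz zv) (Iz v (le_trans uz zv) (lexx _)) zv.
    by rewrite (lt_le_trans u1)//= (le_lt_trans zv').
  have [xx0|x0x] := leP x x0.
    have := @resonance_ratio a b k x x0 k0 xx0 (fun z => conv x x0 z cx x0d gx gx0).
    have : expash x <= expash x0 by rewrite ler_expash.
    by move=> ? ?; apply/andP; split; lra.
  have := @resonance_ratio a b k x0 x k0 (ltW x0x) (fun z => conv x0 x z cx0 xd gx0 gx).
  have : expash x0 <= expash x by rewrite ler_expash ltW.
  by move=> ? ?; apply/andP; split; lra.
- rewrite Rintegral_inv_bracket// !logsinhK// ln_div ?posrE// lnM ?posrE//.
  by lra.
Qed.

Lemma core_antitone a b k th c d : k != 0 -> c <= d ->
  {in `[c, d] &, {homo speed a b k : x y /~ x <= y}} ->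
  `|\int[mu]_(x in `[c, d]) (cos (phase a b k th x) / bracket x)| <= core_bound k.
Proof.
move=> k0 cd nd.
have -> : core_bound k = core_bound (- k) by rewrite /core_bound normrN.
rewrite [X in `|X|](_ : _ = \int[mu]_(x in `[c, d]) (cos (phase (- a) (- b) (- k) (- th) x) / bracket x)).
  apply: core_monotone => //; first by rewrite oppr_eq0.
  move=> x y xI yI xy; have := nd _ _ yI xI xy.
  by rewrite /speed !mulNr; lra.
apply: eq_Rintegral => x _; congr (_ / _); rewrite -cosN; congr cos.
by rewrite /phase; ring.
Qed.

Lemma speedB a b k x y :
  speed a b k y - speed a b k x = (expash y - expash x) * (a + b / (expash x * expash y)).
Proof.
have X0 := expash_gt0 x; have Y0 := expash_gt0 y.
by rewrite /speed; field; rewrite !lt0r_neq0.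
Qed.

Lemma integrable_cos_phase a b k th c d :
  mu.-integrable `[c, d] (EFin \o (fun x => cos (phase a b k th x) / bracket x)).
Proof.
apply: continuous_itv_integrable => x _.
apply: cvgM; last by apply: cvgV; [rewrite lt0r_neq0 ?bracket_gt0|exact: continuous_bracket].
apply: continuous_comp; last exact: continuous_cos.
exact: is_derive_continuous (is_derive_phase a b k th x).
Qed.

Lemma Rintegral_itv_split (f : R -> R) a b c : a <= b -> b <= c ->
  mu.-integrable `[a, c] (EFin \o f) ->
  \int[mu]_(x in `[a, c]) f x = \int[mu]_(x in `[a, b]) f x + \int[mu]_(x in `[b, c]) f x.
Proof.
move=> ab bc fi.
have := @Rintegral_itvB _ f (BLeft a) (BRight c) b fi; rewrite !bnd_simp => /(_ ab bc).
rewrite Rintegral_itv_obnd_cbnd; first by lra.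
by apply: integrableS fi => //; apply: subset_itvr; rewrite bnd_simp.
Qed.

(** The speed is monotone in [x], or changes monotonicity once, where
    [expash x ^+ 2 = - b / a]. *)
Lemma core_estimate a b k th c d : k != 0 -> c <= d ->
  `|\int[mu]_(x in `[c, d]) (cos (phase a b k th x) / bracket x)| <= 2 * core_bound k.
Proof.
move=> k0 cd.
have cb0 : 0 <= core_bound k.
  by rewrite addr_ge0// ?divr_ge0// mulr_ge0// ln_ge0// ler1n.
wlog b0 : a b k th k0 cb0 / 0 <= b.
  move=> H; have [b0|b0] := leP 0 b; first exact: H.
  have -> : core_bound k = core_bound (- k) by rewrite /core_bound normrN.
  rewrite [X in `|X|](_ : _ = \int[mu]_(x in `[c, d]) (cos (phase (- a) (- b) (- k) (- th) x) / bracket x)).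
    by apply: H; rewrite ?oppr_eq0// ?/core_bound ?normrN//; lra.
  apply: eq_Rintegral => x _; congr (_ / _); rewrite -cosN; congr cos.
  by rewrite /phase; ring.
have ndspeed u v : u <= v -> (forall x y, u <= x -> x <= y -> y <= v -> 0 <= a + b / (expash x * expash y)) ->
    {in `[u, v] &, {homo speed a b k : x y / x <= y}}.
  move=> uv H x y /[!in_itv]/= /andP[ux xv] /andP[uy yv] xy.
  rewrite -subr_ge0 speedB mulr_ge0//; last exact: H.
  by rewrite subr_ge0 ler_expash.
have nispeed u v : u <= v -> (forall x y, u <= x -> x <= y -> y <= v -> a + b / (expash x * expash y) <= 0) ->
    {in `[u, v] &, {homo speed a b k : x y /~ x <= y}}.
  move=> uv H y x /[!in_itv]/= /andP[uy yv] /andP[ux xv] xy.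
  rewrite -subr_le0 speedB mulr_ge0_le0//; last exact: H.
  by rewrite subr_ge0 ler_expash.
have XX x y : 0 < expash x * expash y by rewrite mulr_gt0// expash_gt0.
have [a0|a0] := leP 0 a.
  apply: (le_trans (core_monotone th k0 cd _)); last by lra.
  by apply: ndspeed => // x y _ _ _; rewrite addr_ge0// divr_ge0// ltW.
pose z := logsinh (Num.sqrt (b / - a)).
have [b00|bp] := eqVneq b 0.
  apply: (le_trans (core_antitone th k0 cd _)); last by lra.
  by apply: nispeed => // x y _ _ _; rewrite b00 mul0r addr0 ltW.
have {}b0 : 0 < b by rewrite lt_neqAle eq_sym bp.
have ba0 : 0 < b / - a by rewrite divr_gt0// oppr_gt0.
have ez : expash z ^+ 2 = b / - a by rewrite logsinhK ?sqrtr_gt0// sqr_sqrtr// ltW.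
have Z0 := expash_gt0 z.
have low x y : x <= y -> y <= z -> 0 <= a + b / (expash x * expash y).
  move=> xy yz.
  have h : expash x * expash y <= b / - a.
    rewrite -ez expr2 ler_pM ?(ltW (expash_gt0 _)) ?ler_expash//.
    exact: le_trans yz.
  have : - a <= b / (expash x * expash y).
    rewrite ler_pdivlMr// mulrC -ler_pdivlMr ?oppr_gt0//.
  by lra.
have high x y : z <= x -> x <= y -> a + b / (expash x * expash y) <= 0.
  move=> zx xy.
  have h : b / - a <= expash x * expash y.
    rewrite -ez expr2 ler_pM ?(ltW (expash_gt0 _)) ?ler_expash//.
    exact: le_trans xy.
  have : b / (expash x * expash y) <= - a.
    rewrite ler_pdivrMr// mulrC -ler_pdivrMr ?oppr_gt0//.
  by lra.
have [zc|cz] := leP z c.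
  apply: (le_trans (core_antitone th k0 cd _)); last by lra.
  by apply: nispeed => // x y cx xy _; apply: high => //; exact: le_trans cx.
have [dz|zd] := leP d z.
  apply: (le_trans (core_monotone th k0 cd _)); last by lra.
  by apply: ndspeed => // x y _ xy yd; apply: low => //; exact: le_trans dz.
rewrite (Rintegral_itv_split (ltW cz) (ltW zd)); last exact: integrable_cos_phase.
apply: (le_trans (ler_normD _ _)).
have -> : 2 * core_bound k = core_bound k + core_bound k by ring.
apply: lerD.
  apply: core_monotone => //; first exact: ltW.
  by apply: (ndspeed _ _ (ltW cz)) => x y _ xy yz; exact: low.
apply: core_antitone => //; first exact: ltW.
by apply: (nispeed _ _ (ltW zd)) => x y zx xy _; exact: high.
Qed.

End core.

(** * Bounded variation on the half-line *)

Section bounded_variation.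
Context {R : realType}.
Implicit Types (M A : R) (f g h b c : R -> R).

Definition monotone_upto M b : Prop :=
  (forall x y, 0 <= x -> x <= y -> b x <= b y) /\
  (forall x, 0 <= x -> 0 <= b x <= M).

(** Bounded variation on the half-line, in Jordan's form: sums and products stay
    in the class with explicit constants, and the layer-cake bound applies to
    both monotone parts. *)
Definition bv M f : Prop :=
  exists b c, [/\ monotone_upto M b, monotone_upto M c &
                  forall x, 0 <= x -> f x = b x - c x].

Lemma monotone_upto_ge0 M b : monotone_upto M b -> 0 <= M.
Proof. by move=> [_ /(_ 0 (lexx _)) /andP[]]; exact: le_trans. Qed.

Lemma bv_ge0 M f : bv M f -> 0 <= M.
Proof. by move=> [b [c [Hb _ _]]]; exact: monotone_upto_ge0 Hb. Qed.

Lemma monotone_upto_cst M : 0 <= M -> monotone_upto M (fun=> M).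
Proof. by move=> M0; split => // x _; rewrite M0 lexx. Qed.

Lemma bv_monotone M b : monotone_upto M b -> bv M b.
Proof.
move=> Hb; exists b, (fun=> 0); split => //; last by move=> x _; rewrite subr0.
by split => // x _; rewrite lexx (monotone_upto_ge0 Hb).
Qed.

Lemma eq_bv M f g : (forall x, 0 <= x -> f x = g x) -> bv M f -> bv M g.
Proof.
by move=> fg [b [c [Hb Hc E]]]; exists b, c; split => // x x0; rewrite -fg// E.
Qed.

Lemma bvN M f : bv M f -> bv M (fun x => - f x).
Proof. by move=> [b [c [Hb Hc E]]]; exists c, b; split => // x x0; rewrite E// opprB. Qed.

Lemma monotone_uptoD M M' b c : monotone_upto M b -> monotone_upto M' c ->
  monotone_upto (M + M') (fun x => b x + c x).
Proof.
move=> [nb Mb] [nc Mc]; split=> [x y x0 xy|x x0]; first by rewrite lerD ?nb ?nc.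
have /andP[b0 bM] := Mb x x0; have /andP[c0 cM] := Mc x x0.
by rewrite addr_ge0//= lerD.
Qed.

Lemma monotone_uptoM M M' b c : monotone_upto M b -> monotone_upto M' c ->
  monotone_upto (M * M') (fun x => b x * c x).
Proof.
move=> [nb Mb] [nc Mc]; split=> [x y x0 xy|x x0].
  have /andP[b0 bM] := Mb x x0; have /andP[c0 cM] := Mc x x0.
  by rewrite ler_pM ?nb ?nc.
have /andP[b0 bM] := Mb x x0; have /andP[c0 cM] := Mc x x0.
by rewrite mulr_ge0//= ler_pM.
Qed.

Lemma bvD M M' f g : bv M f -> bv M' g -> bv (M + M') (fun x => f x + g x).
Proof.
move=> [b [c [Hb Hc E]]] [b' [c' [Hb' Hc' E']]].
exists (fun x => b x + b' x), (fun x => c x + c' x).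
by split; [exact: monotone_uptoD|exact: monotone_uptoD|move=> x x0; rewrite E// E'//; ring].
Qed.

Lemma bvB M M' f g : bv M f -> bv M' g -> bv (M + M') (fun x => f x - g x).
Proof. by move=> Hf /bvN; exact: bvD. Qed.

Lemma bvM M M' f g : bv M f -> bv M' g -> bv (2 * M * M') (fun x => f x * g x).
Proof.
move=> [b [c [Hb Hc E]]] [b' [c' [Hb' Hc' E']]].
exists (fun x => b x * b' x + c x * c' x), (fun x => b x * c' x + c x * b' x).
have -> : 2 * M * M' = M * M' + M * M' by ring.
split; last by move=> x x0; rewrite E// E'//; ring.
  by apply: monotone_uptoD; exact: monotone_uptoM.
by apply: monotone_uptoD; exact: monotone_uptoM.
Qed.

Lemma bv_cst k : bv `|k| (fun=> k).
Proof.
have Hk : bv `|k| (fun=> `|k|) by apply: bv_monotone; exact: monotone_upto_cst.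
have [k0|k0] := leP 0 k; first by rewrite (ger0_norm k0) in Hk *.
have := bvN Hk; rewrite (ltr0_norm k0).
by apply: eq_bv => x _; rewrite opprK.
Qed.

Lemma bvZ k M f : bv M f -> bv (2 * `|k| * M) (fun x => k * f x).
Proof. by move=> Hf; apply: bvM => //; exact: bv_cst. Qed.

(** A Lipschitz function becomes nondecreasing after adding a multiple of the
    identity. *)
Lemma bv_lipschitz (lo A L : R) (f h : R -> R) :
  (forall x y, 0 <= x -> x <= y -> h x <= h y) ->
  (forall x, 0 <= x -> lo < h x <= 1) ->
  (forall x, lo < x <= 1 -> `|f x| <= A) -> 0 <= L ->
  (forall x y, lo < x -> x <= y -> y <= 1 -> `|f x - f y| <= L * (y - x)) ->
  bv (L * (1 - lo) + 2 * A) (fun x => f (h x)).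
Proof.
move=> nh hh fA L0 fL.
exists (fun x => f (h x) + L * (h x - lo) + A), (fun x => L * (h x - lo) + A).
split; last by move=> x x0; ring.
- split=> [x y x0 xy|x x0].
    have hxy := nh _ _ x0 xy.
    have /andP[hx _] := hh x x0.
    have /andP[_ hy] := hh y (le_trans x0 xy).
    by have := fL _ _ hx hxy hy; rewrite ler_norml => /andP[]; lra.
  have hx := hh x x0; have := fA _ hx; rewrite ler_norml => /andP[f1 f2].
  move: hx => /andP[h1 h2].
  have : L * (h x - lo) <= L * (1 - lo) by rewrite ler_wpM2l// lerB.
  have : 0 <= L * (h x - lo) by rewrite mulr_ge0// subr_ge0 ltW.
  by move=> ? ?; apply/andP; split; lra.
- split=> [x y x0 xy|x x0].
    by have hxy := nh _ _ x0 xy; rewrite lerD2r ler_wpM2l// lerB.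
  have hx := hh x x0; have := fA _ hx; rewrite ler_norml => /andP[f1 f2].
  move: hx => /andP[h1 h2].
  have : L * (h x - lo) <= L * (1 - lo) by rewrite ler_wpM2l// lerB.
  have : 0 <= L * (h x - lo) by rewrite mulr_ge0// subr_ge0 ltW.
  by move=> ? ?; apply/andP; split; lra.
Qed.

Lemma lipschitz_derive (lo L : R) (f df : R -> R) :
  (forall x, lo < x <= 1 -> is_derive x 1 f (df x)) ->
  (forall x, lo < x <= 1 -> `|df x| <= L) ->
  forall x y, lo < x -> x <= y -> y <= 1 -> `|f x - f y| <= L * (y - x).
Proof.
move=> Hd HL x y lx xy y1.
have I z : z \in `]x, y[ -> lo < z <= 1.
  by rewrite in_itv/= => /andP[xz zy]; rewrite (lt_trans lx)//= (le_trans (ltW zy)).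
have [|z zI E] := @MVT_segment _ f df x y xy (fun z zI => Hd _ (I z zI)).
  apply: continuous_in_subspaceT => z; rewrite inE/= in_itv/= => /andP[xz zy].
  by apply: is_derive_continuous (Hd z _); rewrite (lt_le_trans lx)//= (le_trans zy).
rewrite distrC E normrM (ger0_norm (_ : 0 <= y - x)) ?subr_ge0// ler_wpM2r ?subr_ge0//.
by apply: HL; move: zI; rewrite in_itv/= => /andP[xz zy]; rewrite (lt_le_trans lx)//= (le_trans zy).
Qed.

End bounded_variation.

(** * Oscillatory integrals with a weight of bounded variation *)

Section weights.
Context {R : realType}.
Notation mu := (@lebesgue_measure R).
Implicit Types (M L K : R).

Lemma monotone_upto_measurable M L (b : R -> R) :
  monotone_upto M b -> measurable_fun (`[0, L]%classic : set R) b.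
Proof.
move=> [nb _].
apply: (@eq_measurable_fun _ _ (measurableTypeR R) R _ (fun x => b (Num.max 0 x))).
  by move=> x /set_mem/=; rewrite in_itv/= => /andP[x0 _]; rewrite max_r.
apply: nondecreasing_measurable => // x y xy.
apply: nb; first by rewrite le_max lexx.
by rewrite ge_max !le_max lexx xy orbT.
Qed.

Lemma bv_measurable M L (f : R -> R) : bv M f -> measurable_fun (`[0, L]%classic : set R) f.
Proof.
move=> [b [c [Hb Hc E]]].
apply: (@eq_measurable_fun _ _ (measurableTypeR R) R _ (fun x => b x - c x)).
  by move=> x /set_mem/=; rewrite in_itv/= => /andP[x0 _]; rewrite E.
apply: measurable_funB; first exact: (monotone_upto_measurable Hb).
exact: (monotone_upto_measurable Hc).
Qed.

Lemma bv_bounded M (f : R -> R) x : bv M f -> 0 <= x -> `|f x| <= M.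
Proof.
move=> [b [c [[_ Hb] [_ Hc] E]]] x0; rewrite E// ler_norml.
have /andP[? ?] := Hb x x0; have /andP[? ?] := Hc x x0.
by apply/andP; split; lra.
Qed.

Lemma bv_integrable M L (f h : R -> R) :
  mu.-integrable `[0, L] (EFin \o f) -> bv M h ->
  mu.-integrable `[0, L] (EFin \o (fun x => f x * h x)).
Proof.
move=> fi bh; have mf : measurable_fun (`[0, L]%classic : set R) f.
  by apply/measurable_EFinP; exact: (measurable_int mu).
have fi' : mu.-integrable `[0, L] (EFin \o (fun x => M * f x)).
  by apply: integrableRZl.
apply: le_integrable fi' => //.
  by apply/measurable_EFinP; apply: measurable_funM => //; exact: bv_measurable bh.
move=> x; rewrite /= in_itv/= => /andP[x0 _]; rewrite lee_fin mulrC !normrM ler_wpM2r//.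
by rewrite (ger0_norm (bv_ge0 bh)) (bv_bounded bh).
Qed.

(** Superlevel sets of a monotone weight are intervals. *)
Lemma monotone_weight M L K (f b : R -> R) :
  0 <= K -> mu.-integrable `[0, L] (EFin \o f) ->
  (forall c d, 0 <= c -> c <= d -> d <= L -> `|\int[mu]_(x in `[c, d]) f x| <= K) ->
  monotone_upto M b ->
  `|\int[mu]_(x in `[0, L]) (f x * b x)| <= M * K.
Proof.
move=> K0 fi HK Hb; have M0 := monotone_upto_ge0 Hb; have [nb Mb] := Hb.
pose D : set (measurableTypeR R) := `[0, L]%classic.
have mD : measurable D by exact: measurable_itv.
rewrite [X in `|X|]Rintegral_mkcond.
rewrite [X in `|X|](_ : _ = \int[mu]_x ((f \_ D) x * (b \_ D) x)); last first.
  by apply: eq_Rintegral => x _; rewrite /patch; case: ifP => // _; rewrite mul0r.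
apply: layer_cake_bound => //.
- rewrite -restrict_EFin; apply/(integrable_restrict _ _ measurableT) => //.
  by rewrite setTI.
- apply/(measurable_restrictT _ mD).
  exact: (monotone_upto_measurable Hb).
- move=> x; rewrite /patch; case: ifPn => [/set_mem|_]; last by rewrite lexx.
  by rewrite /D/= in_itv/= => /andP[/Mb].
- move=> l l0.
  rewrite (_ : [set x | _] = D `&` [set x | l < b x]); last first.
    apply/seteqP; split => x /=; rewrite /patch.
      by case: ifPn => [/set_mem Dx //|_]; rewrite ltNge l0.
    by move=> [Dx lx]; rewrite mem_set.
  rewrite [X in `|X|](_ : _ = \int[mu]_(x in D `&` [set x | l < b x]) f x); last first.
    by apply: eq_Rintegral => x /set_mem[Dx _]; rewrite /patch mem_set.
  apply: (@Rintegral_interval_bound _ _ _ 0 L) => //.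
    move=> x y [Dx lx] [Dy ly] z /andP[xz zy].
    move: Dx Dy; rewrite /D/= !in_itv/= => /andP[x0 _] /andP[_ yL].
    split; first by rewrite /= (le_trans x0)// (le_trans zy).
    by rewrite /= (lt_le_trans lx)// nb.
Qed.

Lemma bv_weight M L K (f h : R -> R) :
  0 <= K -> mu.-integrable `[0, L] (EFin \o f) ->
  (forall c d, 0 <= c -> c <= d -> d <= L -> `|\int[mu]_(x in `[c, d]) f x| <= K) ->
  bv M h ->
  `|\int[mu]_(x in `[0, L]) (f x * h x)| <= 2 * M * K.
Proof.
move=> K0 fi HK [b [c [Hb Hc E]]].
rewrite [X in `|X|](_ : _ = \int[mu]_(x in `[0, L]) (f x * b x - f x * c x)); last first.
  apply: eq_Rintegral => x /set_mem/=; rewrite in_itv/= => /andP[x0 _].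
  by rewrite E// mulrBr.
have ib := bv_integrable fi (bv_monotone Hb); have ic := bv_integrable fi (bv_monotone Hc).
rewrite RintegralB//.
apply: (le_trans (ler_normB _ _)).
have -> : 2 * M * K = M * K + M * K by ring.
by apply: lerD; exact: monotone_weight.
Qed.

Lemma phase_weight M L a b k th (h : R -> R) : k != 0 -> bv M h ->
  `|\int[mu]_(x in `[0, L]) (cos (phase a b k th x) / bracket x * h x)|
    <= 4 * M * core_bound k.
Proof.
move=> k0 bh.
have -> : 4 * M * core_bound k = 2 * M * (2 * core_bound k) by ring.
apply: bv_weight => //.
- by rewrite mulr_ge0// addr_ge0// ?divr_ge0// mulr_ge0// ln_ge0// ler1n.
- exact: integrable_cos_phase.
- by move=> c d _ cd _; exact: core_estimate.
Qed.

End weights.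

(** * The oscillatory integral of one slice *)

Section weighted_oscillation.
Context {R : realType}.
Notation mu := (@lebesgue_measure R).
Implicit Types (s p k th x y t : R).

Definition ratio s x : R := bracket x / (bracket x + s).

Lemma ratio_itv s x : 0 <= s -> 0 < ratio s x <= 1.
Proof.
move=> s0; have m0 := bracket_gt0 x.
have ms : 0 < bracket x + s by rewrite ltr_pwDl.
by rewrite divr_gt0//= ler_pdivrMr// mul1r lerDl.
Qed.

Lemma ratio_mono s x y : 0 <= s -> 0 <= x -> x <= y -> ratio s x <= ratio s y.
Proof.
move=> s0 x0 xy; have m0 := bracket_gt0 x; have m1 := bracket_gt0 y.
have h : bracket x <= bracket y by exact: bracket_mono.
rewrite ler_pdivrMr ?ltr_pwDl// mulrAC ler_pdivlMr ?ltr_pwDl//.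
by have := ler_wpM2l s0 h; nra.
Qed.

(** What remains of [expash x] after division by [bracket x]: on the half-line
    [x >= 0], a monotone factor with values between 1/4 and 1. *)
Definition half_expash x : R := expash x / (2 * bracket x).

Lemma half_expash_itv x : 0 <= x -> 4^-1 < half_expash x <= 1.
Proof.
move=> x0; have m0 := bracket_gt0 x; have := ltr_bracket x; rewrite ger0_norm// => xm.
rewrite /half_expash ltr_pdivlMr ?ler_pdivrMr ?mulr_gt0// /expash.
by apply/andP; split; lra.
Qed.

Lemma half_expash_mono x y : 0 <= x -> x <= y -> half_expash x <= half_expash y.
Proof.
move=> x0 xy; have m0 := bracket_gt0 x; have m1 := bracket_gt0 y.
rewrite /half_expash ler_pdivrMr ?mulr_gt0// mulrAC ler_pdivlMr ?mulr_gt0//.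
rewrite /expash.
have y0 : 0 <= y by exact: le_trans xy.
have H : x * bracket y <= y * bracket x.
  rewrite -ler_sqr ?nnegrE; [|exact: mulr_ge0 (ltW _)|exact: mulr_ge0 (ltW _)].
  rewrite !exprMn !bracket_sqr.
  have : x ^+ 2 <= y ^+ 2 by rewrite ler_sqr ?nnegrE// (le_trans x0).
  by nra.
by nra.
Qed.

Lemma is_derive_cos_ln k c x : 0 < x ->
  is_derive x 1 (fun x : R => cos (k * ln x + c)) (- sin (k * ln x + c) * (k / x)).
Proof.
move=> x0.
apply: (@is_derive_compR _ cos (fun x => k * ln x + c)).
have L := is_derive1_ln x0.
by apply: is_derive_eq; rewrite /GRing.scale/=; ring.
Qed.

(** The factor [u] makes [u * cos (k * ln u + c)] Lipschitz up to [u = 0]. *)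
Lemma bv_ratio_cos k c s : 0 <= s ->
  bv (3 + `|k|) (fun x => ratio s x * cos (k * ln (ratio s x) + c)).
Proof.
move=> s0.
have -> : 3 + `|k| = (1 + `|k|) * (1 - 0) + 2 * 1 by ring.
apply: (@bv_lipschitz _ 0 1 (1 + `|k|) (fun x => x * cos (k * ln x + c)) (ratio s)).
- by move=> x y; exact: ratio_mono.
- by move=> x _; exact: ratio_itv.
- move=> x /andP[x0 x1]; rewrite normrM mulr_ile1// ?cos_max//.
  by rewrite ger0_norm// ltW.
- by rewrite addr_ge0.
apply: (@lipschitz_derive _ _ _ _ (fun x => cos (k * ln x + c) - k * sin (k * ln x + c))).
- move=> x /andP[x0 x1]; have H := is_derive_cos_ln k c x0.
  apply: is_derive_eq; rewrite /GRing.scale/=.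
  by field; rewrite lt0r_neq0.
- move=> x _; apply: (le_trans (ler_normB _ _)); apply: lerD; first exact: cos_max.
  by rewrite normrM ler_piMr// sin_max.
Qed.

Lemma bv_cos_half_expash k c :
  bv (2 + 3 * `|k|) (fun x => cos (k * ln (half_expash x) + c)).
Proof.
have -> : 2 + 3 * `|k| = (4 * `|k|) * (1 - 4^-1) + 2 * 1 :> R by field.
apply: (@bv_lipschitz _ (4^-1) 1 (4 * `|k|) (fun x => cos (k * ln x + c)) half_expash).
- by move=> x y; exact: half_expash_mono.
- by move=> x; exact: half_expash_itv.
- by move=> x _; exact: cos_max.
- by rewrite mulr_ge0.
have x0 x : 4^-1 < x -> 0 < x by apply: lt_trans; rewrite invr_gt0.
apply: (@lipschitz_derive _ _ _ _ (fun x => - sin (k * ln x + c) * (k / x))).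
- by move=> x /andP[/x0 xp _]; exact: is_derive_cos_ln.
- move=> x /andP[x4 _]; rewrite normrM normrN mulrC normrM.
  rewrite -[leRHS]mulr1 ler_pM ?mulr_ge0 ?sin_max// mulrC ler_wpM2r//.
  rewrite gtr0_norm ?invr_gt0 ?x0//.
  by rewrite -div1r ler_pdivrMr ?x0//; lra.
Qed.

Lemma bv_powR_ratio p : exists2 A : R, 0 <= A &
  forall s, 0 <= s -> bv A (fun x => (1 + ratio s x) `^ p).
Proof.
have pw x : 0 < x -> x <= 1 -> (1 + x) `^ p <= 2 `^ `|p|.
  move=> x0 x1; apply: (@le_trans _ _ ((1 + x) `^ `|p|)).
    by rewrite ler_powR ?ler_norm// lerDl ltW.
  by rewrite ge0_ler_powR ?nnegrE//; lra.
pose L := `|p| * 2 `^ `|p - 1|.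
have L0 : 0 <= L by rewrite mulr_ge0// powR_ge0.
exists (L * (1 - 0) + 2 * 2 `^ `|p|).
  by rewrite subr0 mulr1 addr_ge0// mulr_ge0// powR_ge0.
move=> s s0.
apply: (@bv_lipschitz _ 0 _ L (fun x => (1 + x) `^ p) (ratio s)) => //.
- by move=> x y; exact: ratio_mono.
- by move=> x _; exact: ratio_itv.
- by move=> x /andP[x0 x1]; rewrite ger0_norm ?powR_ge0// pw.
apply: (@lipschitz_derive _ _ _ _ (fun x => p * (1 + x) `^ (p - 1))).
- move=> x /andP[x0 x1].
  have x10 : 0 < 1 + x by lra.
  by have := is_derive_compR (is_derive_shift 1 x) (is_derive_powR p x10); rewrite mulr1.
- move=> x /andP[x0 x1]; rewrite normrM ler_wpM2l// ger0_norm ?powR_ge0//.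
  apply: (@le_trans _ _ ((1 + x) `^ `|p - 1|)).
    by rewrite ler_powR ?ler_norm// lerDl ltW.
  by rewrite ge0_ler_powR ?nnegrE//; lra.
Qed.

Lemma ln_split s x : 0 <= s ->
  ln (bracket x + s) = ln (expash x) - ln (ratio s x) - ln (half_expash x) - ln 2.
Proof.
move=> s0; have m0 := bracket_gt0 x; have X0 := expash_gt0 x.
have ms : 0 < bracket x + s by rewrite ltr_pwDl.
rewrite /ratio /half_expash !ln_div ?posrE ?mulr_gt0// lnM ?posrE//.
by ring.
Qed.

(** Here [bracket x + s] is the bracket of a vector with one coordinate [x]. The
    exponents combine the weight of the kernel with the Jacobian of the radial
    substitution. *)
Definition oscillating p s y t k th th' x : R :=
  cos (y * x + t * bracket x + th) * cos (k * ln (bracket x + s) + th') *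
  ((bracket x + s) `^ (- p) * (bracket x + s + bracket x) `^ (p - 1)).

Lemma amplitude_ratio p s x : 0 <= s ->
  (bracket x + s) `^ (- p) * (bracket x + s + bracket x) `^ (p - 1) =
  (bracket x)^-1 * (ratio s x * (1 + ratio s x) `^ (p - 1)).
Proof.
move=> s0; have m0 := bracket_gt0 x.
have ms : 0 < bracket x + s by rewrite ltr_pwDl.
have -> : 1 + ratio s x = (bracket x + s + bracket x) / (bracket x + s).
  by rewrite /ratio; field; rewrite lt0r_neq0.
rewrite powRM ?invr_ge0 ?(ltW ms)//; last by rewrite addr_ge0// ltW.
have -> : (bracket x + s)^-1 `^ (p - 1) = (bracket x + s) `^ (- p) * (bracket x + s).
  rewrite -[in LHS](powR_inv1 (ltW ms)) -powRrM -[X in _ = _ * X](powRr1 (ltW ms)).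
  rewrite -powRD; last by rewrite (lt0r_neq0 ms) implybT.
  by congr (_ `^ _); ring.
by rewrite /ratio; field; rewrite !lt0r_neq0.
Qed.

(** The factor [cos (k ln w + th')] is moved onto [expash x], whose logarithm
    is the phase variable; the cosine of [k] times the difference of the two
    logarithms has bounded variation once multiplied by [m / w], a factor which
    the amplitude provides. *)
Lemma oscillating_bound p : exists2 C : R, 0 <= C &
  forall s y t k th th' L M (B : R -> R), 0 <= s -> k != 0 -> bv M B ->
  `|k| * `|\int[mu]_(x in `[0, L]) (oscillating p s y t k th th' x * B x)|
    <= C * (1 + `|k|) ^+ 3 * M.
Proof.
have [A A0 HA] := bv_powR_ratio (p - 1).
exists (10 ^+ 6 * A * (2 * ln 36 + 8)).
  by rewrite !mulr_ge0// addr_ge0// mulr_ge0// ln_ge0// ler1n.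
move=> s y t k th th' L M B s0 k0 bB.
pose a := (y + t) / 2; pose b := (t - y) / 2.
pose rc := fun c x => ratio s x * cos (k * ln (ratio s x) + c).
pose hc := fun c x => cos (k * ln (half_expash x) + c).
pose W c c' x := rc c x * hc c' x * ((1 + ratio s x) `^ (p - 1) * B x).
pose N := 2 * (2 * (3 + `|k|) * (2 + 3 * `|k|)) * (2 * A * M).
have bW c c' : bv N (W c c').
  apply: bvM; last by apply: bvM => //; exact: HA.
  by apply: bvM; [exact: bv_ratio_cos|exact: bv_cos_half_expash].
have M0 := bv_ge0 bB.
(* By [ln_split] the logarithmic phase is [k ln X + c0 - (k ln r + k ln h)] with
   [X = expash x], [r = ratio s x] and [h = half_expash x]; [V1] and [V2] are the
   cosine and the sine of [k ln r + k ln h], times [r] and the other weights. *)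
pose c0 := th' - k * ln 2.
pose V1 x := W 0 0 x - W (pi / 2) (pi / 2) x.
pose V2 x := - (W (pi / 2) 0 x + W 0 (pi / 2) x).
have bV1 : bv (2 * N) V1.
  by rewrite mulr_natl mulr2n; apply: bvB; exact: bW.
have bV2 : bv (2 * N) V2.
  by rewrite mulr_natl mulr2n; apply: bvN; apply: bvD; exact: bW.
have X0 x := @expash_gt0 R x.
have phE x : y * x + t * bracket x = a * expash x + b / expash x.
  by rewrite expashV /expash /a /b; field.
pose T j th0 x := cos (phase a b j th0 x) / bracket x.
have E x : oscillating p s y t k th th' x * B x =
   2^-1 * (T k (th + c0) x * V1 x + T (- k) (th - c0) x * V1 x
         + (T k (th + c0 - pi / 2) x * V2 x - T (- k) (th - c0 - pi / 2) x * V2 x)).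
  rewrite /oscillating amplitude_ratio// /T /phase phE ln_split//.
  have -> : k * (ln (expash x) - ln (ratio s x) - ln (half_expash x) - ln 2) + th' =
     (k * ln (expash x) + c0) - (k * ln (ratio s x) + k * ln (half_expash x)) by rewrite /c0; ring.
  rewrite cosB (cosD (k * ln (ratio s x))) (sinD (k * ln (ratio s x))).
  set P := a * expash x + b / expash x.
  set U := k * ln (expash x) + c0.
  have -> : P + k * ln (expash x) + (th + c0) = (P + th) + U by rewrite /U; ring.
  have -> : P + - k * ln (expash x) + (th - c0) = (P + th) - U by rewrite /U; ring.
  have -> : P + k * ln (expash x) + (th + c0 - pi / 2) = (P + th) + U - pi / 2 by rewrite /U; ring.
  have -> : P + - k * ln (expash x) + (th - c0 - pi / 2) = (P + th) - U - pi / 2 by rewrite /U; ring.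
  rewrite !cosBpihalf (cosD (P + th)) (cosB (P + th)) (sinD (P + th)) (sinB (P + th)).
  rewrite /V1 /V2 /W /rc /hc !addr0 !cosDpihalf.
  by field; rewrite lt0r_neq0// bracket_gt0.
have iT j th0 (V : R -> R) : bv (2 * N) V -> mu.-integrable `[0, L] (EFin \o (fun x => T j th0 x * V x)).
  by move=> bV; apply: bv_integrable bV; exact: integrable_cos_phase.
have i1 := iT k (th + c0) _ bV1.
have i2 := iT (- k) (th - c0) _ bV1.
have i3 := iT k (th + c0 - pi / 2) _ bV2.
have i4 := iT (- k) (th - c0 - pi / 2) _ bV2.
have -> : (fun x => oscillating p s y t k th th' x * B x) =
    (fun x => 2^-1 * (T k (th + c0) x * V1 x + T (- k) (th - c0) x * V1 x +
    (T k (th + c0 - pi / 2) x * V2 x - T (- k) (th - c0 - pi / 2) x * V2 x))).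
  exact/funext.
have mD : measurable (`[0, L]%classic : set (measurableTypeR R)) by exact: measurable_itv.
have i12 := integrableRD mD i1 i2.
have i34 := integrableRB mD i3 i4.
have i1234 := integrableRD mD i12 i34.
rewrite RintegralZl// RintegralD// RintegralD// RintegralB//.
have k0' : - k != 0 by rewrite oppr_eq0.
have cbN : core_bound (- k) = core_bound k by rewrite /core_bound normrN.
have b1 := phase_weight L a b (th + c0) k0 bV1.
have b2 := phase_weight L a b (th - c0) k0' bV1.
have b3 := phase_weight L a b (th + c0 - pi / 2) k0 bV2.
have b4 := phase_weight L a b (th - c0 - pi / 2) k0' bV2.
rewrite cbN in b2 b4.
rewrite -/(T _ _) in b1 b2 b3 b4.
set I1 := \int[mu]_(x in _) _ in b1 *.
set I2 := \int[mu]_(x in _) _ in b2 *.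
set I3 := \int[mu]_(x in _) _ in b3 *.
set I4 := \int[mu]_(x in _) _ in b4 *.
have S : `|2^-1 * (I1 + I2 + (I3 - I4))| <= 2 * (4 * (2 * N) * core_bound k).
  rewrite normrM ger0_norm//.
  have := ler_normD (I1 + I2) (I3 - I4).
  have := ler_normD I1 I2; have := ler_normB I3 I4.
  by lra.
have kc : `|k| * core_bound k <= (2 * ln 36 + 8) * (1 + `|k|).
  have kn : `|k| != 0 by rewrite normr_eq0.
  have -> : `|k| * core_bound k = 2 * ln 36 * `|k| + 8 by rewrite /core_bound; field.
  have : 0 <= ln 36 :> R by rewrite ln_ge0// ler1n.
  by have := normr_ge0 k; nra.
apply: (@le_trans _ _ (16 * N * ((2 * ln 36 + 8) * (1 + `|k|)))).
  have N0 : 0 <= N by exact: bv_ge0 (bW 0 0).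
  apply: (@le_trans _ _ (16 * N * (`|k| * core_bound k))).
    have -> : 16 * N * (`|k| * core_bound k) = `|k| * (2 * (4 * (2 * N) * core_bound k)) by ring.
    by rewrite ler_wpM2l.
  by rewrite ler_wpM2l// mulr_ge0.
have NE : 16 * N <= 10 ^+ 6 * A * (1 + `|k|) ^+ 2 * M.
  have kk : (3 + `|k|) * (2 + 3 * `|k|) <= 9 * (1 + `|k|) ^+ 2.
    by have := normr_ge0 k; rewrite expr2; nra.
  have -> : 16 * N = (16 * 2 * 2 * 2 * A * M) * ((3 + `|k|) * (2 + 3 * `|k|)).
    by rewrite /N; ring.
  apply: (@le_trans _ _ ((16 * 2 * 2 * 2 * A * M) * (9 * (1 + `|k|) ^+ 2))).
    by rewrite ler_wpM2l// !mulr_ge0.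
  have : 0 <= A * M * (1 + `|k|) ^+ 2 by rewrite !mulr_ge0// sqr_ge0.
  by lra.
have l0 : 0 <= (2 * ln 36 + 8) * (1 + `|k|).
  by rewrite mulr_ge0// ?addr_ge0// mulr_ge0// ln_ge0// ler1n.
have := ler_wpM2r l0 NE.
by congr (_ <= _); rewrite !exprS; ring.
Qed.

End weighted_oscillation.

(** * Cutoffs *)

Section cutoff.
Context {R : realType}.
Implicit Types (psi : R -> R).

(** Vanishing near each point passes at once to the derivatives. *)
Definition cutoff psi : Prop :=
  smooth psi /\ forall s : R, 1 <= s -> \forall u \near s, psi u = 0.

Lemma cutoff_continuous psi : cutoff psi -> continuous psi.
Proof. by move=> [sm _] s; exact/differentiable_continuous/derivable1_diffP/(sm 0%N). Qed.

(** [s ^+ j * psi^(j) s], which the Euler operator [s d/ds] maps to a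
    combination of itself and of its successor. *)
Definition euler_jet psi (j : nat) (s : R) : R := s ^+ j * derive1n j psi s.

Lemma cutoff_derive1n psi j : cutoff psi ->
  forall s : R, 1 <= s -> \forall u \near s, derive1n j psi u = 0.
Proof.
move=> [_ H]; elim: j => [//|j IH] s s1.
have /nbhs_interior := IH s s1; apply: filterS => u Hu.
rewrite derive1nS derive1E (_ : 0 = 'D_1 (cst 0 : R -> R) u); last by rewrite derive_cst.
by apply: near_eq_derive; rewrite ?oner_eq0.
Qed.

Lemma is_derive_derive1n psi j (s : R) : cutoff psi ->
  is_derive s 1 (derive1n j psi) (derive1n j.+1 psi s).
Proof.
by move=> [sm _]; rewrite derive1nS derive1E; apply: derivableP; exact: sm.
Qed.

Lemma euler_jet_out psi j s : cutoff psi -> 1 <= s -> euler_jet psi j s = 0.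
Proof.
move=> H s1; have /nbhs_singleton := cutoff_derive1n j H s1.
by rewrite /euler_jet => ->; rewrite mulr0.
Qed.

Definition euler_jet' psi j (s : R) : R :=
  (s ^+ j.-1 *+ j) * derive1n j psi s + s ^+ j * derive1n j.+1 psi s.

Lemma is_derive_euler_jet psi j (s : R) : cutoff psi ->
  is_derive s 1 (euler_jet psi j) (euler_jet' psi j s).
Proof.
move=> H; have D := is_derive_derive1n j s H.
have X : is_derive s 1 (fun s : R => s ^+ j) (s ^+ j.-1 *+ j).
  apply: DeriveDef; first exact: exprn_derivable.
  by rewrite exp_derive /GRing.scale/= mulr1 mulr_natl.
rewrite /euler_jet; apply: is_derive_eq.
by rewrite addrC /euler_jet' [X in _ = X + _]mulrC.
Qed.

Lemma euler_jet'E psi j (s : R) :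
  s * euler_jet' psi j s = j%:R * euler_jet psi j s + euler_jet psi j.+1 s.
Proof.
rewrite /euler_jet' /euler_jet; case: j => [|j]; first by rewrite mulr0n expr0 expr1; ring.
by rewrite -mulr_natl /= !exprS; ring.
Qed.

Lemma continuous_euler_jet psi j : cutoff psi -> continuous (euler_jet psi j).
Proof. by move=> H s; exact: is_derive_continuous (is_derive_euler_jet j s H). Qed.

Lemma continuous_euler_jet' psi j : cutoff psi -> continuous (euler_jet' psi j).
Proof.
move=> H s.
have c i : {for s, continuous (derive1n i psi)}.
  exact: is_derive_continuous (is_derive_derive1n i s H).
have x i : {for s, continuous (fun s : R => s ^+ i)}.
  by apply: (@exprn_continuous R i).
apply: cvgD; last by apply: cvgM; [exact: x|exact: c].
apply: cvgM; last exact: c.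
apply: (@cvg_comp _ _ _ (fun s : R => s ^+ j.-1) (fun v => v *+ j)); first exact: x.
exact: natmul_continuous.
Qed.

Lemma euler_jet_lipschitz psi j : cutoff psi ->
  exists2 A : R, 0 <= A & (forall x, -1 < x <= 1 -> `|euler_jet psi j x| <= A) /\
   forall x y : R, -1 < x -> x <= y -> y <= 1 ->
     `|euler_jet psi j x - euler_jet psi j y| <= A * (y - x).
Proof.
move=> H.
have [A A0 HA] := continuous_bounded_itv (-1) 1 (@continuous_euler_jet psi j H).
have [A' A'0 HA'] := continuous_bounded_itv (-1) 1 (@continuous_euler_jet' psi j H).
exists (A + A'); first by rewrite addr_ge0.
split=> [x /andP[x1 x2]|].
  by apply: (le_trans (HA x _)); rewrite ?lerDl// (ltW x1).
apply: lipschitz_derive => x x11.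
  exact: is_derive_euler_jet.
by apply: (le_trans (HA' x _)); rewrite ?lerDr//; case/andP: x11 => /ltW->.
Qed.

End cutoff.

(** * Symbols *)

Section symbols.
Context {R : realType}.
Implicit Types (s eps x k : R).

(** The length of a vector with one coordinate [x] and bracket [bracket x + s]. *)
Definition radius s x : R := Num.sqrt ((bracket x + s) ^+ 2 - 1).

Definition r1 s x : R := s / (bracket x + s).
Definition r2 s x : R := s / (bracket x + s + bracket x).
Definition r3 s x : R := s * (bracket x + s) / ((bracket x + s) ^+ 2 - 1).

(** The amplitudes produced by repeated integration by parts form an algebra
    that [s d/ds] preserves; they are kept as syntax so that this derivation is
    a program on expressions. *)
Inductive symbol : Type :=
| Jet of nat
| R1 of symbol
| R2 of symbol
| R3 of symbol
| Plus of symbol & symbol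
| Scale of R & symbol.

Fixpoint eval (psi : R -> R) (e : symbol) eps s x : R :=
  match e with
  | Jet j => euler_jet psi j (eps * radius s x)
  | R1 e => r1 s x * eval psi e eps s x
  | R2 e => r2 s x * eval psi e eps s x
  | R3 e => r3 s x * eval psi e eps s x
  | Plus e f => eval psi e eps s x + eval psi f eps s x
  | Scale c e => c * eval psi e eps s x
  end.

(** [s d/ds], by [is_derive_eval]. *)
Fixpoint euler (e : symbol) : symbol :=
  match e with
  | Jet j => R3 (Plus (Scale j%:R (Jet j)) (Jet j.+1))
  | R1 e => R1 (Plus (euler e) (Plus e (Scale (-1) (R1 e))))
  | R2 e => R2 (Plus (euler e) (Plus e (Scale (-1) (R2 e))))
  | R3 e => R3 (Plus (euler e) (Plus e (Plus (R1 e) (Scale (-2) (R3 e)))))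
  | Plus e f => Plus (euler e) (euler f)
  | Scale c e => Scale c (euler e)
  end.

Lemma bracketD_gt1 s x : 0 < s -> 1 < bracket x + s.
Proof. by move=> s0; have := bracket_ge1 x; lra. Qed.

Lemma bracketD_ge1 s x : 0 <= s -> 1 <= bracket x + s.
Proof. by move=> s0; have := bracket_ge1 x; lra. Qed.

Lemma sqrB1_gt0 s x : 0 < s -> 0 < (bracket x + s) ^+ 2 - 1.
Proof. by move=> s0; have := bracketD_gt1 x s0; nra. Qed.

Lemma is_derive_r1 s x : 0 < s -> is_derive s 1 (r1 ^~ x) (r1 s x * (1 - r1 s x) / s).
Proof.
move=> s0; have w0 : 0 < bracket x + s by have := bracketD_gt1 x s0; lra.
have H := is_derive_inv (lt0r_neq0 w0) (is_derive_shift (bracket x) s).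
rewrite /r1; apply: is_derive_eq; rewrite /GRing.scale/=.
by field; rewrite !lt0r_neq0.
Qed.

Lemma is_derive_r2 s x : 0 < s -> is_derive s 1 (r2 ^~ x) (r2 s x * (1 - r2 s x) / s).
Proof.
move=> s0; have w0 : 0 < bracket x + s by have := bracketD_gt1 x s0; lra.
have m0 := bracket_gt0 x.
have w1 : 0 < bracket x + s + bracket x by rewrite addr_gt0.
have H0 : is_derive s 1 (fun s => bracket x + s + bracket x) 1.
  have H := is_derive_shift (bracket x) s; apply: is_derive_eq.
  by rewrite addr0.
have H := @is_derive_inv _ (fun s => bracket x + s + bracket x) s _ (lt0r_neq0 w1) H0.
rewrite /r2; apply: is_derive_eq; rewrite /GRing.scale/=.
by field; rewrite !lt0r_neq0.
Qed.

Lemma is_derive_sqrB1 s x :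
  is_derive s 1 (fun s => (bracket x + s) ^+ 2 - 1) (2 * (bracket x + s)).
Proof.
have H := is_derive_shift (bracket x) s; apply: is_derive_eq.
by rewrite /GRing.scale/=; ring.
Qed.

Lemma is_derive_r3 s x : 0 < s ->
  is_derive s 1 (r3 ^~ x) (r3 s x * (1 + r1 s x - 2 * r3 s x) / s).
Proof.
move=> s0; have w0 : 0 < bracket x + s by have := bracketD_gt1 x s0; lra.
have q0 := sqrB1_gt0 x s0.
have H := is_derive_shift (bracket x) s.
have H1 := @is_derive_inv _ (fun s => (bracket x + s) ^+ 2 - 1) s _ (lt0r_neq0 q0) (is_derive_sqrB1 s x).
rewrite /r3; apply: is_derive_eq; rewrite /GRing.scale/= /r1.
by field; rewrite !lt0r_neq0.
Qed.

Lemma is_derive_radius s x : 0 < s ->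
  is_derive s 1 (radius ^~ x) ((bracket x + s) / radius s x).
Proof.
move=> s0; have q0 := sqrB1_gt0 x s0.
have H := is_derive_compR (is_derive_sqrB1 s x) (is_derive1_sqrt q0).
apply: (is_derive_eq H); rewrite -/(radius s x).
by field; rewrite lt0r_neq0// sqrtr_gt0.
Qed.

Lemma is_derive_eval psi (e : symbol) eps s x : cutoff psi -> 0 < s ->
  is_derive s 1 (fun s => eval psi e eps s x) (eval psi (euler e) eps s x / s).
Proof.
move=> Hpsi s0; elim: e => [j|e IH|e IH|e IH|e IHe f IHf|c e IH] /=.
- have q0 := sqrB1_gt0 x s0.
  have rho0 : 0 < radius s x by rewrite sqrtr_gt0.
  have Hr := is_derive_radius x s0.
  have Hr' : is_derive s 1 (fun s => eps * radius s x) (eps * ((bracket x + s) / radius s x)).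
    by apply: is_derive_eq; rewrite /GRing.scale/=; ring.
  have := is_derive_compR Hr' (is_derive_euler_jet j (eps * radius s x) Hpsi).
  move=> H; apply: (is_derive_eq H); rewrite -euler_jet'E /r3.
  have -> : (bracket x + s) ^+ 2 - 1 = radius s x ^+ 2 by rewrite sqr_sqrtr// ltW.
  by field; rewrite !lt0r_neq0.
- have H := is_derive_r1 x s0; apply: is_derive_eq; rewrite /GRing.scale/=; ring.
- have H := is_derive_r2 x s0; apply: is_derive_eq; rewrite /GRing.scale/=; ring.
- have H := is_derive_r3 x s0; apply: is_derive_eq; rewrite /GRing.scale/=; ring.
- by apply: is_derive_eq; rewrite mulrDl.
- by apply: is_derive_eq; rewrite /GRing.scale/=; ring.
Qed.

Lemma eval_out psi (e : symbol) eps s x : cutoff psi -> 1 <= eps * radius s x ->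
  eval psi e eps s x = 0.
Proof.
move=> Hpsi out; elim: e => [j|e IH|e IH|e IH|e IHe f IHf|c e IH] /=.
- exact: euler_jet_out.
- by rewrite IH mulr0.
- by rewrite IH mulr0.
- by rewrite IH mulr0.
- by rewrite IHe IHf addr0.
- by rewrite IH mulr0.
Qed.

Lemma bv_r1 s : 0 <= s -> bv 2 (r1 s).
Proof.
move=> s0; have b := bv_cst (1:R); rewrite normr1 in b.
have r : bv 1 (ratio s).
  apply: bv_monotone; split=> [x y|x _]; first exact: ratio_mono.
  by have /andP[/ltW-> ->] := ratio_itv x s0.
have := bvB b r; apply: eq_bv => x _; rewrite /r1 /ratio.
by field; rewrite lt0r_neq0//; have := bracketD_ge1 x s0; lra.
Qed.

Lemma bv_r2 s : 0 <= s -> bv 2 (r2 s).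
Proof.
move=> s0; have b := bv_cst (1:R); rewrite normr1 in b.
have r : bv 1 (fun x => 2 * bracket x / (bracket x + s + bracket x)).
  apply: bv_monotone; split=> [x y x0 xy|x _].
    have h := bracket_mono x0 xy; have m0 := bracket_gt0 x; have m1 := bracket_gt0 y.
    rewrite ler_pdivrMr; last by lra.
    rewrite mulrAC ler_pdivlMr; last by lra.
    by have := ler_wpM2l s0 h; nra.
  have m0 := bracket_gt0 x.
  rewrite divr_ge0 ?ler_pdivrMr; lra.
have := bvB b r; apply: eq_bv => x _; rewrite /r2.
by field; rewrite lt0r_neq0//; have := bracketD_ge1 x s0; have := bracket_gt0 x; lra.
Qed.

Lemma bv_r3 s : 0 <= s -> bv 2 (r3 s).
Proof.
move=> s0; have b := bv_cst (1:R); rewrite normr1 in b.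
suff r : bv 1 (fun x => 1 - r3 s x).
  by have := bvB b r; apply: eq_bv => x _; ring.
move: s0; rewrite le_eqVlt => /predU1P[<-|s0].
  by apply: eq_bv b => x _; rewrite /r3; ring.
apply: bv_monotone; split=> [x y x0 xy|x _].
  have h := bracket_mono x0 xy.
  have wx := bracketD_gt1 x s0; have wy := bracketD_gt1 y s0.
  rewrite lerD2l lerN2 /r3 -!mulrA ler_wpM2l ?(ltW s0)//.
  rewrite ler_pdivrMr ?sqrB1_gt0// mulrAC ler_pdivlMr ?sqrB1_gt0//.
  have : bracket x + s <= bracket y + s by rewrite lerD2r.
  move: wx wy; set w := bracket x + s; set w' := bracket y + s => w1 w1' ww.
  have : 0 <= (w' - w) * (w * w' + 1) by rewrite mulr_ge0 ?subr_ge0// addr_ge0// mulr_ge0//; lra.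
  by rewrite !expr2; lra.
have w1 := bracketD_gt1 x s0; have q0 := sqrB1_gt0 x s0.
have m1 := bracket_ge1 x.
rewrite subr_ge0 lerBlDr lerDl /r3 ler_pdivrMr// divr_ge0 ?(ltW q0)//.
  rewrite andbT; move: w1 m1; set w := bracket x + s => w1 m1.
  have -> : s = w - bracket x by rewrite /w; ring.
  by rewrite expr2; nra.
by rewrite mulr_ge0//; lra.
Qed.

Lemma radius_mono s x y : 0 <= s -> 0 <= x -> x <= y -> radius s x <= radius s y.
Proof.
move=> s0 x0 xy; rewrite ler_wsqrtr// lerB//.
have := bracketD_ge1 x s0; have := bracketD_ge1 y s0.
have h := bracket_mono x0 xy.
by move=> ? ?; rewrite ler_sqr ?nnegrE; lra.
Qed.

Lemma radius0 x : radius 0 x = `|x|.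
Proof. by rewrite /radius addr0 bracket_sqr addrC addKr sqrtr_sqr. Qed.

Lemma radius_ge s x : 0 <= s -> s <= radius s x.
Proof.
move=> s0; have m1 := bracket_ge1 x.
rewrite -[leLHS](ger0_norm s0) -sqrtr_sqr ler_wsqrtr//; nra.
Qed.

Lemma radius_ge_normr s x : 0 <= s -> `|x| <= radius s x.
Proof.
move=> s0; have m1 := bracket_ge1 x.
rewrite -sqrtr_sqr ler_wsqrtr//; have := bracket_sqr x; nra.
Qed.

Lemma radius_mono_excess s s' x : 0 <= s -> s <= s' -> radius s x <= radius s' x.
Proof.
move=> s0 ss'; have m1 := bracket_ge1 x.
rewrite ler_wsqrtr// lerB// lerXn2r ?nnegrE; lra.
Qed.

(** The argument [eps * radius s x] of the cutoff is monotone in [x] and may be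
    truncated at 1, so the bound does not depend on [eps] and [s]. *)
Lemma bv_eval psi (e : symbol) : cutoff psi ->
  exists M : R, forall eps s, 0 < eps -> 0 <= s -> bv M (eval psi e eps s).
Proof.
move=> Hpsi; elim: e => [j|e [M HM]|e [M HM]|e [M HM]|e [M HM] f [M' HM']|c e [M HM]] /=.
- have [A A0 [HA HL]] := euler_jet_lipschitz j Hpsi.
  exists (A * (1 - (-1)) + 2 * A) => eps s e0 s0.
  have := @bv_lipschitz _ (-1) A A (euler_jet psi j) (fun x => Num.min (eps * radius s x) 1).
  move=> /(_ _ _ HA A0 HL) H; apply: eq_bv (H _ _).
  + move=> x x0 /=; rewrite /Num.min; case: ifPn => //; rewrite -leNgt => out.
    by rewrite !euler_jet_out.
  + move=> x y x0 xy; rewrite le_min !ge_min lexx orbT andbT.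
    by rewrite ler_wpM2l ?(ltW e0)// radius_mono.
  + move=> x x0; rewrite lt_min ge_min lexx orbT andbT.
    have : 0 <= eps * radius s x by rewrite mulr_ge0 ?(ltW e0)// sqrtr_ge0.
    by move=> ?; apply/andP; split; lra.
- by exists (2 * 2 * M) => eps s e0 s0; apply: bvM; [exact: bv_r1|exact: HM].
- by exists (2 * 2 * M) => eps s e0 s0; apply: bvM; [exact: bv_r2|exact: HM].
- by exists (2 * 2 * M) => eps s e0 s0; apply: bvM; [exact: bv_r3|exact: HM].
- by exists (M + M') => eps s e0 s0; apply: bvD; [exact: HM|exact: HM'].
- by exists (2 * `|c| * M) => eps s e0 s0; apply: bvZ; exact: HM.
Qed.

Lemma cutoff_bounded psi : cutoff psi -> exists M : R, forall s, 0 <= s -> `|psi s| <= M.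
Proof.
move=> Hpsi; have [M HM] := bv_eval (Jet 0) Hpsi; exists M => s s0.
have := bv_bounded (HM 1 0 ltr01 (lexx _)) s0.
by rewrite /= /euler_jet expr0 !mul1r radius0 (ger0_norm s0); exact.
Qed.

End symbols.
Arguments symbol : clear implicits.

(** * Integrals over boxes *)

Section box.
Context {R : realType}.
Notation mu := (@lebesgue_measure R).
Notation RR := (measurableTypeR R).
Implicit Types (a b c d : R) (G : R -> R -> R).

Definition box_bounded a b c d G : Prop :=
  measurable_fun [set: RR * RR] (fun u => G u.1 u.2) /\
  exists M, forall x z, a <= x <= b -> c <= z <= d -> `|G x z| <= M.

Lemma box_bounded_sym a b c d G : box_bounded a b c d G ->
  box_bounded c d a b (fun z x => G x z).
Proof.
move=> [mG [M HM]]; split; last by exists M => z x cz ax; exact: HM.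
exact: (measurableT_comp mG (measurable_fun_pair measurable_snd measurable_fst)).
Qed.

Lemma box_boundedM a b c d G G' : box_bounded a b c d G -> box_bounded a b c d G' ->
  box_bounded a b c d (fun x z => G x z * G' x z).
Proof.
move=> [mG [M HM]] [mG' [M' HM']]; split; first exact: measurable_funM.
by exists (M * M') => x z ax cz; rewrite normrM ler_pM// ?HM ?HM'.
Qed.

Lemma box_boundedD a b c d G G' : box_bounded a b c d G -> box_bounded a b c d G' ->
  box_bounded a b c d (fun x z => G x z + G' x z).
Proof.
move=> [mG [M HM]] [mG' [M' HM']]; split; first exact: measurable_funD.
exists (M + M') => x z ax cz; apply: (le_trans (ler_normD _ _)).
by rewrite lerD// ?HM ?HM'.
Qed.

Lemma box_bounded_cst a b c d k : box_bounded a b c d (fun _ _ => k).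
Proof. by split; [exact: measurable_cst|exists `|k|]. Qed.

Lemma box_boundedZ a b c d k G : box_bounded a b c d G ->
  box_bounded a b c d (fun x z => k * G x z).
Proof. by apply: box_boundedM; exact: box_bounded_cst. Qed.

Lemma finite_itv c d : (mu `[c, d]%classic < +oo)%E.
Proof.
by rewrite lebesgue_measure_itv/=; case: ifP => _; rewrite ?ltry// -EFinB ltry.
Qed.

Lemma bounded_itv_integrable (f : R -> R) c d (M : R) : measurable_fun [set: RR] f ->
  (forall z, c <= z <= d -> `|f z| <= M) -> mu.-integrable `[c, d] (EFin \o f).
Proof.
move=> mf HM; apply: measurable_bounded_integrable => //.
- exact: finite_itv.
- exact: measurable_funTS.
- exists M; split; first by rewrite num_real.
  by move=> x Mx y /=; rewrite in_itv/= => cyd; rewrite (le_trans (HM _ cyd))// ltW.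
Qed.

Lemma box_inner a b c d G x : box_bounded a b c d G -> a <= x <= b ->
  mu.-integrable `[c, d] (EFin \o G x).
Proof.
move=> [mG [M HM]] ax; apply: (@bounded_itv_integrable _ _ _ M); last by move=> z; exact: HM.
exact: (measurableT_comp mG (pair1_measurable x)).
Qed.

Section fubini.
Variables (a b c d : R) (G : R -> R -> R).
Hypothesis HG : box_bounded a b c d G.

Let D : set (RR * RR) := `[a, b]%classic `*` `[c, d]%classic.
Let Gb (u : RR * RR) : \bar R := ((EFin \o (fun u => G u.1 u.2)) \_ D) u.

Lemma measurable_box : measurable D.
Proof. by apply: measurableX; exact: measurable_itv. Qed.

Let mD := measurable_box.

Lemma box_integrable : (mu \x mu)%E.-integrable setT Gb.
Proof.
have [mG [M HM]] := HG.
apply/(integrable_restrict _ _ measurableT) => //; rewrite setTI.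
apply: measurable_bounded_integrable => //.
- have : ((mu \x mu) D < +oo)%E; last by [].
  rewrite /D product_measure1E; [|exact: measurable_itv|exact: measurable_itv].
  apply: lte_mul_pinfty => //; last exact: finite_itv.
  by rewrite ge0_fin_numE//; exact: finite_itv.
- exact: measurable_funTS.
- exists M; split; first by rewrite num_real.
  move=> y My [x z] /= [ax cz].
  by rewrite (le_trans (HM _ _ ax cz))// ltW.
Qed.

Let GbE x : (fun z => Gb (x, z)) = (fun z => ((EFin \o G x) \_ `[c, d]%classic) z *
   (\1_(`[a, b]%classic) x)%:E)%E.
Proof.
apply/funext => z; rewrite /Gb /patch /= indicE /D.
have [xI|xI] := boolP (x \in `[a, b]%classic); have [zI|zI] := boolP (z \in `[c, d]%classic).
- by rewrite mem_set ?mule1//; split; exact: set_mem.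
- by rewrite memNset ?mul0e// => -[_ /mem_set]; rewrite (negPf zI).
- by rewrite memNset ?mule0// => -[/mem_set]; rewrite (negPf xI).
- by rewrite memNset ?mul0e// => -[/mem_set]; rewrite (negPf xI).
Qed.

Let innerE x : x \in `[a, b]%classic ->
  (\int[mu]_z Gb (x, z) = (\int[mu]_(z in `[c, d]) G x z)%:E)%E.
Proof.
move=> xI; rewrite GbE indicE xI.
under eq_integral do rewrite mule1.
rewrite -integral_mkcond /Rintegral fineK//.
apply: integrable_fin_num => //.
by apply: (box_inner HG); move: xI => /set_mem/=; rewrite in_itv.
Qed.

Lemma box_outer : mu.-integrable `[a, b] (EFin \o (fun x => \int[mu]_(z in `[c, d]) G x z)).
Proof.
have H : mu.-integrable (`[a, b]%classic : set RR) (fubini_F mu Gb).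
  by apply: integrableS (integrable_fubini_F box_integrable); [|exact: measurable_itv|].
move: H.
by apply: eq_integrable; [exact: measurable_itv|move=> x xI; rewrite /fubini_F innerE].
Qed.

Lemma box_swap1 : (\int[mu]_x \int[mu]_z Gb (x, z) =
  (\int[mu]_(x in `[a, b]) \int[mu]_(z in `[c, d]) G x z)%:E)%E.
Proof.
rewrite [in RHS]/Rintegral fineK; last first.
  by apply: integrable_fin_num => //; exact: box_outer.
rewrite [RHS]integral_mkcond; apply: eq_integral => x _.
rewrite /patch; case: ifPn => xI; first exact: innerE.
rewrite GbE indicE (negPf xI); under eq_integral do rewrite mule0.
exact: integral0.
Qed.

Lemma box_fubini : (\int[mu]_x \int[mu]_z Gb (x, z) = \int[mu]_z \int[mu]_x Gb (x, z))%E.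
Proof. exact: Fubini box_integrable. Qed.

Lemma box_product : (\int[(mu \x mu)%E]_u Gb u =
  (\int[mu]_(x in `[a, b]) \int[mu]_(z in `[c, d]) G x z)%:E)%E.
Proof. by rewrite -(integral12_prod_meas1 box_integrable) box_swap1. Qed.

Lemma box_integrable_on : (mu \x mu)%E.-integrable D (EFin \o (fun u => G u.1 u.2)).
Proof.
apply/(integrable_mkcond _ measurable_box); exact: box_integrable.
Qed.

Lemma box_Rintegral : \int[(mu \x mu)%E]_(u in D) G u.1 u.2 =
  \int[mu]_(x in `[a, b]) \int[mu]_(z in `[c, d]) G x z.
Proof.
rewrite {1}/Rintegral integral_mkcond.
by rewrite -/D (box_product).
Qed.

End fubini.

Lemma box_swap a b c d G : box_bounded a b c d G ->
  \int[mu]_(x in `[a, b]) \int[mu]_(z in `[c, d]) G x z =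
  \int[mu]_(z in `[c, d]) \int[mu]_(x in `[a, b]) G x z.
Proof.
move=> HG; have HG' := box_bounded_sym HG.
apply: EFin_inj; rewrite -(box_swap1 HG) -(box_swap1 HG') (box_fubini HG).
apply: eq_integral => z _; apply: eq_integral => x _.
rewrite /patch; congr (if _ then _ else _).
by apply/idP/idP => /set_mem[/= h1 h2]; apply/mem_set.
Qed.

Lemma box_outer_sym a b c d G : box_bounded a b c d G ->
  mu.-integrable `[c, d] (EFin \o (fun z => \int[mu]_(x in `[a, b]) G x z)).
Proof. by move=> /box_bounded_sym; exact: box_outer. Qed.

Lemma Rintegral_norm_le (f g : R -> R) c d :
  mu.-integrable `[c, d] (EFin \o f) -> mu.-integrable `[c, d] (EFin \o g) ->
  (forall z, c <= z <= d -> `|f z| <= g z) ->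
  `|\int[mu]_(z in `[c, d]) f z| <= \int[mu]_(z in `[c, d]) g z.
Proof.
move=> fi gi fg; have mcd : measurable (`[c, d]%classic : set RR) by exact: measurable_itv.
apply: (le_trans (le_normr_Rintegral mcd fi)).
by apply: le_Rintegral => //; exact: integrable_norm.
Qed.

End box.

(** * Measurability of the integrands *)

Section measurability.
Context d (T : measurableType d) (R : realType).
Implicit Types (f : T -> R).

Lemma measurable_inv f : measurable_fun setT f -> measurable_fun setT (fun x => (f x)^-1).
Proof.
move=> mf.
have -> : (fun x => (f x)^-1) =
    (fun x => if 0 <= f x then f x `^ (-1) else - ((- f x) `^ (-1))).
  apply/funext => x; case: leP => f0; first by rewrite powR_inv1.
  by rewrite powR_inv1 ?invrN ?opprK// oppr_ge0 ltW.
apply: measurable_fun_ifT.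
- exact: measurable_fun_ler.
- exact: (measurableT_comp (measurable_powR _)).
- apply: measurableT_comp => //.
  by apply: (measurableT_comp (measurable_powR _)); exact: measurableT_comp.
Qed.

Lemma measurable_cos f : measurable_fun setT f -> measurable_fun setT (fun x => cos (f x)).
Proof.
by move=> mf; apply: (measurableT_comp _ mf); apply: continuous_measurable_fun; exact: continuous_cos.
Qed.

Lemma measurable_sqrt f : measurable_fun setT f -> measurable_fun setT (fun x => Num.sqrt (f x)).
Proof.
by move=> mf; apply: (measurableT_comp _ mf); apply: continuous_measurable_fun; exact: sqrt_continuous.
Qed.

Lemma measurable_bracket f : measurable_fun setT f -> measurable_fun setT (fun x => bracket (f x)).
Proof.
by move=> mf; apply: (measurableT_comp _ mf); apply: continuous_measurable_fun; exact: continuous_bracket.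
Qed.

Lemma measurable_eval psi (e : symbol R) eps (s x : T -> R) : cutoff psi ->
  measurable_fun setT s -> measurable_fun setT x ->
  measurable_fun setT (fun u => eval psi e eps (s u) (x u)).
Proof.
move=> Hpsi ms mx.
have mm : measurable_fun setT (fun u => bracket (x u)) by exact: measurable_bracket.
have mw : measurable_fun setT (fun u => bracket (x u) + s u) by exact: measurable_funD.
have mq : measurable_fun setT (fun u => (bracket (x u) + s u) ^+ 2 - 1).
  by apply: measurable_funB => //; exact: measurable_funX.
elim: e => [j|e IH|e IH|e IH|e IHe f IHf|c e IH] /=.
- have mj : measurable_fun setT (euler_jet psi j).
    by apply: continuous_measurable_fun; exact: continuous_euler_jet.
  apply: (measurableT_comp mj); apply: measurable_funM => //; exact: measurable_sqrt.
- by apply: measurable_funM => //; apply: measurable_funM => //; exact: measurable_inv.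
- apply: measurable_funM => //; apply: measurable_funM => //; apply: measurable_inv.
  exact: measurable_funD.
- apply: measurable_funM => //; apply: measurable_funM; last exact: measurable_inv.
  exact: measurable_funM.
- exact: measurable_funD.
- exact: measurable_funM.
Qed.

Lemma measurable_oscillating (p y t k th' : R) (s th x : T -> R) :
  measurable_fun setT s -> measurable_fun setT th -> measurable_fun setT x ->
  measurable_fun setT (fun u => oscillating p (s u) y t k (th u) th' (x u)).
Proof.
move=> ms mth mx.
have mm : measurable_fun setT (fun u => bracket (x u)) by exact: measurable_bracket.
have mw : measurable_fun setT (fun u => bracket (x u) + s u) by exact: measurable_funD.
apply: measurable_funM; first apply: measurable_funM.
- apply: measurable_cos; apply: measurable_funD => //.
  by apply: measurable_funD; exact: measurable_funM.
- apply: measurable_cos; apply: measurable_funD => //.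
  have ml : measurable_fun setT (fun u => ln (bracket (x u) + s u)).
    exact: (measurableT_comp (@measurable_ln R) mw).
  by apply: measurable_funM.
- apply: measurable_funM; first exact: (measurableT_comp (measurable_powR _) mw).
  by apply: (measurableT_comp (measurable_powR _)); exact: measurable_funD.
Qed.

End measurability.

(** * Integration by parts in the radial variable *)

Section by_parts.
Context {R : realType} (p : R) (psi : R -> R) (Hpsi : cutoff psi).
Notation mu := (@lebesgue_measure R).
Notation RR := (measurableTypeR R).
Implicit Types (e : symbol R) (eps s t y k th x z L Z q : R).

(** With [s = z ^ 2 / t] the part [t * s] of the phase becomes [z ^ 2]. *)
Definition wave e eps t y k th th' x z : R :=
  oscillating p (z ^+ 2 / t) y t k (th + z ^+ 2) th' x * eval psi e eps (z ^+ 2 / t) x.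

(** The factors of [wave] that see [z] only through [s = z ^ 2 / t]. *)
Definition envelope e eps k th s x : R :=
  cos (k * ln (bracket x + s) + th) *
  ((bracket x + s) `^ (- p) * (bracket x + s + bracket x) `^ (p - 1)) *
  eval psi e eps s x.

Lemma waveE e eps t y k th th' x z :
  wave e eps t y k th th' x z =
  cos (y * x + t * bracket x + (th + z ^+ 2)) * envelope e eps k th' (z ^+ 2 / t) x.
Proof. by rewrite /wave /oscillating /envelope -!mulrA. Qed.

(** [s d/ds] also acts on the two powers in the envelope, which gives the terms in
    [R1] and [R2]. *)
Definition euler_weight e : symbol R :=
  Plus (Scale (- p) (R1 e)) (Plus (Scale (p - 1) (R2 e)) (euler e)).

Lemma is_derive_envelope e eps k th s x : 0 < s ->
  is_derive s 1 (fun s => envelope e eps k th s x)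
   ((envelope (euler_weight e) eps k th s x + k * envelope (R1 e) eps k (th + pi / 2) s x) / s).
Proof.
move=> s0; have m0 := bracket_gt0 x.
have w0 : 0 < bracket x + s by rewrite addr_gt0.
have wm0 : 0 < bracket x + s + bracket x by rewrite addr_gt0.
have Hw := is_derive_shift (bracket x) s.
have Hwm : is_derive s 1 (fun s => bracket x + s + bracket x) 1.
  by apply: is_derive_eq; rewrite addr0.
have H1 := @is_derive_compR _ (fun x : R => cos (k * ln x + th)) (fun s => bracket x + s) s _ _ Hw (is_derive_cos_ln k th w0).
have H2 := @is_derive_compR _ (fun x : R => x `^ (- p)) (fun s => bracket x + s) s _ _ Hw (is_derive_powR (- p) w0).
have H3 := @is_derive_compR _ (fun x : R => x `^ (p - 1)) (fun s => bracket x + s + bracket x) s _ _ Hwm (is_derive_powR (p - 1) wm0).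
have H4 := is_derive_eval e eps x Hpsi s0.
rewrite /envelope; apply: is_derive_eq.
have -> : k * ln (bracket x + s) + (th + pi / 2) = k * ln (bracket x + s) + th + pi / 2 by ring.
rewrite !powRB1// /euler_weight /= (cosD _ (pi / 2)) cos_pihalf sin_pihalf /r1 /r2.
rewrite /GRing.scale/=.
by field; rewrite !lt0r_neq0.
Qed.

Lemma is_derive_sqr_div t z : is_derive z 1 (fun z => z ^+ 2 / t) (2 * z / t).
Proof. by apply: is_derive_eq; rewrite /GRing.scale/=; ring. Qed.

(** One integration by parts in [z] against [cos (z ^ 2)], in the form of the
    derivative of its boundary term: [z ^ q] drops to [z ^ (q - 2)] because the
    phase has derivative [2 z] and the envelope is differentiated by [z d/dz]. *)
Lemma is_derive_wave q e eps t y k th th' x z : 0 < t -> 0 < z ->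
  is_derive z 1
    (fun z => 2^-1 * (z `^ (q - 1) * wave e eps t y k (th - pi / 2) th' x z))
    (z `^ q * wave e eps t y k th th' x z +
     z `^ (q - 2) *
      (wave (Plus (Scale ((q - 1) / 2) e) (euler_weight e)) eps t y k (th - pi / 2) th' x z +
       k * wave (R1 e) eps t y k (th - pi / 2) (th' + pi / 2) x z)).
Proof.
move=> t0 z0.
have s0 : 0 < z ^+ 2 / t by rewrite divr_gt0// exprn_gt0.
have He := @is_derive_compR _ (fun s => envelope e eps k th' s x) (fun z => z ^+ 2 / t) z _ _
  (is_derive_sqr_div t z) (is_derive_envelope e eps k th' x s0).
have Ha : is_derive z 1 (fun z : R => y * x + t * bracket x + (th - pi / 2 + z ^+ 2)) (2 * z).
  by apply: is_derive_eq; rewrite /GRing.scale/=; ring.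
have Hc := is_derive_compR Ha (is_derive_cos _).
have Hp := is_derive_powR (q - 1) z0.
have -> : (fun z => 2^-1 * (z `^ (q - 1) * wave e eps t y k (th - pi / 2) th' x z)) =
  (fun z => 2^-1 * (z `^ (q - 1) * (cos (y * x + t * bracket x + (th - pi / 2 + z ^+ 2)) *
     envelope e eps k th' (z ^+ 2 / t) x))).
  by apply/funext => u; rewrite waveE.
apply: is_derive_eq; rewrite !waveE.
have -> : envelope (Plus (Scale ((q - 1) / 2) e) (euler_weight e)) eps k th' (z ^+ 2 / t) x =
   (q - 1) / 2 * envelope e eps k th' (z ^+ 2 / t) x + envelope (euler_weight e) eps k th' (z ^+ 2 / t) x.
  by rewrite /envelope /=; ring.
have -> : y * x + t * bracket x + (th - pi / 2 + z ^+ 2) =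
  y * x + t * bracket x + (th + z ^+ 2) - pi / 2 by ring.
rewrite (sinB _ (pi / 2)) cos_pihalf sin_pihalf.
have -> : q - 2 = q - 1 - 1 by ring.
rewrite !powRB1//.
rewrite /GRing.scale/=.
by field; rewrite !lt0r_neq0.
Qed.

Lemma measurable_wave e eps t y k th th' :
  measurable_fun [set: RR * RR] (fun u => wave e eps t y k th th' u.1 u.2).
Proof.
have m2 : measurable_fun [set: RR * RR] (fun u : RR * RR => (u.2 : R) ^+ 2).
  by apply: measurable_funX; exact: measurable_snd.
have ms : measurable_fun [set: RR * RR] (fun u : RR * RR => (u.2 : R) ^+ 2 / t).
  by apply: measurable_funM => //; exact: measurable_cst.
apply: measurable_funM.
  apply: measurable_oscillating => //.
  by apply: measurable_funD => //; exact: measurable_cst.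
by apply: measurable_eval => //; exact: measurable_fst.
Qed.

Lemma oscillating_le s y t k th th' x : 0 <= s ->
  `|oscillating p s y t k th th' x| <= 2 `^ `|p - 1|.
Proof.
move=> s0; rewrite /oscillating amplitude_ratio//.
have m1 := bracket_ge1 x; have m0 := bracket_gt0 x.
have /andP[r0 r1] := ratio_itv x s0.
rewrite normrM -[leRHS]mul1r ler_pM//.
  by rewrite normrM mulr_ile1// cos_max.
rewrite normrM -[leRHS]mul1r ler_pM//.
  by rewrite ger0_norm ?invr_ge0 ?(ltW m0)// invf_le1.
rewrite normrM -[leRHS]mul1r ler_pM//; first by rewrite (ger0_norm (ltW r0)).
rewrite ger0_norm ?powR_ge0//; apply: (@le_trans _ _ ((1 + ratio s x) `^ `|p - 1|)).
  by rewrite ler_powR ?ler_norm// lerDl ltW.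
by rewrite ge0_ler_powR ?nnegrE//; lra.
Qed.

Lemma wave_box e eps t y k th th' L a b : 0 < eps -> 0 < t ->
  box_bounded 0 L a b (wave e eps t y k th th').
Proof.
move=> e0 t0; split; first exact: measurable_wave.
have [M HM] := bv_eval e Hpsi.
exists (2 `^ `|p - 1| * M) => x z /andP[x0 _] _.
have s0 : 0 <= z ^+ 2 / t by rewrite divr_ge0 ?sqr_ge0// ltW.
rewrite normrM ler_pM// ?oscillating_le//.
by apply: bv_bounded x0; exact: HM.
Qed.

Lemma powR_box q L Z : box_bounded 0 L 1 Z (fun _ z => z `^ q).
Proof.
split; first by apply: (measurableT_comp (measurable_powR q)); exact: measurable_snd.
exists (Z `^ `|q|) => x z _ /andP[z1 zZ].
rewrite ger0_norm ?powR_ge0//; apply: (@le_trans _ _ (z `^ `|q|)).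
  by rewrite ler_powR// ler_norm.
by rewrite ge0_ler_powR ?nnegrE//; lra.
Qed.

Lemma expr_box n L Z : box_bounded 0 L 0 Z (fun _ z => z ^+ n).
Proof.
split; first by apply: measurable_funX; exact: measurable_snd.
exists (Z ^+ n) => x z _ /andP[z1 zZ].
by rewrite ger0_norm ?exprn_ge0// lerXn2r ?nnegrE// (le_trans z1).
Qed.

Lemma wave_out e eps t y k th th' x z : 1 <= eps * radius (z ^+ 2 / t) x ->
  wave e eps t y k th th' x z = 0.
Proof. by move=> out; rewrite /wave eval_out ?mulr0. Qed.

Lemma slice_bound e : exists2 C : R, 0 <= C &
  forall eps t y k th th' L z, 0 < eps -> 0 < t -> k != 0 ->
  `|k| * `|\int[mu]_(x in `[0, L]) wave e eps t y k th th' x z| <= C * (1 + `|k|) ^+ 3.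
Proof.
have [M HM] := bv_eval e Hpsi; have [C C0 HC] := oscillating_bound p.
have M0 : 0 <= M by exact: bv_ge0 (HM 1 0 ltr01 (lexx _)).
exists (C * M); first exact: mulr_ge0.
move=> eps t y k th th' L z e0 t0 k0.
have s0 : 0 <= z ^+ 2 / t by rewrite divr_ge0 ?sqr_ge0// ltW.
rewrite -mulrA (mulrC M) mulrA.
by apply: HC => //; exact: HM.
Qed.

Lemma wave_by_parts q e eps t y k th th' x Z : 0 < eps -> 0 < t -> 1 <= Z -> 0 <= x ->
  1 <= eps * radius (Z ^+ 2 / t) x ->
  \int[mu]_(z in `[1, Z]) (z `^ q * wave e eps t y k th th' x z) =
  - (2^-1 * wave e eps t y k (th - pi / 2) th' x 1) -
  (\int[mu]_(z in `[1, Z]) (z `^ (q - 2) *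
     wave (Plus (Scale ((q - 1) / 2) e) (euler_weight e)) eps t y k (th - pi / 2) th' x z) +
   k * \int[mu]_(z in `[1, Z]) (z `^ (q - 2) *
     wave (R1 e) eps t y k (th - pi / 2) (th' + pi / 2) x z)).
Proof.
move=> e0 t0 Z1 x0 out.
set e2 := Plus _ _.
have cw q' e' th1 th1' z : 1 <= z -> {for z, continuous (fun z => z `^ q' * wave e' eps t y k th1 th1' x z)}.
  move=> z1; have z0 : 0 < z by lra.
  have := is_derive_continuous (is_derive_wave (q' + 1) e' eps y k (th1 + pi / 2) th1' x t0 z0).
  rewrite !addrK => H.
  have -> : (fun z => z `^ q' * wave e' eps t y k th1 th1' x z) =
      (fun z => 2 * (2^-1 * (z `^ q' * wave e' eps t y k th1 th1' x z))).
    by apply/funext => u; field.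
  by apply: cvgM; [exact: cvg_cst|exact: H].
have iw q' e' th1 th1' : mu.-integrable `[1, Z] (EFin \o (fun z => z `^ q' * wave e' eps t y k th1 th1' x z)).
  by apply: continuous_itv_integrable => z /andP[z1 _]; exact: cw.
have mI : measurable (`[1, Z]%classic : set RR) by exact: measurable_itv.
have := @Rintegral_FTC _ _ _ 1 Z Z1
  (fun z zI => is_derive_wave q e eps y k th th' x t0 (lt_le_trans ltr01 (proj1 (andP zI)))).
have E z : z `^ q * wave e eps t y k th th' x z +
     z `^ (q - 2) * (wave e2 eps t y k (th - pi / 2) th' x z +
       k * wave (R1 e) eps t y k (th - pi / 2) (th' + pi / 2) x z) =
   z `^ q * wave e eps t y k th th' x z +
   (z `^ (q - 2) * wave e2 eps t y k (th - pi / 2) th' x z +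
    k * (z `^ (q - 2) * wave (R1 e) eps t y k (th - pi / 2) (th' + pi / 2) x z)) by ring.
have -> : (fun z => z `^ q * wave e eps t y k th th' x z +
     z `^ (q - 2) * (wave e2 eps t y k (th - pi / 2) th' x z +
       k * wave (R1 e) eps t y k (th - pi / 2) (th' + pi / 2) x z)) =
   (fun z => z `^ q * wave e eps t y k th th' x z +
   (z `^ (q - 2) * wave e2 eps t y k (th - pi / 2) th' x z +
    k * (z `^ (q - 2) * wave (R1 e) eps t y k (th - pi / 2) (th' + pi / 2) x z))).
  by apply/funext => z; exact: E.
have ik := integrableRZl k mI (iw (q - 2) (R1 e) (th - pi / 2) (th' + pi / 2)).
have i2 := integrableRD mI (iw (q - 2) e2 (th - pi / 2) th') ik.
rewrite RintegralD// RintegralD// RintegralZl//.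
move=> FTC; rewrite -[LHS](addrK (\int[mu]_(z in `[1, Z]) (z `^ (q - 2) * wave e2 eps t y k (th - pi / 2) th' x z) +
  k * \int[mu]_(z in `[1, Z]) (z `^ (q - 2) * wave (R1 e) eps t y k (th - pi / 2) (th' + pi / 2) x z))).
rewrite FTC; last first.
  move=> z /andP[z1 _].
  apply: cvgD; first exact: cw.
  apply: cvgD; first exact: cw.
  by apply: cvgM; [exact: cvg_cst|exact: cw].
rewrite (wave_out _ _ _ _ _ out) powR1 mul1r.
by ring.
Qed.

(** Each step lowers the power of [z] by two at the price of a factor [k]; once
    it is integrable the uniform bound on slices can be integrated in [z]. *)
Lemma tail_bound (n : nat) e q : q <= 2 * n%:R - 2 ->
  exists C : R, exists N : nat, 0 <= C /\
  forall eps t y k th th' L Z, 0 < eps -> 0 < t -> k != 0 -> 1 <= Z ->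
  (forall x, 1 <= eps * radius (Z ^+ 2 / t) x) ->
  `|k| * `|\int[mu]_(x in `[0, L]) \int[mu]_(z in `[1, Z])
     (z `^ q * wave e eps t y k th th' x z)| <= C * (1 + `|k|) ^+ N.
Proof.
elim: n e q => [|n IH] e q.
  rewrite mulr0 sub0r => q2.
  have [C C0 HC] := slice_bound e.
  exists C, 3; split => // eps t y k th th' L Z e0 t0 k0 Z1 out.
  have HG : box_bounded 0 L 1 Z (fun x z => z `^ q * wave e eps t y k th th' x z).
    by apply: box_boundedM; [exact: powR_box|exact: wave_box].
  rewrite (box_swap HG).
  have mI : measurable (`[1, Z]%classic : set RR) by exact: measurable_itv.
  have mJ : measurable (`[0, L]%classic : set RR) by exact: measurable_itv.
  rewrite -normrM -RintegralZl//; last exact: box_outer_sym HG.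
  set A := C * (1 + `|k|) ^+ 3.
  have A0 : 0 <= A by rewrite mulr_ge0// exprn_ge0// addr_ge0.
  have cz z : 1 <= z -> {for z, continuous (fun z : R => A * z ^- 2)}.
    move=> z1; apply: cvgM; first exact: cvg_cst.
    by apply: cvgV; [rewrite expf_neq0// lt0r_neq0//; lra|exact: exprn_continuous].
  have I2 : \int[mu]_(z in `[1, Z]) (A * z ^- 2) <= A.
    have dA z : 1 <= z <= Z -> is_derive z 1 (fun z => - A * z^-1) (A * z ^- 2).
      move=> /andP[z1 _]; have z0 : z != 0 by rewrite lt0r_neq0//; lra.
      have H := @is_derive_inv _ id z 1 z0 (is_derive_id _ _).
      by apply: is_derive_eq; rewrite /GRing.scale/=; field.
    have -> := Rintegral_FTC Z1 dA (fun z zI => cz z (proj1 (andP zI))).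
    by rewrite invr1 mulr1 opprK mulNr addrC gerDl oppr_le0 mulr_ge0// invr_ge0; lra.
  apply: le_trans I2; apply: Rintegral_norm_le.
  - by apply: integrableRZl => //; exact: box_outer_sym HG.
  - by apply: continuous_itv_integrable => z /andP[z1 _]; exact: cz.
  move=> z /andP[z1 zZ]; have z0 : 0 < z by lra.
  rewrite RintegralZl//; last first.
    by apply: (box_inner (box_bounded_sym (wave_box e y k th th' L 1 Z e0 t0))); rewrite z1.
  rewrite mulrCA normrM mulrC ler_pM//.
    by rewrite normrM; exact: HC.
  rewrite ger0_norm ?powR_ge0//.
  apply: (@le_trans _ _ (z `^ (- 2))); first by rewrite ler_powR.
  by rewrite powRN powR_mulrn// ltW.
move=> qn.
have qn' : q - 2 <= 2 * n%:R - 2 by move: qn; rewrite -natr1; lra.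
have [C0 C0p H0] := slice_bound e.
have [C1 [N1 [C1p H1]]] := IH (Plus (Scale ((q - 1) / 2) e) (euler_weight e)) (q - 2) qn'.
have [C2 [N2 [C2p H2]]] := IH (R1 e) (q - 2) qn'.
exists (C0 + C1 + C2), (3 + N1 + N2.+1)%N; split; first by rewrite !addr_ge0.
move=> eps t y k th th' L Z e0 t0 k0 Z1 out.
have mJ : measurable (`[0, L]%classic : set RR) by exact: measurable_itv.
set e2 := Plus _ _ in H1.
have B0 : box_bounded 0 L 1 1 (wave e eps t y k (th - pi / 2) th') by exact: wave_box.
have B1 : box_bounded 0 L 1 Z (fun x z => z `^ (q - 2) * wave e2 eps t y k (th - pi / 2) th' x z).
  by apply: box_boundedM; [exact: powR_box|exact: wave_box].
have B2 : box_bounded 0 L 1 Z (fun x z => z `^ (q - 2) * wave (R1 e) eps t y k (th - pi / 2) (th' + pi / 2) x z).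
  by apply: box_boundedM; [exact: powR_box|exact: wave_box].
have i0 : mu.-integrable `[0, L] (EFin \o (fun x => wave e eps t y k (th - pi / 2) th' x 1)).
  by apply: (box_inner (box_bounded_sym B0)); rewrite lexx.
have i0' := integrableRZl (- 2^-1) mJ i0.
have i1 := box_outer B1; have i2 := box_outer B2.
have i2' := integrableRZl k mJ i2.
have i12 := integrableRD mJ i1 i2'.
rewrite [X in _ * `|X|](_ : _ = \int[mu]_(x in `[0, L]) (- 2^-1 * wave e eps t y k (th - pi / 2) th' x 1 -
  (\int[mu]_(z in `[1, Z]) (z `^ (q - 2) * wave e2 eps t y k (th - pi / 2) th' x z) +
   k * \int[mu]_(z in `[1, Z]) (z `^ (q - 2) * wave (R1 e) eps t y k (th - pi / 2) (th' + pi / 2) x z)))); last first.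
  apply: eq_Rintegral => x /set_mem/=; rewrite in_itv/= => /andP[x0 _].
  by rewrite wave_by_parts// -mulNr.
rewrite RintegralB// RintegralD// !RintegralZl//.
have h0 := H0 eps t y k (th - pi / 2) th' L 1 e0 t0 k0.
have h1 := H1 eps t y k (th - pi / 2) th' L Z e0 t0 k0 Z1 out.
have h2 := H2 eps t y k (th - pi / 2) (th' + pi / 2) L Z e0 t0 k0 Z1 out.
set J0 := Rintegral _ _ _ in h0 *.
set J1 := Rintegral _ _ _ in h1 *.
set J2 := Rintegral _ _ _ in h2 *.
have tri : `|- 2^-1 * J0 - (J1 + k * J2)| <= `|J0| + (`|J1| + `|k| * `|J2|).
  apply: (le_trans (ler_normB _ _)); apply: lerD.
    by rewrite mulNr normrN normrM ger0_norm ?invr_ge0// ler_piMl// invf_le1// ler1n.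
  by rewrite -normrM; exact: ler_normD.
apply: (le_trans (ler_wpM2l (normr_ge0 k) tri)).
set K := 1 + `|k|.
have K1 : 1 <= K by rewrite lerDl.
have kK : `|k| <= K by rewrite lerDr.
have up a b : (a <= b)%N -> K ^+ a <= K ^+ b by move=> ab; rewrite ler_weXn2l.
rewrite !mulrDr addrA !mulrDl; apply: lerD; first apply: lerD.
- by apply: (le_trans h0); rewrite ler_wpM2l// up// -addnA leq_addr.
- by apply: (le_trans h1); rewrite ler_wpM2l// up// addnAC leq_addl.
- apply: (@le_trans _ _ (K * (C2 * K ^+ N2))).
    by rewrite ler_pM// mulr_ge0.
  by rewrite mulrCA -exprS ler_wpM2l// up// leq_addl.
Qed.

(** Near [z = 0] the power [z ^ j] is integrable and no integration by parts is
    needed. *)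
Lemma half_line_bound (j : nat) : exists C : R, exists N : nat, 0 <= C /\
  forall eps t y k th th' L Z, 0 < eps -> 0 < t -> k != 0 -> 1 <= Z ->
  (forall x, 1 <= eps * radius (Z ^+ 2 / t) x) ->
  `|k| * `|\int[mu]_(x in `[0, L]) \int[mu]_(z in `[0, Z])
     (z ^+ j * wave (@Jet R 0) eps t y k th th' x z)| <= C * (1 + `|k|) ^+ N.
Proof.
have [C0 C0p H0] := slice_bound (@Jet R 0).
have [|C1 [N1 [C1p H1]]] := @tail_bound j.+2 (@Jet R 0) j%:R.
  by rewrite -!natr1; have : 0 <= j%:R :> R by []; lra.
exists (C0 + C1), (3 + N1)%N; split; first by rewrite addr_ge0.
move=> eps t y k th th' L Z e0 t0 k0 Z1 out.
have Z0 : 0 <= Z by lra.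
have mI : measurable (`[0, 1]%classic : set RR) by exact: measurable_itv.
have mJ : measurable (`[0, L]%classic : set RR) by exact: measurable_itv.
have B u : box_bounded 0 L 0 u (fun x z => z ^+ j * wave (@Jet R 0) eps t y k th th' x z).
  by apply: box_boundedM; [exact: expr_box|exact: wave_box].
have B1 : box_bounded 0 L 1 Z (fun x z => z `^ j%:R * wave (@Jet R 0) eps t y k th th' x z).
  by apply: box_boundedM; [exact: powR_box|exact: wave_box].
rewrite [X in _ * `|X|](_ : _ = \int[mu]_(x in `[0, L])
  (\int[mu]_(z in `[0, 1]) (z ^+ j * wave (@Jet R 0) eps t y k th th' x z) +
   \int[mu]_(z in `[1, Z]) (z `^ j%:R * wave (@Jet R 0) eps t y k th th' x z))); last first.
  apply: eq_Rintegral => x /set_mem/=; rewrite in_itv/= => xL.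
  rewrite (Rintegral_itv_split ler01 Z1); last exact: (box_inner (B Z) xL).
  congr (_ + _); apply: eq_Rintegral => z /set_mem/=; rewrite in_itv/= => /andP[z1 _].
  by rewrite powR_mulrn//; lra.
rewrite RintegralD//; [|exact: box_outer (B 1)|exact: box_outer B1].
have h1 := H1 eps t y k th th' L Z e0 t0 k0 Z1 out.
have h0 : `|k| * `|\int[mu]_(x in `[0, L]) \int[mu]_(z in `[0, 1]) (z ^+ j * wave (@Jet R 0) eps t y k th th' x z)| <= C0 * (1 + `|k|) ^+ 3.
  rewrite (box_swap (B 1)) -normrM -RintegralZl//; last exact: box_outer_sym (B 1).
  set A := C0 * (1 + `|k|) ^+ 3.
  have A0 : 0 <= A by rewrite mulr_ge0// exprn_ge0// addr_ge0.
  have I2 : \int[mu]_(z in `[0, 1]) A <= A.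
    have e1 : fine (mu `[0 : R, 1]%classic) = 1.
      by rewrite lebesgue_measure_itv/= lte_fin ltr01 -EFinB/= subr0.
    by rewrite Rintegral_cst// -[leRHS]mulr1 ler_wpM2l// [leLHS]e1.
  apply: le_trans I2; apply: Rintegral_norm_le.
  - by apply: integrableRZl => //; exact: box_outer_sym (B 1).
  - by apply: continuous_itv_integrable => z _; exact: cvg_cst.
  move=> z /andP[z0 z1].
  rewrite RintegralZl//; last first.
    by apply: (box_inner (box_bounded_sym (wave_box (@Jet R 0) y k th th' L 0 1 e0 t0))); rewrite z0.
  rewrite mulrCA normrM -[leRHS]mul1r ler_pM//.
    by rewrite ger0_norm ?exprn_ge0// exprn_ile1.
  by rewrite normrM; exact: H0.
apply: (le_trans (ler_wpM2l (normr_ge0 k) (ler_normD _ _))); rewrite mulrDr mulrDl.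
set K := 1 + `|k|.
have K1 : 1 <= K by rewrite lerDl.
have up a b : (a <= b)%N -> K ^+ a <= K ^+ b by move=> ab; rewrite ler_weXn2l.
apply: lerD.
  by apply: (le_trans h0); rewrite ler_wpM2l// up// leq_addr.
by apply: (le_trans h1); rewrite ler_wpM2l// up// leq_addl.
Qed.

End by_parts.

(** * Changes of variables on the line *)

Section line.
Context {R : realType}.
Notation mu := (@lebesgue_measure R).
Notation RR := (measurableTypeR R).
Local Open Scope ereal_scope.

(** A measure on the line is determined by its values on intervals. *)
Lemma ge0_integral_invariant (phi : RR -> RR) (k : R) (f : RR -> \bar R) :
  measurable_fun setT phi -> (0 <= k)%R ->
  (forall a b : R, (a < b)%R -> k%:E * mu (phi @^-1` `]a, b]) = (b - a)%:E) ->
  measurable_fun setT f -> (forall x, 0 <= f x) ->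
  k%:E * \int[mu]_x f (phi x) = \int[mu]_x f x.
Proof.
move=> mphi k0 H mf f0.
have E A : measurable A -> mu A = mscale (NngNum k0) (pushforward mu phi) A.
  move=> mA; apply: lebesgue_measure_unique => // _ [[a b]] _ <-.
  have [ab|ba] := ltP a b; last first.
    by rewrite set_itv_ge ?bnd_simp -?leNgt// !measure0.
  apply: (@etrans _ _ (k%:E * mu (phi @^-1` `]a, b]))); last by [].
  by rewrite H// lebesgue_measure_itv/= lte_fin ab EFinB.
rewrite [RHS](eq_measure_integral (mscale (NngNum k0) (pushforward mu phi))).
  rewrite ge0_integral_mscale//= ge0_integral_pushforward//.
by move=> A mA _; exact: (E mphi A mA).
Qed.

Lemma ge0_integral_translate (c : R) (f : RR -> \bar R) :
  measurable_fun setT f -> (forall x, 0 <= f x) ->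
  \int[mu]_x f (x + c)%R = \int[mu]_x f x.
Proof.
move=> mf f0; rewrite -[RHS](@ge0_integral_invariant (fun x => x + c)%R 1 f)// ?mul1e//.
  by apply: measurable_funD => //; exact: measurable_cst.
move=> a b ab; rewrite mul1e.
rewrite (_ : _ @^-1` _ = [set` `]a - c, b - c]%R]); last first.
  by apply/seteqP; split => x; rewrite /= !in_itv/= ltrBlDr lerBrDr.
by rewrite lebesgue_measure_itv/= lte_fin ltrD2r ab -EFinB; congr EFin; ring.
Qed.

Lemma ge0_integral_reflect (f : RR -> \bar R) :
  measurable_fun setT f -> (forall x, 0 <= f x) ->
  \int[mu]_x f (- x)%R = \int[mu]_x f x.
Proof.
move=> mf f0.
rewrite [RHS](eq_measure_integral (pushforward mu (-%R : RR -> RR))); last first.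
  by move=> A mA _; exact/esym/lebesgue_measureN.
by rewrite ge0_integral_pushforward//; exact: measurableT_comp.
Qed.

Lemma ge0_integral_dilate (c : R) (f : RR -> \bar R) : (0 < c)%R ->
  measurable_fun setT f -> (forall x, 0 <= f x) ->
  c%:E * \int[mu]_x f (c * x)%R = \int[mu]_x f x.
Proof.
move=> c0 mf f0; apply: ge0_integral_invariant => //.
  exact: ltW.
move=> a b ab.
rewrite (_ : _ @^-1` _ = [set` `]a / c, b / c]%R]); last first.
  by apply/seteqP; split => x; rewrite /= !in_itv/= ltr_pdivrMr// ler_pdivlMr// mulrC.
rewrite lebesgue_measure_itv/= lte_fin ltr_pM2r ?invr_gt0// ab -EFinB -EFinM; congr EFin.
by field; rewrite lt0r_neq0.
Qed.

End line.

(** * Rotations of the plane *)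

Section plane.
Context {R : realType}.
Notation mu := (@lebesgue_measure R).
Notation RR := (measurableTypeR R).
Local Open Scope ereal_scope.
Implicit Types f : RR * RR -> \bar R.

Definition shear2 (a : R) (u : RR * RR) : RR * RR := (u.1, u.2 + a * u.1)%R.
Definition shear1 (a : R) (u : RR * RR) : RR * RR := (u.1 + a * u.2, u.2)%R.

Lemma measurable_shear1 a : measurable_fun setT (shear1 a).
Proof.
apply: measurable_fun_pair; last exact: measurable_snd.
apply: measurable_funD; first exact: measurable_fst.
by apply: measurable_funM; [exact: measurable_cst|exact: measurable_snd].
Qed.

Lemma measurable_shear2 a : measurable_fun setT (shear2 a).
Proof.
apply: measurable_fun_pair; first exact: measurable_fst.
apply: measurable_funD; first exact: measurable_snd.
by apply: measurable_funM; [exact: measurable_cst|exact: measurable_fst].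
Qed.

Lemma ge0_integral_shear2 a f : measurable_fun setT f -> (forall u, 0 <= f u) ->
  \int[mu]_x \int[mu]_y f (shear2 a (x, y)) = \int[mu]_x \int[mu]_y f (x, y).
Proof.
move=> mf f0; apply: eq_integral => x _.
rewrite /shear2 /= (@ge0_integral_translate _ (a * x)%R (fun y => f (x, y)))//.
exact: (measurableT_comp mf (pair1_measurable x)).
Qed.

Lemma ge0_integral_shear1 a f : measurable_fun setT f -> (forall u, 0 <= f u) ->
  \int[mu]_x \int[mu]_y f (shear1 a (x, y)) = \int[mu]_x \int[mu]_y f (x, y).
Proof.
move=> mf f0.
rewrite (@fubini_tonelli _ _ _ _ _ mu mu (fun u => f (shear1 a u)))//; last first.
  exact: (measurableT_comp mf (measurable_shear1 a)).
rewrite (@fubini_tonelli _ _ _ _ _ mu mu f)//.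
apply: eq_integral => y _.
rewrite /shear1 /= (@ge0_integral_translate _ (a * y)%R (fun x => f (x, y)))//.
exact: (measurableT_comp mf (pair2_measurable y)).
Qed.

(** A plane rotation is a product of three shears. *)
Lemma ge0_integral_rotate (c s : R) f : (c ^+ 2 + s ^+ 2 = 1)%R -> (s != 0)%R ->
  measurable_fun setT f -> (forall u, 0 <= f u) ->
  \int[mu]_x \int[mu]_y f (c * x - s * y, s * x + c * y)%R =
  \int[mu]_x \int[mu]_y f (x, y).
Proof.
move=> cs s0 mf f0; pose al := ((c - 1) / s)%R.
have m1 := measurable_shear1 al; have m2 := measurable_shear2 s.
have ma := measurableT_comp mf m1.
apply: (etrans _ (ge0_integral_shear1 al mf f0)).
apply: (etrans _ (@ge0_integral_shear2 s (f \o shear1 al) ma (fun u => f0 _))).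
apply: (etrans _ (@ge0_integral_shear1 al (f \o shear1 al \o shear2 s)
  (measurableT_comp ma m2) (fun u => f0 _))).
apply: eq_integral => x _; apply: eq_integral => y _.
rewrite /shear1 /shear2 /=; congr (f (_, _)); last by rewrite /al; field.
have e1 : (al * s = c - 1)%R by rewrite /al; field.
have e2 : (al * (c + 1) = - s)%R.
  apply: (mulIf s0); have -> : (al * (c + 1) * s = al * s * (c + 1))%R by ring.
  rewrite e1; have -> : ((c - 1) * (c + 1) = c ^+ 2 - (c ^+ 2 + s ^+ 2))%R by rewrite cs; ring.
  by ring.
have -> : (x + al * y + al * (y + s * (x + al * y)) =
   x + al * s * x + al * (1 + (1 + al * s)) * y)%R by ring.
by rewrite e1 (_ : (1 + (1 + (c - 1)) = c + 1)%R) ?e2; ring.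
Qed.

(** The rotation that carries [(a, b)] to an axis leaves [x ^ 2 + y ^ 2] alone. *)
Lemma ge0_integral_align (a b r : R) (H : RR * RR -> \bar R) : (0 <= b)%R ->
  measurable_fun setT H -> (forall u, 0 <= H u) ->
  \int[mu]_x \int[mu]_y H (a * x + b * y, x ^+ 2 + y ^+ 2 + r)%R =
  \int[mu]_x \int[mu]_y H (Num.sqrt (a ^+ 2 + b ^+ 2) * y, x ^+ 2 + y ^+ 2 + r)%R.
Proof.
move=> b0 mH H0; have [->|a0] := eqVneq a 0%R.
  rewrite expr0n add0r sqrtr_sqr (ger0_norm b0).
  by under eq_integral do under eq_integral do rewrite mul0r add0r.
set rho := Num.sqrt _.
have q0 : (0 < a ^+ 2 + b ^+ 2)%R by rewrite ltr_pwDl ?sqr_ge0// lt_neqAle sqr_ge0 eq_sym sqrf_eq0 a0.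
have rho0 : (0 < rho)%R by rewrite sqrtr_gt0.
have rn : (rho != 0)%R by rewrite lt0r_neq0.
have rho2 : (rho ^+ 2 = a ^+ 2 + b ^+ 2)%R by rewrite sqr_sqrtr// ltW.
rewrite -(@ge0_integral_rotate (b / rho) (a / rho) (fun u => H (rho * u.2, u.1 ^+ 2 + u.2 ^+ 2 + r)%R)).
- apply: eq_integral => x _; apply: eq_integral => y _ /=; congr (H (_, _)).
    by field.
  have -> : ((b / rho * x - a / rho * y) ^+ 2 + (a / rho * x + b / rho * y) ^+ 2 =
     (a ^+ 2 + b ^+ 2) / rho ^+ 2 * (x ^+ 2 + y ^+ 2))%R by field.
  by rewrite rho2 divff ?mul1r// lt0r_neq0.
- have -> : ((b / rho) ^+ 2 + (a / rho) ^+ 2 = (a ^+ 2 + b ^+ 2) / rho ^+ 2)%R by field.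
  by rewrite rho2 divff// lt0r_neq0.
- by rewrite mulf_neq0// invr_neq0.
- apply: (measurableT_comp mH); apply: measurable_fun_pair.
    by apply: measurable_funM; [exact: measurable_cst|exact: measurable_snd].
  apply: measurable_funD; last exact: measurable_cst.
  by apply: measurable_funD; apply: measurable_funX; [exact: measurable_fst|exact: measurable_snd].
- by [].
Qed.

End plane.

(** * Rotations of space *)

Section space.
Context {R : realType}.
Notation mu := (@lebesgue_measure R).
Notation RR := (measurableTypeR R).
Notation leb := (lebesgue_measure_Rn R).
Local Open Scope ereal_scope.

Lemma ge0_integral_Rn_cons n (f : Rn R n.+1 -> \bar R) :
  measurable_fun setT f -> (forall v, 0 <= f v) ->
  \int[leb n.+1]_v f v = \int[mu]_x \int[leb n]_v f (Rn_cons (x, v)).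
Proof.
move=> mf f0.
have mc := @measurable_Rn_cons R n.
rewrite (eq_measure_integral (pushforward (mu \x leb n) (@Rn_cons R n)))//.
rewrite ge0_integral_pushforward//.
by rewrite preimage_setT (@fubini_tonelli1 _ _ _ _ _ mu (leb n) (f \o @Rn_cons R n)
  (measurableT_comp mf mc) (fun u => f0 _)).
Qed.

Lemma dotRn_cons n (x y : R) (u v : Rn R n) :
  dotRn (Rn_cons (x, u)) (Rn_cons (y, v)) = (x * y + dotRn u v)%R.
Proof.
rewrite /dotRn big_ord_recl /= !(tnth_nth 0%R) /=; congr (_ + _)%R.
by apply: eq_bigr => i _; rewrite !(tnth_nth 0%R).
Qed.

Lemma dotRn0 (u v : Rn R 0) : dotRn u v = 0%R.
Proof. by rewrite /dotRn big_ord0. Qed.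

Lemma dotRn_ge0 n (u : Rn R n) : (0 <= dotRn u u)%R.
Proof. by apply: sumr_ge0 => i _; rewrite -expr2 sqr_ge0. Qed.

Lemma measurable_dotRn n (x : Rn R n) d (T : measurableType d) (v : T -> Rn R n) :
  measurable_fun setT v -> measurable_fun setT (fun u => dotRn x (v u)).
Proof.
move=> mv; apply: measurable_sum => i.
apply: measurable_funM; first exact: measurable_cst.
exact: (measurableT_comp (measurable_tnth i) mv).
Qed.

Lemma measurable_sqrRn n d (T : measurableType d) (v : T -> Rn R n) :
  measurable_fun setT v -> measurable_fun setT (fun u => dotRn (v u) (v u)).
Proof.
move=> mv; apply: measurable_sum => i.
by apply: measurable_funM; exact: (measurableT_comp (measurable_tnth i) mv).
Qed.

Lemma ge0_tonelli3 d (V : measurableType d) (m : {sigma_finite_measure set V -> \bar R})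
    (g : RR * RR * V -> \bar R) :
  measurable_fun setT g -> (forall u, 0 <= g u) ->
  \int[mu]_x \int[mu]_y \int[m]_v g (x, y, v) = \int[m]_v \int[mu]_x \int[mu]_y g (x, y, v).
Proof.
move=> mg g0.
transitivity (\int[mu]_x \int[m]_v \int[mu]_y g (x, y, v)).
  apply: eq_integral => x _.
  rewrite (@fubini_tonelli _ _ _ _ _ mu m (fun u => g (x, u.1, u.2)))//.
  apply: (measurableT_comp mg); apply: measurable_fun_pair; last exact: measurable_snd.
  by apply: measurable_fun_pair; [exact: measurable_cst|exact: measurable_fst].
pose h (u : RR * V * RR) := g (u.1.1, u.2, u.1.2).
have mh : measurable_fun setT h.
  apply: (measurableT_comp mg).
  have m1 : measurable_fun setT (fun u : RR * V * RR => u.1.1).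
    exact: (measurableT_comp measurable_fst measurable_fst).
  have m2 : measurable_fun setT (fun u : RR * V * RR => u.1.2).
    exact: (measurableT_comp measurable_snd measurable_fst).
  apply: measurable_fun_pair => //.
  by apply: measurable_fun_pair => //; exact: measurable_snd.
have := @measurable_fun_fubini_tonelli_F _ _ _ _ _ mu h mh (fun u => g0 _) => mF.
exact: (@fubini_tonelli _ _ _ _ _ mu m (fun u => \int[mu]_y g (u.1, y, u.2)) mF (fun u => integral_ge0 _ (fun y _ => g0 _))).
Qed.

(** Rotating one pair of coordinates at a time turns the linear form [x . xi]
    into [|x| eta]. *)
Lemma ge0_integral_polarize n (x : Rn R n.+1) (H : RR * RR -> \bar R) :
  measurable_fun setT H -> (forall u, 0 <= H u) ->
  \int[leb n.+1]_xi H (dotRn x xi, dotRn xi xi) =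
  \int[mu]_eta \int[leb n]_v H (normRn x * eta, eta ^+ 2 + dotRn v v)%R.
Proof.
elim: n x H => [|n IH] x H mH H0.
  case/tupleP: x => x0 x'.
  rewrite ge0_integral_Rn_cons//; last first.
    apply: (measurableT_comp mH); apply: measurable_fun_pair.
      exact: measurable_dotRn.
    exact: measurable_sqrRn.
  have E (xi : RR) (v : Rn R 0) : (dotRn [tuple of x0 :: x'] (Rn_cons (xi, v)), dotRn (Rn_cons (xi, v)) (Rn_cons (xi, v)))
     = (x0 * xi, xi ^+ 2 + dotRn v v)%R.
    by rewrite -[[tuple of _]]/(Rn_cons (x0, x')) !dotRn_cons !dotRn0 addr0 expr2.
  under eq_integral do under eq_integral do rewrite E.
  have -> : normRn [tuple of x0 :: x'] = `|x0|%R.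
    by rewrite /normRn -[[tuple of _]]/(Rn_cons (x0, x')) dotRn_cons dotRn0 addr0 -expr2 sqrtr_sqr.
  have [x00|x00] := leP 0%R x0; first by rewrite ger0_norm.
  rewrite (ltr0_norm x00) -[RHS]ge0_integral_reflect.
  - by apply: eq_integral => eta _; apply: eq_integral => v _; rewrite mulrNN sqrrN.
  - apply: (@measurable_fun_fubini_tonelli_F _ _ _ _ _ (leb 0) (fun u => H (- x0 * u.1, u.1 ^+ 2 + dotRn u.2 u.2)%R)) => //.
    apply: (measurableT_comp mH); apply: measurable_fun_pair.
      by apply: measurable_funM; [exact: measurable_cst|exact: measurable_fst].
    apply: measurable_funD; first by apply: measurable_funX; exact: measurable_fst.
    by apply: measurable_sqrRn; exact: measurable_snd.
  - by move=> eta; apply: integral_ge0.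
case/tupleP: x => x0 x'.
rewrite ge0_integral_Rn_cons//; last first.
  apply: (measurableT_comp mH); apply: measurable_fun_pair.
    exact: measurable_dotRn.
  exact: measurable_sqrRn.
have E (xi : RR) (v : Rn R n.+1) : (dotRn [tuple of x0 :: x'] (Rn_cons (xi, v)), dotRn (Rn_cons (xi, v)) (Rn_cons (xi, v)))
     = (x0 * xi + dotRn x' v, xi ^+ 2 + dotRn v v)%R.
  by rewrite -[[tuple of _]]/(Rn_cons (x0, x')) !dotRn_cons expr2.
under eq_integral do under eq_integral do rewrite E.
transitivity (\int[mu]_xi \int[mu]_eta \int[leb n]_v
    H (x0 * xi + normRn x' * eta, xi ^+ 2 + eta ^+ 2 + dotRn v v)%R).
  apply: eq_integral => xi _.
  have mx : measurable_fun setT (fun u : RR * RR => H (x0 * xi + u.1, xi ^+ 2 + u.2)%R).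
    apply: (measurableT_comp mH); apply: measurable_fun_pair; apply: measurable_funD => //;
      exact: measurable_cst.
  rewrite (IH x' _ mx (fun u => H0 _)).
  by apply: eq_integral => eta _; apply: eq_integral => v _; rewrite addrA.
have mlin (a b : R) : measurable_fun setT (fun u : RR * RR * Rn R n =>
    (a * u.1.1 + b * u.1.2, u.1.1 ^+ 2 + u.1.2 ^+ 2 + dotRn u.2 u.2)%R).
  have m1 : measurable_fun setT (fun u : RR * RR * Rn R n => u.1.1).
    exact: (measurableT_comp measurable_fst measurable_fst).
  have m2 : measurable_fun setT (fun u : RR * RR * Rn R n => u.1.2).
    exact: (measurableT_comp measurable_snd measurable_fst).
  apply: measurable_fun_pair.
    by apply: measurable_funD; apply: measurable_funM => //; exact: measurable_cst.
  apply: measurable_funD; last by apply: measurable_sqrRn; exact: measurable_snd.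
  by apply: measurable_funD; exact: measurable_funX.
rewrite (@ge0_tonelli3 _ _ (leb n) (fun u => H (x0 * u.1.1 + normRn x' * u.1.2,
   u.1.1 ^+ 2 + u.1.2 ^+ 2 + dotRn u.2 u.2)%R))//; last exact: (measurableT_comp mH (mlin _ _)).
have nx : normRn [tuple of x0 :: x'] = Num.sqrt (x0 ^+ 2 + normRn x' ^+ 2)%R.
  by rewrite /normRn -[[tuple of _]]/(Rn_cons (x0, x')) dotRn_cons sqr_sqrtr ?dotRn_ge0// expr2.
transitivity (\int[leb n]_v \int[mu]_xi \int[mu]_eta
   H (normRn [tuple of x0 :: x'] * xi, xi ^+ 2 + eta ^+ 2 + dotRn v v)%R).
  apply: eq_integral => v _ /=.
  rewrite (ge0_integral_align _ _ (sqrtr_ge0 _) mH H0) -nx.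
  rewrite (@fubini_tonelli _ _ _ _ _ mu mu (fun u => H (normRn [tuple of x0 :: x'] * u.2,
    u.1 ^+ 2 + u.2 ^+ 2 + dotRn v v)%R))//=.
    by apply: eq_integral => y _; apply: eq_integral => z _; rewrite (addrC (z ^+ 2)%R).
  apply: (measurableT_comp mH); apply: measurable_fun_pair.
    by apply: measurable_funM; [exact: measurable_cst|exact: measurable_snd].
  apply: measurable_funD; last exact: measurable_cst.
  by apply: measurable_funD; apply: measurable_funX; [exact: measurable_fst|exact: measurable_snd].
rewrite -(@ge0_tonelli3 _ _ (leb n) (fun u => H (normRn [tuple of x0 :: x'] * u.1.1,
   u.1.1 ^+ 2 + u.1.2 ^+ 2 + dotRn u.2 u.2)%R))//; last first.
  have := measurableT_comp mH (mlin (normRn [tuple of x0 :: x']) 0%R).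
  by apply: eq_measurable_fun => u _ /=; rewrite mul0r addr0.
apply: eq_integral => eta _; rewrite ge0_integral_Rn_cons//.
  apply: eq_integral => xi _; apply: eq_integral => v _ /=.
  by rewrite dotRn_cons -expr2 addrA.
apply: (measurableT_comp mH); apply: measurable_fun_pair; first exact: measurable_cst.
by apply: measurable_funD; [exact: measurable_cst|exact: measurable_sqrRn].
Qed.

End space.

(** * Push-forward measures with a density *)

Section density.
Context d (T : measurableType d) {R : realType} (m : {measure set T -> \bar R}).
Notation mu := (@lebesgue_measure R).
Notation RR := (measurableTypeR R).
Local Open Scope ereal_scope.

Lemma eq_measure_below (m1 m2 : {measure set RR -> \bar R}) :
  (forall b, m1 `]-oo, b[%classic = m2 `]-oo, b[%classic) ->
  (forall b, m1 `]-oo, b[%classic < +oo) ->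
  forall A, measurable A -> m1 A = m2 A.
Proof.
move=> E F; apply: (@measure_unique _ R RR (@RGenInftyO.G R) (fun n => `]-oo, n%:R[%classic)).
- exact: RGenInftyO.measurableE.
- move=> _ _ [a ->] [b ->]; exists (Num.min a b).
  by apply/seteqP; split => x /=; rewrite !in_itv/= lt_min => /andP.
- by move=> i; exists i%:R.
- rewrite -subTset => x _; exists (Num.truncn `|x|).+1 => //=.
  by rewrite in_itv/= (le_lt_trans (ler_norm x))// truncnS_gt.
- by move=> _ [b ->].
- by move=> k.
Qed.

(** The region below the graph of the density carries the two-dimensional
    Lebesgue measure; its projection to the axis is the measure with that
    density. *)
Lemma ge0_integral_density (phi : T -> RR) (g : RR -> R) (f : RR -> \bar R) :
  measurable_fun setT phi -> (forall v, (0 <= phi v)%R) ->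
  measurable_fun setT g -> (forall z, (0 <= z)%R -> (0 <= g z)%R) ->
  (forall b : R, (0 < b)%R -> m [set v | (phi v < b)%R] = \int[mu]_(z in `[0%R, b[) (g z)%:E) ->
  (forall b : R, (0 < b)%R -> \int[mu]_(z in `[0%R, b[) (g z)%:E < +oo) ->
  measurable_fun setT f -> (forall z, 0 <= f z) ->
  \int[m]_v f (phi v) = \int[mu]_(z in `[0%R, +oo[) (f z * (g z)%:E).
Proof.
move=> mphi phi0 mg g0 H Hoo mf f0.
pose D : set (RR * RR) := [set u | (0 <= u.1)%R && ((0 <= u.2)%R && (u.2 < g u.1)%R)].
have mD : measurable D.
  have : measurable_fun [set: RR * RR] (fun u => (0 <= u.1)%R && ((0 <= u.2)%R && (u.2 < g u.1)%R)).
    have m1 := @measurable_fst _ _ RR RR; have m2 := @measurable_snd _ _ RR RR.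
    apply: measurable_and; first by apply: measurable_fun_ler => //; exact: measurable_cst.
    apply: measurable_and; first by apply: measurable_fun_ler => //; exact: measurable_cst.
    by apply: measurable_fun_ltr => //; exact: (measurableT_comp mg m1).
  by move=> /(_ measurableT [set true] I); rewrite setTI.
pose M := (mu \x mu).
have mfst := @measurable_fst _ _ RR RR.
pose nu := pushforward (mrestr M mD) (@fst RR RR).
have slice (F : RR -> \bar R) : measurable_fun setT F -> (forall z, 0 <= F z) ->
    \int[nu]_z F z = \int[mu]_(z in `[0%R, +oo[) (F z * (g z)%:E).
  move=> mF F0; have mF1 := measurableT_comp mF mfst.
  rewrite /nu ge0_integral_pushforward// preimage_setT.
  have mDC : measurable (~` D) by exact: measurableC.
  have D0 : mrestr M mD (~` D) = 0 by rewrite /mrestr setICl; exact: (@measure0 _ _ _ (mu \x mu)).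
  rewrite (ge0_negligible_integral mDC measurableT mF1 (fun u _ => F0 _) D0).
  rewrite setTD setCK (eq_measure_integral M); last first.
    by move=> A mA AD; congr (M _); apply/seteqP; split => [u []|u Au] //; split => //; exact: AD.
  rewrite integral_mkcond /M fubini_tonelli1; last 2 first.
  - by apply/(measurable_restrictT _ mD); exact: measurable_funTS.
  - by move=> u; rewrite patchE; case: ifP => // _; exact: F0.
  rewrite [RHS]integral_mkcond; apply: eq_integral => z _.
  rewrite /fubini_F [RHS]patchE; case: ifPn => z0; last first.
    apply: integral0_eq => s _; rewrite patchE ifF//; apply/negP; rewrite inE /D/= => /andP[z0' _].
    by move: z0; rewrite notin_setE/= in_itv/= z0'.
  have {}z0 : (0 <= z)%R by move: z0; rewrite inE/= in_itv/= andbT.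
  transitivity (\int[mu]_(s in `[0%R, g z[) cst (F z) s).
    rewrite [RHS]integral_mkcond; apply: eq_integral => s _; rewrite !patchE/=.
    congr (if _ then _ else _).
    by apply/idP/idP; rewrite !inE /D /= in_itv/= z0.
  have lg : mu `[0%R, g z[%classic = (g z)%:E.
    rewrite lebesgue_measure_itv/= lte_fin; case: ltP => gz; first by rewrite EFinN sube0.
    by congr EFin; apply/eqP; rewrite eq_le gz g0.
  by rewrite integral_cst//; congr (_ * _); exact: lg.
have nuE b : nu `]-oo, b[%classic = \int[mu]_(z in `[0%R, b[) (g z)%:E.
  have mb : measurable (`]-oo, b[%classic : set RR) by exact: measurable_itv.
  rewrite -[LHS]mul1e -(integral_cst nu mb) integral_mkcond slice; last 2 first.
  - by apply/(measurable_restrictT _ mb); exact: measurable_cst.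
  - by move=> z; rewrite patchE; case: ifP.
  rewrite [LHS]integral_mkcond [RHS]integral_mkcond; apply: eq_integral => z _.
  rewrite !patchE /= !mem_setE !in_itv/= andbT.
  by case: (leP 0%R z) => _ //=; case: ifP => _; rewrite ?mul1e ?mul0e.
have below0 b : (b <= 0)%R -> \int[mu]_(z in `[0%R, b[) (g z)%:E = 0.
  by move=> b0; rewrite set_itv_ge ?integral_set0// bnd_simp -leNgt.
have pE b : m (phi @^-1` `]-oo, b[%classic) = \int[mu]_(z in `[0%R, b[) (g z)%:E.
  have [b0|b0] := ltP 0%R b.
    by rewrite -H//; congr (m _); apply/seteqP; split => v /=; rewrite in_itv.
  rewrite below0// (_ : _ @^-1` _ = set0) ?measure0//.
  by apply/seteqP; split => v //=; rewrite in_itv/= ltNge (le_trans b0).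
have E A : measurable A -> pushforward m phi A = nu A.
  move: A; apply: eq_measure_below => b; first exact: (etrans (pE b) (esym (nuE b))).
  apply: (@le_lt_trans _ _ (\int[mu]_(z in `[0%R, b[) (g z)%:E)); first by rewrite -pE.
  by have [/Hoo//|/below0->] := ltP 0%R b; exact: ltry.
rewrite -slice//; transitivity (\int[pushforward m phi]_z f z).
  by rewrite [RHS]ge0_integral_pushforward.
by apply: eq_measure_integral => A mA _; exact: (E A mA).
Qed.

End density.

(** * The radial substitution *)

Section radial.
Context {R : realType}.
Notation mu := (@lebesgue_measure R).
Notation RR := (measurableTypeR R).
Notation leb := (lebesgue_measure_Rn R).
Local Open Scope ereal_scope.

Lemma measurable_ball n r : measurable [set v : Rn R n | (dotRn v v < r)%R].
Proof.
have : measurable_fun setT (fun v : Rn R n => (dotRn v v < r)%R).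
  by apply: measurable_fun_ltr; [exact: measurable_sqrRn|exact: measurable_cst].
by move=> /(_ measurableT [set true] I); rewrite setTI.
Qed.

Lemma ball_finite n (r : R) : leb n [set v | (dotRn v v < r)%R] < +oo.
Proof.
elim: n => [|n IH]; first by rewrite /= diracE ltry.
pose A : set (RR * Rn R n) := `[(- (1 + `|r|))%R, (1 + `|r|)%R]%classic `*` [set v | (dotRn v v < r)%R].
have mA : measurable A by apply: measurableX; [exact: measurable_itv|exact: measurable_ball].
have mc := @measurable_Rn_cons R n.
apply: (@le_lt_trans _ _ ((mu \x leb n) A)); last first.
  rewrite product_measure1E//; last exact: measurable_ball.
  by apply: lte_mul_pinfty => //; rewrite ge0_fin_numE//; exact: finite_itv.
change ((mu \x leb n) (@Rn_cons R n @^-1` [set v | (dotRn v v < r)%R]) <= (mu \x leb n) A).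
apply: le_measure; rewrite ?inE//.
  by rewrite -[X in measurable X]setTI; apply: mc => //; exact: measurable_ball.
move=> [x v] /=; rewrite dotRn_cons => H.
have v0 := dotRn_ge0 v; have x0 := mulr_ge0 (normr_ge0 x) (normr_ge0 x).
have xx : (x * x = `|x| * `|x|)%R by rewrite -normrM ger0_norm// -expr2 sqr_ge0.
split => /=; last by lra.
rewrite in_itv/= -ler_norml; have := ler_norm r; have := normr_ge0 x; nra.
Qed.

Lemma ge0_integral_dilate_Rn n (r : R) (g : RR -> \bar R) : (0 < r)%R ->
  measurable_fun setT g -> (forall s, 0 <= g s) ->
  (r ^+ n)%:E * \int[leb n]_v g (r ^+ 2 * dotRn v v)%R = \int[leb n]_v g (dotRn v v).
Proof.
move=> r0; elim: n g => [|n IH] g mg g0.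
  by rewrite expr0 mul1e; apply: eq_integral => v _; rewrite dotRn0 mulr0.
have mdil d (T : measurableType d) (q : T -> RR) : measurable_fun setT q ->
    measurable_fun setT (fun v => r ^+ 2 * q v)%R.
  by move=> mq; apply: measurable_funM => //; exact: measurable_cst.
rewrite !ge0_integral_Rn_cons//; last 2 first.
- by apply: (measurableT_comp mg); exact: measurable_sqrRn.
- by apply: (measurableT_comp mg); apply: mdil; exact: measurable_sqrRn.
pose h (x : RR) := \int[leb n]_v g (x * x + r ^+ 2 * dotRn v v)%R.
have mh : measurable_fun setT h.
  have mF : measurable_fun setT (fun u : RR * Rn R n => g (u.1 * u.1 + r ^+ 2 * dotRn u.2 u.2)%R).
    apply: (measurableT_comp mg); apply: measurable_funD.
      by apply: measurable_funM; exact: measurable_fst.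
    by apply: mdil; apply: measurable_sqrRn; exact: measurable_snd.
  have := @measurable_fun_fubini_tonelli_F _ _ _ _ _ (leb n) _ mF (fun u => g0 _).
  exact.
have h0 x : 0 <= h x by apply: integral_ge0.
transitivity ((r ^+ n)%:E * \int[mu]_x h x); last first.
  rewrite -ge0_integralZl//; last by rewrite lee_fin exprn_ge0// ltW.
  apply: eq_integral => x _; rewrite (IH (fun s => g (x * x + s)%R))//.
    by apply: eq_integral => v _; rewrite dotRn_cons.
  by apply: (measurableT_comp mg); apply: measurable_funD => //; exact: measurable_cst.
rewrite -(ge0_integral_dilate r0 mh h0) muleA -EFinM -exprSr; congr (_ * _).
apply: eq_integral => x _; apply: eq_integral => v _; congr g.
by rewrite dotRn_cons; ring.
Qed.

Lemma ball_volume n (r : R) : (0 < r)%R ->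
  leb n [set v | (dotRn v v < r ^+ 2)%R] = (r ^+ n)%:E * leb n [set v | (dotRn v v < 1)%R].
Proof.
move=> r0; pose g (s : RR) : \bar R := (\1_[set s : RR | (s < r ^+ 2)%R] s)%:E.
have mg : measurable_fun setT g.
  apply/measurable_EFinP/measurable_indic.
  by rewrite (_ : [set _ | _] = `]-oo, (r ^+ 2)%R[%classic)//; apply/seteqP; split => x; rewrite /= in_itv.
have H := @ge0_integral_dilate_Rn n r g r0 mg (fun s => _).
have volE c : leb n [set v | (dotRn v v < c)%R] = \int[leb n]_v (\1_[set v | (dotRn v v < c)%R] v)%:E.
  by rewrite integral_indic ?setIT//; exact: measurable_ball.
rewrite !volE.
apply: (etrans _ (etrans (esym (H _)) _)) => //.
  by move=> s; rewrite lee_fin.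
congr (_ * _); apply: eq_integral => v _; rewrite /g !indicE; congr ((nat_of_bool _)%:R%:E).
have e : (r ^+ 2 * dotRn v v < r ^+ 2)%R = (dotRn v v < 1)%R.
  by rewrite -[ltRHS]mulr1 ltr_pM2l// exprn_gt0.
by apply/idP/idP; rewrite !inE/= e.
Qed.

Lemma sqrtr_exp (a : R) n : (0 <= a)%R -> (Num.sqrt a ^+ n = a `^ (n%:R / 2))%R.
Proof.
by move=> a0; rewrite -powR12_sqrt// -powR_mulrn ?powR_ge0// -powRrM mulrC.
Qed.

(** The derivative in [z] of the volume of the ball of squared radius
    [z ^ 2 / t * (2 * m + z ^ 2 / t)]. *)
Definition ball_density n (m t z : R) : R :=
  2 * n.+1%:R * t `^ (- (n.+1%:R / 2)) * fine (leb n.+1 [set v | (dotRn v v < 1)%R]) *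
  (z ^+ n * (2 * m + z ^+ 2 / t) `^ (n.+1%:R / 2 - 1) * (m + z ^+ 2 / t)).

Lemma ball_density_ge0 n m t z : (0 < m)%R -> (0 < t)%R -> (0 <= z)%R -> (0 <= ball_density n m t z)%R.
Proof.
move=> m0 t0 z0; have q0 : (0 <= z ^+ 2 / t)%R by rewrite divr_ge0 ?sqr_ge0// ltW.
rewrite /ball_density !mulr_ge0 ?powR_ge0 ?exprn_ge0 ?fine_ge0//.
by rewrite addr_ge0// ltW.
Qed.

Lemma is_derive_shifted_sqr (m t z : R) : is_derive z 1%R (fun z => m + z ^+ 2 / t)%R (2 * z / t)%R.
Proof. by apply: is_derive_eq; rewrite /GRing.scale/=; ring. Qed.

Lemma continuous_ball_density n (m t : R) : (0 < m)%R -> (0 < t)%R ->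
  continuous (ball_density n m t).
Proof.
move=> m0 t0 z; have q0 : (0 <= z ^+ 2 / t)%R by rewrite divr_ge0 ?sqr_ge0// ltW.
have Q0 : (0 < 2 * m + z ^+ 2 / t)%R by rewrite ltr_wpDr// mulr_gt0.
have c0 : {for z, continuous (fun z : R => z ^+ n)}%R by exact: exprn_continuous.
have c1 := is_derive_continuous (is_derive_compR (is_derive_shifted_sqr (2 * m) t z)
  (is_derive_powR (n.+1%:R / 2 - 1) Q0)).
have c2 := is_derive_continuous (is_derive_shifted_sqr m t z).
by apply: cvgM; [exact: cvg_cst|apply: cvgM => //; exact: cvgM].
Qed.

Lemma integral_ball_density n (m t b : R) : (0 < m)%R -> (0 < t)%R -> (0 < b)%R ->
  \int[mu]_(z in `[0%R, b[) (ball_density n m t z)%:E =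
  leb n.+1 [set v | (dotRn v v < b ^+ 2 / t * (2 * m + b ^+ 2 / t))%R].
Proof.
move=> m0 t0 b0.
have q0 z : (0 <= z ^+ 2 / t)%R by rewrite divr_ge0 ?sqr_ge0// ltW.
have Q0 z : (0 < 2 * m + z ^+ 2 / t)%R by rewrite ltr_wpDr// mulr_gt0.
have cg := @continuous_ball_density n m t m0 t0.
have mg : measurable_fun setT (ball_density n m t) by exact: continuous_measurable_fun.
pose V := fine (leb n.+1 [set v | (dotRn v v < 1)%R]).
pose F (z : R) := (t `^ (- (n.+1%:R / 2)) * V * (z ^+ n.+1 * (2 * m + z ^+ 2 / t) `^ (n.+1%:R / 2)))%R.
have dF (x : R) : is_derive x 1%R F (ball_density n m t x).
  have d1 := is_derive_compR (is_derive_shifted_sqr (2 * m) t x)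
    (is_derive_powR (n.+1%:R / 2) (Q0 x)).
  have d2 : is_derive x 1%R (fun z : R => z ^+ n.+1)%R (n.+1%:R * x ^+ n)%R.
    apply: DeriveDef; first exact: exprn_derivable.
    by rewrite exp_derive /GRing.scale/= mulr1.
  apply: is_derive_eq; rewrite /GRing.scale/= powRB1// /ball_density powRB1// -/V.
  set u := (_ `^ (n.+1%:R / 2))%R; set T := (t `^ _)%R.
  have Q1 : (2 * m + x ^+ 2 / t != 0)%R by rewrite lt0r_neq0.
  have : (u = (2 * m + x ^+ 2 / t) * (u / (2 * m + x ^+ 2 / t)))%R by rewrite mulrC divfK.
  move: (u / _)%R => w ->; rewrite exprS.
  by field; rewrite lt0r_neq0.
transitivity (F b)%:E.
  rewrite integral_itv_bndo_bndc; last by apply/measurable_EFinP; exact: measurable_funTS.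
  transitivity (\int[mu]_(z in `[0%R, b]) ball_density n m t z)%R%:E.
    rewrite /Rintegral fineK//; apply: integrable_fin_num => //.
    by apply: continuous_itv_integrable => x _; exact: cg.
  rewrite (Rintegral_FTC (ltW b0) (fun x _ => dF x) (fun x _ => cg x)).
  by congr EFin; rewrite /F expr0n/= mul0r mulr0 subr0.
pose r : R := (b * (Num.sqrt t^-1 * Num.sqrt (2 * m + b ^+ 2 / t)))%R.
have r0 : (0 < r)%R by rewrite !mulr_gt0 ?sqrtr_gt0 ?invr_gt0.
have -> : (b ^+ 2 / t * (2 * m + b ^+ 2 / t) = r ^+ 2)%R.
  by rewrite /r !exprMn !sqr_sqrtr ?invr_ge0 ?(ltW t0) ?(ltW (Q0 b))// mulrA.
rewrite ball_volume// -[X in _ * X]fineK ?ge0_fin_numE ?ball_finite// -EFinM; congr EFin.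
rewrite -/V /F /r !exprMn !sqrtr_exp ?invr_ge0 ?(ltW t0) ?(ltW (Q0 b))//.
rewrite -(powR_inv1 (ltW t0)) -powRrM mulN1r; ring.
Qed.

(** The variable [z] with [z ^ 2 = t (sqrt (m ^ 2 + |v| ^ 2) - m)] turns the
    phase [t <xi>] into [t m + z ^ 2]. *)
Lemma ge0_integral_radial n (m t : R) (f : RR -> \bar R) : (0 < m)%R -> (0 < t)%R ->
  measurable_fun setT f -> (forall s, 0 <= f s) ->
  \int[leb n.+1]_v f (Num.sqrt (m ^+ 2 + dotRn v v)%R) =
  \int[mu]_(z in `[0%R, +oo[) (f (m + z ^+ 2 / t)%R * (ball_density n m t z)%:E).
Proof.
move=> m0 t0 mf f0.
pose phi (v : Rn R n.+1) : RR := Num.sqrt (t * (Num.sqrt (m ^+ 2 + dotRn v v) - m))%R.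
have mphi : measurable_fun setT phi.
  apply: measurable_sqrt; apply: measurable_funM; first exact: measurable_cst.
  apply: measurable_funB; last exact: measurable_cst.
  apply: measurable_sqrt; apply: measurable_funD; first exact: measurable_cst.
  exact: measurable_sqrRn.
have sm (v : Rn R n.+1) : (m <= Num.sqrt (m ^+ 2 + dotRn v v))%R.
  rewrite -[leLHS](gtr0_norm m0) -sqrtr_sqr ler_wsqrtr//.
  by rewrite lerDl dotRn_ge0.
have fE (v : Rn R n.+1) : Num.sqrt (m ^+ 2 + dotRn v v)%R = (m + phi v ^+ 2 / t)%R.
  rewrite /phi sqr_sqrtr; last by rewrite mulr_ge0 ?subr_ge0 ?(ltW t0).
  by field; rewrite lt0r_neq0.
have mF : measurable_fun setT (fun z : RR => f (m + z ^+ 2 / t)%R).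
  apply: (measurableT_comp mf); apply: measurable_funD; first exact: measurable_cst.
  by apply: measurable_funM; [exact: measurable_funX|exact: measurable_cst].
transitivity (\int[leb n.+1]_v (fun z : RR => f (m + z ^+ 2 / t)%R) (phi v)).
  by apply: eq_integral => v _; rewrite fE.
have lev (b : R) : (0 < b)%R -> leb n.+1 [set v | (phi v < b)%R] =
    \int[mu]_(z in `[0%R, b[) (ball_density n m t z)%:E.
  move=> b0; rewrite integral_ball_density//; congr (leb n.+1 _).
  have bt : (0 < b ^+ 2 / t)%R by rewrite divr_gt0// exprn_gt0.
  apply/seteqP; suff E v : (phi v < b)%R =
     (dotRn v v < b ^+ 2 / t * (2 * m + b ^+ 2 / t))%R by split => v /=; rewrite E.
  rewrite /phi -[in LHS](gtr0_norm b0) -sqrtr_sqr ltr_sqrt ?exprn_gt0//.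
  rewrite mulrC -ltr_pdivlMr// ltrBlDr.
  have mb : (0 < b ^+ 2 / t + m)%R by rewrite addr_gt0.
  rewrite -[ltRHS](gtr0_norm mb) -sqrtr_sqr ltr_sqrt ?exprn_gt0//.
  rewrite -ltrBrDl; congr (_ < _)%R; ring.
apply: ge0_integral_density => //.
- by move=> v; exact: sqrtr_ge0.
- by apply: continuous_measurable_fun; exact: continuous_ball_density.
- by move=> z z0; exact: ball_density_ge0.
- by move=> b b0; rewrite integral_ball_density// ball_finite.
Qed.

End radial.

(** * From nonnegative to signed integrands *)

Section transfer.
Context {R : realType} d1 (T : measurableType d1) d2 (S : measurableType d2).
Variables (m : {measure set T -> \bar R}) (m' : {measure set S -> \bar R}).
Notation RR := (measurableTypeR R).
Variables (phi : T -> RR * RR) (a1 a2 : S -> RR * RR) (w : S -> R) (D : set S).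
Variable G : RR * RR -> R.
Hypothesis w0 : forall u, D u -> 0 <= w u.
Hypothesis mG : measurable_fun setT G.
Hypothesis H : forall K : RR * RR -> \bar R, measurable_fun setT K ->
  (forall u, 0 <= K u)%E -> (forall u, G u = 0 -> K u = 0%E) ->
  (\int[m]_v K (phi v) = \int[m']_(u in D) (K (a1 u) * (w u)%:E) +
                         \int[m']_(u in D) (K (a2 u) * (w u)%:E))%E.
Hypothesis I1 : m'.-integrable D (EFin \o (fun u => G (a1 u) * w u)).
Hypothesis I2 : m'.-integrable D (EFin \o (fun u => G (a2 u) * w u)).
Hypothesis mD : measurable D.

(** The formula for nonnegative integrands is applied to the positive and negative
    parts of [G]. It is required only for integrands vanishing where [G] does,
    since the support of [G] is what confines the variables to the bounded [D]. *)
Lemma Rintegral_transfer : \int[m]_v G (phi v) =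
  \int[m']_(u in D) (G (a1 u) * w u) + \int[m']_(u in D) (G (a2 u) * w u).
Proof.
have posE a : (\int[m']_(u in D) ((EFin \o G)^\+ (a u) * (w u)%:E) =
    \int[m']_(u in D) (EFin \o (fun u => (G (a u) * w u)%R))^\+ u)%E.
  apply: eq_integral => u /set_mem/w0 wu.
  by rewrite !funeposE/= -!EFin_max -EFinM maxr_pMl// mul0r.
have negE a : (\int[m']_(u in D) ((EFin \o G)^\- (a u) * (w u)%:E) =
    \int[m']_(u in D) (EFin \o (fun u => (G (a u) * w u)%R))^\- u)%E.
  apply: eq_integral => u /set_mem/w0 wu.
  by rewrite !funenegE/= -!EFin_max -EFinM maxr_pMl// mul0r mulNr.
have mE : measurable_fun setT (EFin \o G) by exact/measurable_EFinP.
rewrite /Rintegral integralE.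
have -> : (fun x => (G (phi x))%:E) = (EFin \o G) \o phi by [].
rewrite funepos_comp funeneg_comp.
under eq_integral do rewrite /=.
rewrite !H.
- rewrite !posE !negE.
  rewrite [in RHS]integralE [X in _ + fine X]integralE.
  have p1 := integrable_pos_fin_num mD I1; have p2 := integrable_pos_fin_num mD I2.
  have n1 := integrable_neg_fin_num mD I1; have n2 := integrable_neg_fin_num mD I2.
  by rewrite -(fineK p1) -(fineK p2) -(fineK n1) -(fineK n2)/=; ring.
- exact: measurable_funeneg.
- by move=> u; exact: funeneg_ge0.
- by move=> u G0; rewrite funenegE/= G0 oppr0 maxxx.
- exact: measurable_funepos.
- by move=> u; exact: funepos_ge0.
- by move=> u G0; rewrite funeposE/= G0 maxxx.
Qed.

End transfer.

(** * Reduction to two variables *)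

Section polar.
Context {R : realType}.
Notation mu := (@lebesgue_measure R).
Notation RR := (measurableTypeR R).
Notation leb := (lebesgue_measure_Rn R).
Local Open Scope ereal_scope.

Lemma ge0_integral_half (A : RR -> \bar R) : measurable_fun setT A -> (forall x, 0 <= A x) ->
  \int[mu]_x A x = \int[mu]_(x in `[0%R, +oo[) A x + \int[mu]_(x in `[0%R, +oo[) A (- x)%R.
Proof.
move=> mA A0.
have m0 : measurable (`]-oo, 0%R[%classic : set RR) by exact: measurable_itv.
have m1 : measurable (`[0%R, +oo[%classic : set RR) by exact: measurable_itv.
have U : setT = `[0%R, +oo[%classic `|` `]-oo, 0%R[%classic :> set RR.
  apply/seteqP; split => // x _ /=; rewrite !in_itv/= andbT.
  by case: (leP 0%R x) => _; [left|right].
rewrite U ge0_integral_setU//; last 2 first.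
- exact: measurable_funTS.
- apply/disj_setPS => x [] /=; rewrite !in_itv/= andbT => x0; rewrite ltNge.
  by rewrite x0.
congr (_ + _); rewrite -integral_itv_obnd_cbnd; last first.
  by apply: measurable_funTS; exact: (measurableT_comp mA).
rewrite integral_mkcond [RHS]integral_mkcond -ge0_integral_reflect.
- apply: eq_integral => x _; rewrite !patchE; congr (if _ then _ else _).
  by apply/idP/idP; rewrite !inE/= !in_itv/= andbT oppr_lt0.
- by apply/(measurable_restrictT _ m0); exact: measurable_funTS.
- by move=> x; rewrite patchE; case: ifP.
Qed.

Lemma ge0_integral_polar n (x : Rn R n.+2) (t : R) (H : RR * RR -> \bar R) : (0 < t)%R ->
  measurable_fun setT H -> (forall u, 0 <= H u) ->
  let P y := \int[mu]_(eta in `[0%R, +oo[) \int[mu]_(z in `[0%R, +oo[)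
    (H (y * eta, (bracket eta + z ^+ 2 / t) ^+ 2 - 1)%R *
     (ball_density n (bracket eta) t z)%:E) in
  \int[leb n.+2]_xi H (dotRn x xi, dotRn xi xi) = P (normRn x) + P (- normRn x)%R.
Proof.
move=> t0 mH H0 P; set y := normRn x.
pose A (eta : RR) := \int[leb n.+1]_v H (y * eta, eta ^+ 2 + dotRn v v)%R.
rewrite ge0_integral_polarize// (@ge0_integral_half A); last 2 first.
- apply: (@measurable_fun_fubini_tonelli_F _ _ _ _ _ (leb n.+1)
    (fun u => H (y * u.1, u.1 ^+ 2 + dotRn u.2 u.2)%R)) => //.
  apply: (measurableT_comp mH); apply: measurable_fun_pair.
    by apply: measurable_funM; [exact: measurable_cst|exact: measurable_fst].
  apply: measurable_funD; first by apply: measurable_funX; exact: measurable_fst.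
  by apply: measurable_sqrRn; exact: measurable_snd.
- by move=> eta; exact: integral_ge0.
have key (y' eta : R) : \int[leb n.+1]_v H (y' * eta, eta ^+ 2 + dotRn v v)%R =
    \int[mu]_(z in `[0%R, +oo[)
      (H (y' * eta, (bracket eta + z ^+ 2 / t) ^+ 2 - 1)%R * (ball_density n (bracket eta) t z)%:E).
  rewrite -(@ge0_integral_radial _ n (bracket eta) t (fun s => H (y' * eta, s ^+ 2 - 1)%R))//.
  - apply: eq_integral => v _; congr (H (_, _)).
    rewrite sqr_sqrtr; last by rewrite addr_ge0 ?sqr_ge0// dotRn_ge0.
    by rewrite bracket_sqr; ring.
  - exact: bracket_gt0.
  - apply: (measurableT_comp mH); apply: measurable_fun_pair; first exact: measurable_cst.
    by apply: measurable_funB; [exact: measurable_funX|exact: measurable_cst].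
congr (_ + _); apply: eq_integral => eta _; rewrite /A.
  exact: key.
by rewrite sqrrN mulrN -mulNr; exact: key.
Qed.

Lemma ge0_integral_quarter_plane (h : RR * RR -> \bar R) (L Z : R) :
  measurable_fun setT h -> (forall x z, (0 <= x)%R -> (0 <= z)%R -> 0 <= h (x, z)) ->
  (forall x z, (0 <= x)%R -> (0 <= z)%R -> (L < x)%R \/ (Z < z)%R -> h (x, z) = 0) ->
  \int[mu]_(x in `[0%R, +oo[) \int[mu]_(z in `[0%R, +oo[) h (x, z) =
  \int[(mu \x mu)]_(u in `[0%R, L]%classic `*` `[0%R, Z]%classic) h u.
Proof.
move=> mh h0 out; set D := _ `*` _.
have mD : measurable D by apply: measurableX; exact: measurable_itv.
rewrite [RHS]integral_mkcond fubini_tonelli1; last 2 first.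
- by apply/(measurable_restrictT _ mD); exact: measurable_funTS.
- move=> [x z]; rewrite patchE; case: ifPn => //; rewrite inE => -[] /=; rewrite !in_itv/=.
  by move=> /andP[x0 _] /andP[z0 _]; exact: h0.
rewrite integral_mkcond; apply: eq_integral => x _; rewrite /fubini_F patchE.
case: ifPn => [/set_mem/=|]; last first.
  move=> /negP x0; apply/esym/integral0_eq => z _; rewrite patchE ifF//; apply/negP.
  rewrite inE => -[] /=; rewrite in_itv/= => /andP[x0' _] _; apply: x0.
  by rewrite inE/= in_itv/= x0'.
rewrite in_itv/= andbT => x0; rewrite integral_mkcond; apply: eq_integral => z _.
rewrite !patchE; case: ifPn => [/set_mem/=|]; last first.
  move=> /negP z0; rewrite ifF//; apply/negP; rewrite inE => -[] /= _.
  rewrite in_itv/= => /andP[z0' _]; apply: z0; by rewrite inE/= in_itv/= z0'.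
rewrite in_itv/= andbT => z0; case: ifPn => // /negP xz.
have [xL|Lx] := leP x L; last by rewrite out//; left.
have [zZ|Zz] := leP z Z; last by rewrite out//; right.
by exfalso; apply: xz; rewrite inE; split; rewrite /= in_itv/= ?x0 ?z0.
Qed.

End polar.

(** * The real kernel in dimension at least two *)

Section kernel.
Context {R : realType}.
Notation mu := (@lebesgue_measure R).
Notation RR := (measurableTypeR R).
Notation leb := (lebesgue_measure_Rn R).
Implicit Types (psi : R -> R) (p eps c t k th : R).

(** The integrand as a function of [x . xi] and [|xi| ^ 2]. The coefficient [c]
    makes it possible to reverse the sign of the whole phase, hence of [t]. *)
Definition polar_kernel p psi eps c t k th (u : RR * RR) : R :=
  cos (c * u.1 + t * Num.sqrt (1 + u.2) - k * ln (Num.sqrt (1 + u.2)) + th) *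
  Num.sqrt (1 + u.2) `^ (- (p + 1)) * psi (eps * Num.sqrt u.2).

Definition kernel p psi eps c t k th n (x xi : Rn R n) : R :=
  polar_kernel p psi eps c t k th (dotRn x xi, dotRn xi xi).

Lemma measurable_polar_kernel p psi eps c t k th : cutoff psi ->
  measurable_fun setT (polar_kernel p psi eps c t k th).
Proof.
move=> Hpsi.
have m1 := @measurable_fst _ _ RR RR; have m2 := @measurable_snd _ _ RR RR.
have mw : measurable_fun setT (fun u : RR * RR => Num.sqrt (1 + u.2)).
  by apply: measurable_sqrt; apply: measurable_funD => //; exact: measurable_cst.
have mln : measurable_fun setT (fun u : RR * RR => ln (Num.sqrt (1 + u.2))).
  exact: (measurableT_comp (@measurable_ln R) mw).
have mcst (r : R) : measurable_fun setT (fun _ : RR * RR => r) by exact: measurable_cst.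
apply: measurable_funM; last first.
  apply: (measurableT_comp (continuous_measurable_fun (cutoff_continuous Hpsi))).
  by apply: measurable_funM => //; exact: measurable_sqrt.
apply: measurable_funM; last exact: (measurableT_comp (measurable_powR _) mw).
apply: measurable_cos; apply: measurable_funD => //; apply: measurable_funB; last exact: measurable_funM.
by apply: measurable_funD; exact: measurable_funM.
Qed.

Lemma measurable_ball_density n t :
  measurable_fun setT (fun u : RR * RR => ball_density n (bracket u.1) t u.2).
Proof.
have m1 := @measurable_fst _ _ RR RR; have m2 := @measurable_snd _ _ RR RR.
have mcst (r : R) : measurable_fun setT (fun _ : RR * RR => r) by exact: measurable_cst.
have mb : measurable_fun setT (fun u : RR * RR => bracket u.1) by exact: measurable_bracket.
have ms : measurable_fun setT (fun u : RR * RR => u.2 ^+ 2 / t).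
  by apply: measurable_funM => //; exact: measurable_funX.
apply: measurable_funM => //; apply: measurable_funM; last exact: measurable_funD.
apply: measurable_funM; first exact: measurable_funX.
apply: (measurableT_comp (measurable_powR _)); apply: measurable_funD => //.
exact: measurable_funM.
Qed.

(** The phase of the kernel splits into the free phase and the logarithmic one. *)
Lemma cosB_shift (A B : R) :
  cos (A - B) = cos A * cos (B + 0) + cos (A - pi / 2) * cos (B - pi / 2).
Proof. by rewrite addr0 !cosBpihalf cosB. Qed.

Lemma polar_kernel_shell p psi eps c t k th s q x : 0 <= s ->
  polar_kernel p psi eps c t k th (q, (bracket x + s) ^+ 2 - 1) =
  cos (c * q + t * (bracket x + s) - k * ln (bracket x + s) + th) *
  (bracket x + s) `^ (- (p + 1)) * psi (eps * radius s x).
Proof.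
move=> s0; have w1 := bracketD_ge1 x s0.
have w0 : 0 <= bracket x + s by lra.
have e : Num.sqrt (1 + ((bracket x + s) ^+ 2 - 1)) = bracket x + s.
  by rewrite addrC subrK sqrtr_sqr ger0_norm.
by rewrite /polar_kernel /= e.
Qed.

(** The [w] in the density cancels one power of the weight, and the two waves are
    the two terms of [cosB_shift]. *)
Lemma polar_kernel_wave n psi eps c t k th y x z : 0 < t ->
  polar_kernel (n.+1%:R / 2) psi eps c t k th (y * x, (bracket x + z ^+ 2 / t) ^+ 2 - 1) *
    ball_density n (bracket x) t z =
  2 * n.+1%:R * t `^ (- (n.+1%:R / 2)) * fine (leb n.+1 [set v | dotRn v v < 1]) *
  (z ^+ n * wave (n.+1%:R / 2) psi (@Jet R 0) eps t (c * y) k th 0 x z +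
   z ^+ n * wave (n.+1%:R / 2) psi (@Jet R 0) eps t (c * y) k (th - pi / 2) (- (pi / 2)) x z).
Proof.
move=> t0; set p := n.+1%:R / 2.
have s0 : 0 <= z ^+ 2 / t by rewrite divr_ge0 ?sqr_ge0// ltW.
have w0 : 0 < bracket x + z ^+ 2 / t by have := bracketD_ge1 x s0; lra.
rewrite polar_kernel_shell// /ball_density -/p /wave /oscillating /= /euler_jet expr0 mul1r.
have -> : c * (y * x) + t * (bracket x + z ^+ 2 / t) - k * ln (bracket x + z ^+ 2 / t) + th =
    c * y * x + t * bracket x + (th + z ^+ 2) - k * ln (bracket x + z ^+ 2 / t).
  by field; rewrite lt0r_neq0.
rewrite cosB_shift opprD (powRB1 (- p) w0); change (derive1n 0 psi) with psi.
have -> : c * y * x + t * bracket x + (th + z ^+ 2) - pi / 2 =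
    c * y * x + t * bracket x + (th - pi / 2 + z ^+ 2) by ring.
have -> : 2 * bracket x + z ^+ 2 / t = bracket x + z ^+ 2 / t + bracket x by ring.
move: (cos _) (cos _) (cos _) (cos _) => A B A' B'.
move: (_ `^ (p - 1)) (_ `^ (- p)) (t `^ _) (fine _) (psi _) => X Y T V P.
move: (bracket x + _) w0 => q q0; by field; rewrite lt0r_neq0.
Qed.

Lemma polar_kernel_out p psi eps c t k th s q x : cutoff psi -> 0 <= s ->
  1 <= eps * radius s x -> polar_kernel p psi eps c t k th (q, (bracket x + s) ^+ 2 - 1) = 0.
Proof.
move=> [_ Hpsi] s0 /Hpsi /nbhs_singleton; rewrite polar_kernel_shell// => ->.
by rewrite mulr0.
Qed.

(** The density carries the factor [t ^ (- p)], and the cutoff confines the polar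
    variables to a box on which [half_line_bound] applies. *)
Lemma kernel_bound n psi : cutoff psi -> exists C : R, exists N : nat, 0 <= C /\
  forall (x : Rn R n.+2) eps c t k th, 0 < eps -> 0 < t -> k != 0 ->
  `|k| * `|\int[leb n.+2]_xi kernel (n.+1%:R / 2) psi eps c t k th x xi| <=
  C * (1 + `|k|) ^+ N * t `^ (- (n.+1%:R / 2)).
Proof.
move=> Hpsi; set p := n.+1%:R / 2.
have [C [N [C0 HC]]] := half_line_bound p Hpsi n.
pose V := fine (leb n.+1 [set v | dotRn v v < 1]).
have V0 : 0 <= V by rewrite fine_ge0.
exists (4 * (2 * n.+1%:R * V) * C), N; split; first by rewrite !mulr_ge0.
move=> x eps c t k th eps0 t0 kn0.
(* [Z ^ 2 / t >= eps^-1], so the cutoff vanishes beyond [Z]. *)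
pose L := eps^-1; pose Z := 1 + t / eps.
have te : 0 < t / eps by exact: divr_gt0.
have Z1 : 1 <= Z by rewrite /Z; lra.
have outZ x' : 1 <= eps * radius (Z ^+ 2 / t) x'.
  have s0 : 0 <= Z ^+ 2 / t by rewrite divr_ge0 ?sqr_ge0// ltW.
  apply: (@le_trans _ _ (eps * (Z ^+ 2 / t))); last by rewrite ler_pM2l// radius_ge.
  have -> : 1 = eps * ((t / eps) / t) by field; rewrite !lt0r_neq0.
  rewrite ler_pM2l// ler_pM2r ?invr_gt0// /Z; nra.
pose G := polar_kernel p psi eps c t k th.
pose a (y : R) (u : RR * RR) : RR * RR := (y * u.1, (bracket u.1 + u.2 ^+ 2 / t) ^+ 2 - 1).
pose w (u : RR * RR) := ball_density n (bracket u.1) t u.2.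
pose D : set (RR * RR) := `[0, L]%classic `*` `[0, Z]%classic.
pose W y th1 th2 := fun x z : R => z ^+ n * wave p psi (@Jet R 0) eps t (c * y) k th1 th2 x z.
have WB y th1 th2 : box_bounded 0 L 0 Z (W y th1 th2).
  by apply: box_boundedM; [exact: expr_box|exact: wave_box].
pose cV := 2 * n.+1%:R * t `^ (- p) * V.
have cV0 : 0 <= cV by rewrite !mulr_ge0 ?powR_ge0.
pose F y x z := cV * (W y th 0 x z + W y (th - pi / 2) (- (pi / 2)) x z).
have FB y : box_bounded 0 L 0 Z (F y).
  by apply: box_boundedZ; apply: box_boundedD.
have FE y : (fun u => G (a y u) * w u) = (fun u => F y u.1 u.2).
  by apply/funext => -[x' z]; rewrite /G /a /w /F /W polar_kernel_wave.
have mD : measurable D by exact: measurable_box.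
have mG : measurable_fun setT G by exact: measurable_polar_kernel.
have ma y : measurable_fun setT (a y).
  have m1 := @measurable_fst _ _ RR RR; have m2 := @measurable_snd _ _ RR RR.
  apply: measurable_fun_pair; first by apply: measurable_funM => //; exact: measurable_cst.
  apply: measurable_funB; last exact: measurable_cst.
  apply: measurable_funX; apply: measurable_funD; first exact: measurable_bracket.
  by apply: measurable_funM; [exact: measurable_funX|exact: measurable_cst].
have w0 u : 0 <= u.2 -> 0 <= w u.
  by move=> u0; apply: ball_density_ge0 => //; exact: bracket_gt0.
have out y x' z : 0 <= x' -> 0 <= z -> L < x' \/ Z < z -> G (a y (x', z)) = 0.
  move=> x0 z0 h; have s0 : 0 <= z ^+ 2 / t by rewrite divr_ge0 ?sqr_ge0// ltW.
  apply: polar_kernel_out => //=; case: h => [Lx|Zz].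
    apply: (@le_trans _ _ (eps * x')).
      by rewrite -ler_pdivrMl// mulr1 ltW.
    by rewrite ler_pM2l// -[leLHS]ger0_norm// radius_ge_normr.
  apply: (le_trans (outZ x')); rewrite ler_pM2l// radius_mono_excess//.
    by rewrite divr_ge0 ?sqr_ge0// ltW.
  by rewrite ler_pM2r ?invr_gt0// lerXn2r ?nnegrE ?(ltW Zz)//; lra.
have TR : \int[leb n.+2]_xi kernel p psi eps c t k th x xi =
    \int[(mu \x mu)%E]_(u in D) (G (a (normRn x) u) * w u) +
    \int[(mu \x mu)%E]_(u in D) (G (a (- normRn x) u) * w u).
  apply: (@Rintegral_transfer _ _ _ _ _ (leb n.+2) (mu \x mu)%E
     (fun xi => (dotRn x xi, dotRn xi xi))) => //.
  - by move=> u [_ /=]; rewrite in_itv/= => /andP[u0 _]; exact: w0.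
  - move=> K mK K0 GK; rewrite (ge0_integral_polar x t0 mK K0).
    have E y : (\int[mu]_(eta in `[0%R, +oo[) \int[mu]_(z in `[0%R, +oo[)
        (K (a y (eta, z)) * (w (eta, z))%:E) =
        \int[mu \x mu]_(u in D) (K (a y u) * (w u)%:E))%E.
      apply: (@ge0_integral_quarter_plane _ (fun u => K (a y u) * (w u)%:E)%E L Z).
      + apply: emeasurable_funM; first exact: (measurableT_comp mK).
        by apply/measurable_EFinP; exact: measurable_ball_density.
      + by move=> x' z x0 z0; rewrite mule_ge0// lee_fin w0.
      + by move=> x' z x0 z0 h; rewrite (GK _ (out _ _ _ x0 z0 h)) mul0e.
    by congr (_ + _)%E; exact: E.
  - by rewrite FE; exact: box_integrable_on.
  - by rewrite FE; exact: box_integrable_on.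
have B y : `|k| * `|\int[(mu \x mu)%E]_(u in D) (G (a y u) * w u)| <=
    cV * (2 * (C * (1 + `|k|) ^+ N)).
  rewrite FE RintegralZl//; last first.
    by apply: (@box_integrable_on _ _ _ _ _ (fun x z => W y th 0 x z + W y (th - pi / 2) (- (pi / 2)) x z)); exact: box_boundedD.
  rewrite RintegralD//; [|exact: (box_integrable_on (WB _ _ _))|exact: (box_integrable_on (WB _ _ _))].
  rewrite (box_Rintegral (WB y th 0)) (box_Rintegral (WB y (th - pi / 2) (- (pi / 2)))).
  rewrite normrM (ger0_norm cV0) mulrCA ler_wpM2l//.
  apply: (@le_trans _ _ (`|k| * (`|\int[mu]_(x in `[0, L]) \int[mu]_(z in `[0, Z]) W y th 0 x z| +
     `|\int[mu]_(x in `[0, L]) \int[mu]_(z in `[0, Z]) W y (th - pi / 2) (- (pi / 2)) x z|))).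
    by rewrite ler_wpM2l// ler_normD.
  by rewrite mulrDr mulr_natl mulr2n lerD// HC.
rewrite TR; apply: (@le_trans _ _ (2 * (cV * (2 * (C * (1 + `|k|) ^+ N))))).
  apply: (@le_trans _ _ (`|k| * (`|\int[(mu \x mu)%E]_(u in D) (G (a (normRn x) u) * w u)| +
    `|\int[(mu \x mu)%E]_(u in D) (G (a (- normRn x) u) * w u)|))).
    by rewrite ler_wpM2l// ler_normD.
  by rewrite mulrDr mulr_natl mulr2n lerD// B.
by rewrite /cV le_eqVlt; apply/orP; left; apply/eqP; ring.
Qed.

End kernel.

(** * The real kernel in every dimension *)

Section kernel_estimates.
Context {R : realType}.
Notation mu := (@lebesgue_measure R).
Notation RR := (measurableTypeR R).
Notation leb := (lebesgue_measure_Rn R).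
Implicit Types (psi : R -> R) (p eps c t k th : R).

(** In one dimension there is no transversal variable, and the estimate is the
    oscillatory one at [s = 0]. *)
Lemma kernel_bound1 psi : cutoff psi -> exists2 C : R, 0 <= C &
  forall (x : Rn R 1) eps c t k th, 0 < eps -> k != 0 ->
  `|k| * `|\int[leb 1]_xi kernel 0 psi eps c t k th x xi| <= C * (1 + `|k|) ^+ 3.
Proof.
move=> Hpsi; have [C C0 HC] := @oscillating_bound R 0.
have [M HM] := bv_eval (@Jet R 0) Hpsi.
have M0 : 0 <= M by exact: bv_ge0 (HM 1 0 ltr01 (lexx _)).
exists (8 * C * M); first by rewrite !mulr_ge0.
move=> x eps c t k th eps0 kn0.
pose L := eps^-1.
pose G := polar_kernel 0 psi eps c t k th.
pose a (y : R) (u : RR) : RR * RR := (y * u, u ^+ 2).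
pose B := eval psi (@Jet R 0) eps 0.
have HB : bv M B by exact: HM.
pose O y th1 th2 u := oscillating 0 0 (c * y) t k th1 th2 u * B u.
pose F y u := 2 * (O y th 0 u + O y (th - pi / 2) (- (pi / 2)) u).
have aE y u : a y u = (y * u, (bracket u + 0) ^+ 2 - 1).
  by rewrite /a addr0 bracket_sqr addrC addKr.
have FE y : (fun u => G (a y u) * 1) = F y.
  apply/funext => u; rewrite aE /G polar_kernel_shell// /F /O /oscillating /B /= /euler_jet.
  have m0 : 0 < bracket u + 0 by rewrite addr0 bracket_gt0.
  rewrite expr0 mul1r !addr0 in m0 *; change (derive1n 0 psi) with psi.
  have -> : c * (y * u) + t * bracket u - k * ln (bracket u) + th =
     c * y * u + t * bracket u + th - k * ln (bracket u) by ring.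
  rewrite cosB_shift add0r oppr0 powRr0 sub0r addr0 !powR_inv1 ?(ltW m0) ?addr_ge0 ?(ltW m0)//.
  have -> : c * y * u + t * bracket u + th - pi / 2 = c * y * u + t * bracket u + (th - pi / 2) by ring.
  have -> : bracket u + bracket u = 2 * bracket u by ring.
  by move: (cos _) (cos _) (cos _) (cos _) (psi _) => A1 A2 A3 A4 P; field; rewrite lt0r_neq0.
have out y u : 0 <= u -> L < u -> G (a y u) = 0.
  move=> u0 Lu; rewrite aE; apply: polar_kernel_out => //.
  by rewrite radius0 ger0_norm// -ler_pdivrMl// mulr1 ltW.
have iO y th1 th2 : mu.-integrable `[0, L] (EFin \o O y th1 th2).
  apply: (@bounded_itv_integrable _ _ _ _ (2 `^ `|0 - 1| * M)).
    apply: measurable_funM.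
      by apply: measurable_oscillating => //; exact: measurable_cst.
    by apply: measurable_eval => //; exact: measurable_cst.
  move=> u /andP[u0 _]; rewrite normrM ler_pM//; first exact: oscillating_le.
  exact: (bv_bounded HB).
have mL : measurable (`[0, L]%classic : set RR) by exact: measurable_itv.
have iF y : mu.-integrable `[0, L] (EFin \o F y).
  by apply: integrableRZl => //; exact: integrableRD.
have TR : \int[leb 1]_xi kernel 0 psi eps c t k th x xi =
    \int[mu]_(u in `[0, L]) (G (a (normRn x) u) * 1) +
    \int[mu]_(u in `[0, L]) (G (a (- normRn x) u) * 1).
  apply: (@Rintegral_transfer _ _ _ _ _ (leb 1) mu
     (fun xi => (dotRn x xi, dotRn xi xi)) _ _ (fun _ => 1)) => //.
  - exact: measurable_polar_kernel.
  - move=> K mK K0 GK; rewrite (ge0_integral_polarize x mK K0).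
    have mKa y : measurable_fun setT (fun u : RR => K (a y u)).
      apply: (measurableT_comp mK); apply: measurable_fun_pair; last exact: measurable_funX.
      by apply: measurable_funM => //; exact: measurable_cst.
    transitivity (\int[mu]_u K (a (normRn x) u))%E.
      apply: eq_integral => u _ /=; rewrite integral_dirac//; last first.
        apply: (measurableT_comp mK); apply: measurable_fun_pair; first exact: measurable_cst.
        by apply: measurable_funD; [exact: measurable_cst|exact: measurable_sqrRn].
      by rewrite diracT mul1e dotRn0 addr0.
    rewrite ge0_integral_half//.
    have E y : (\int[mu]_(u in `[0%R, +oo[) K (a y u) =
        \int[mu]_(u in `[0%R, L]) (K (a y u) * 1%:E))%E.
      rewrite integral_mkcond [RHS]integral_mkcond; apply: eq_integral => u _.
      rewrite !patchE !mem_setE !in_itv/= andbT; case: (leP 0 u) => //= u0.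
      case: leP => [_|Lu]; first by rewrite mule1.
      exact: GK (out _ _ u0 Lu).
    rewrite -!E; congr (_ + _)%E; apply: eq_integral => u _.
    by rewrite /a mulrN mulNr sqrrN.
  - by rewrite FE.
  - by rewrite FE.
have B1 y : `|k| * `|\int[mu]_(u in `[0, L]) (G (a y u) * 1)| <= 4 * (C * (1 + `|k|) ^+ 3 * M).
  rewrite FE RintegralZl//; last exact: integrableRD.
  rewrite RintegralD// normrM ger0_norm// mulrCA.
  have := ler_normD (\int[mu]_(u in `[0, L]) O y th 0 u)
    (\int[mu]_(u in `[0, L]) O y (th - pi / 2) (- (pi / 2)) u).
  have h1 := HC 0 (c * y) t k th 0 L M B (lexx _) kn0 HB.
  have h2 := HC 0 (c * y) t k (th - pi / 2) (- (pi / 2)) L M B (lexx _) kn0 HB.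
  move=> /(ler_wpM2l (normr_ge0 k)); rewrite mulrDr.
  by move: h1 h2; rewrite -/(O _ _ _ _); lra.
rewrite TR.
have := ler_normD (\int[mu]_(u in `[0, L]) (G (a (normRn x) u) * 1))
  (\int[mu]_(u in `[0, L]) (G (a (- normRn x) u) * 1)).
move=> /(ler_wpM2l (normr_ge0 k)); rewrite mulrDr.
move=> /le_trans; apply.
have -> : 8 * C * M * (1 + `|k|) ^+ 3 = 4 * (C * (1 + `|k|) ^+ 3 * M) + 4 * (C * (1 + `|k|) ^+ 3 * M) by ring.
by apply: lerD; exact: B1.
Qed.

Lemma kernelN p psi eps c t k th n (x xi : Rn R n) :
  kernel p psi eps c t k th x xi = kernel p psi eps (- c) (- t) (- k) (- th) x xi.
Proof.
rewrite /kernel /polar_kernel -cosN; congr (cos _ * _ * _) => /=; ring.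
Qed.

(** Negative times follow from positive ones by reversing the phase. *)
Lemma kernel_bound_all n psi : cutoff psi -> exists C : R, exists N : nat, 0 <= C /\
  forall (x : Rn R n.+1) eps t k th, 0 < eps -> n = 0%N \/ t != 0 ->
  `|k| * `|\int[leb n.+1]_xi kernel (n%:R / 2) psi eps 1 t k th x xi| <=
  C * (1 + `|k|) ^+ N * `|t| `^ (- (n%:R / 2)).
Proof.
case: n => [|n] Hpsi.
  have [C C0 HC] := kernel_bound1 Hpsi; exists C, 3; split => // x eps t k th eps0 _.
  rewrite mul0r oppr0 powRr0 mulr1.
  have [->|k0] := eqVneq k 0; last exact: HC.
  by rewrite normr0 mul0r mulr_ge0// exprn_ge0// addr0.
have [C [N [C0 HC]]] := kernel_bound n Hpsi; exists C, N; split => // x eps t k th eps0 [//|t0].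
have [->|k0] := eqVneq k 0.
  by rewrite normr0 mul0r !mulr_ge0 ?powR_ge0// exprn_ge0// addr0.
have [tp|tn] := ltP 0 t; first by rewrite (gtr0_norm tp); exact: HC.
have {}tn : 0 < - t by rewrite oppr_gt0 lt_neqAle t0.
have -> : (fun xi => kernel (n.+1%:R / 2) psi eps 1 t k th x xi) =
    kernel (n.+1%:R / 2) psi eps (-1) (- t) (- k) (- th) x.
  by apply/funext => xi; exact: kernelN.
rewrite -(normrN k) -(normrN t) (gtr0_norm tn); apply: HC => //.
by rewrite oppr_eq0.
Qed.

Lemma kernel_integrable p psi eps c t k th n (x : Rn R n) : 0 <= p -> 0 < eps -> cutoff psi ->
  (leb n).-integrable setT (EFin \o kernel p psi eps c t k th x).
Proof.
move=> p0 eps0 Hpsi; have [M HM] := cutoff_bounded Hpsi.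
pose D : set (Rn R n) := [set v | dotRn v v < (eps^-1) ^+ 2].
have mD : measurable D by exact: measurable_ball.
have mk : measurable_fun setT (kernel p psi eps c t k th x).
  apply: (measurableT_comp (measurable_polar_kernel p eps c t k th Hpsi)).
  by apply: measurable_fun_pair; [exact: measurable_dotRn|exact: measurable_sqrRn].
have -> : EFin \o kernel p psi eps c t k th x = (EFin \o kernel p psi eps c t k th x) \_ D.
  apply/funext => xi; rewrite patchE; case: ifPn => //; rewrite notin_setE /D /= => /negP.
  rewrite -leNgt => out; rewrite /kernel /polar_kernel /=.
  have /(Hpsi.2) /nbhs_singleton -> : 1 <= eps * Num.sqrt (dotRn xi xi); last by rewrite mulr0.
  have ei : 0 <= eps^-1 by rewrite invr_ge0 ltW.
  by rewrite -ler_pdivrMl// mulr1 -[leLHS](ger0_norm ei) -sqrtr_sqr ler_wsqrtr.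
apply/(integrable_mkcond _ mD); apply: measurable_bounded_integrable => //.
- exact: ball_finite.
- exact: measurable_funTS.
- exists M; split; first by rewrite num_real.
  move=> M' MM' xi _ /=; apply: (@le_trans _ _ M); last exact: ltW.
  have q0 := dotRn_ge0 xi.
  have w1 : 1 <= Num.sqrt (1 + dotRn xi xi) by rewrite -[leLHS]sqrtr1 ler_wsqrtr// lerDl.
  rewrite /kernel /polar_kernel /= normrM -[leRHS]mul1r ler_pM//; last first.
    by rewrite HM// mulr_ge0 ?sqrtr_ge0// ltW.
  rewrite normrM -[leRHS]mul1r ler_pM// ?cos_max//.
  rewrite ger0_norm ?powR_ge0// -[leRHS](powRr0 (Num.sqrt (1 + dotRn xi xi))) ler_powR//; lra.
Qed.

End kernel_estimates.

(** * The complex integral *)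

Section complex_kernel.
Context {R : realType}.
Notation leb := (lebesgue_measure_Rn R).
Local Open Scope complex_scope.

Lemma test_function_vanish (psi : R -> R[i]) : test_function psi ->
  forall s : R, 1 <= s -> \forall u \near s, psi u = 0.
Proof.
move=> [_ _ _ sub] s s1.
have : open_nbhs s (~` top_support psi).
  split; first by apply: closed_openC; exact: closed_closure.
  by move=> /sub /=; rewrite in_itv/= => /andP[_ /lt_le_trans /(_ s1)]; rewrite ltxx.
move=> /open_nbhs_nbhs; apply: filterS => u nu; apply/eqP; apply: contrapT => /negP u0.
by apply: nu; exact: subset_closure.
Qed.

Lemma cutoff_Re (psi : R -> R[i]) : test_function psi -> cutoff (fun s => complex.Re (psi s)).
Proof.
move=> H; split; first by case: H.
by move=> s /(test_function_vanish H); apply: filterS => u ->.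
Qed.

Lemma cutoff_Im (psi : R -> R[i]) : test_function psi -> cutoff (fun s => complex.Im (psi s)).
Proof.
move=> H; split; first by case: H.
by move=> s /(test_function_vanish H); apply: filterS => u ->.
Qed.

(** Quarter turns of the phase produce the sines, and [kappa] is doubled because
    [1 + |xi| ^ 2] is the square of the bracket. *)
Lemma calJ_kernel n (psi : R -> R[i]) (kappa eps : R) (x : Rn R n.+1) (t : R) :
  test_function psi -> 0 < eps ->
  let K f th := \int[leb n.+1]_xi kernel (n%:R / 2) f eps 1 t (2 * kappa) th x xi in
  let f := fun s => complex.Re (psi s) in let g := fun s => complex.Im (psi s) in
  calJ psi kappa eps x t = (K f 0 + K g (pi / 2)) +i* (K g 0 + K f (- (pi / 2))).
Proof.
move=> Hpsi eps0 K f g; have Hf := cutoff_Re Hpsi; have Hg := cutoff_Im Hpsi.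
have ik h th : cutoff h -> (leb n.+1).-integrable setT
    (EFin \o kernel (n%:R / 2) h eps 1 t (2 * kappa) th x).
  by move=> Hh; apply: kernel_integrable => //; rewrite divr_ge0.
have main xi : Cexp (0 +i* (dotRn x xi + t * japanese_bracket xi)) * psi (eps * normRn xi)
    * Cpow (1 + normRn xi ^+ 2) ((- (n.+2%:R / 4)) +i* (- kappa)) =
  (kernel (n%:R / 2) f eps 1 t (2 * kappa) 0 x xi +
   kernel (n%:R / 2) g eps 1 t (2 * kappa) (pi / 2) x xi) +i*
  (kernel (n%:R / 2) g eps 1 t (2 * kappa) 0 x xi +
   kernel (n%:R / 2) f eps 1 t (2 * kappa) (- (pi / 2)) x xi).
  rewrite /kernel /polar_kernel /f /g /japanese_bracket /normRn sqr_sqrtr ?dotRn_ge0//=.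
  have q0 : 0 < 1 + dotRn xi xi by rewrite ltr_pwDl// dotRn_ge0.
  have w0 : 0 < Num.sqrt (1 + dotRn xi xi) by rewrite sqrtr_gt0.
  have lnE : ln (1 + dotRn xi xi) = 2 * ln (Num.sqrt (1 + dotRn xi xi)).
    by rewrite -[in LHS](sqr_sqrtr (ltW q0)) lnXn// mulr_natl.
  rewrite cosDpihalf cosBpihalf !addr0 !mul1r.
  rewrite /Cpow /Cexp /= expR0 !mul1r lnE /powR gt_eqF//.
  set A := dotRn x xi + _; set l := ln _.
  case: (psi _) => a b /=.
  have -> : - (n.+2%:R / 4) * (2 * l) - - kappa * 0 = - (n%:R / 2 + 1) * l by field.
  have -> : - (n.+2%:R / 4) * 0 + - kappa * (2 * l) = - (2 * kappa * l) by ring.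
  rewrite cosB sinB cosN sinN.
  by congr (_ +i* _); ring.
rewrite /calJ /Cintegral; congr (_ +i* _).
- rewrite -RintegralD//; [|exact: ik|exact: ik].
  by apply: eq_Rintegral => xi _; rewrite main.
- rewrite -RintegralD//; [|exact: ik|exact: ik].
  by apply: eq_Rintegral => xi _; rewrite main.
Qed.

Lemma normc_le_norm (r a b : R) :
  Normc.normc (r%:C * (a +i* b)) <= `|r| * (`|a| + `|b|).
Proof.
have -> : r%:C * (a +i* b) = (r * a) +i* (r * b).
  by apply/eqP; rewrite eq_complex /= !mul0r subr0 addr0 !eqxx.
have h : 0 <= `|r| * (`|a| + `|b|) by rewrite mulr_ge0// addr_ge0.
rewrite /= -[leRHS](ger0_norm h) -sqrtr_sqr ler_wsqrtr// !exprMn real_normK ?num_real//.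
rewrite -mulrDr ler_wpM2l ?sqr_ge0//.
have := normr_ge0 a; have := normr_ge0 b.
rewrite -(real_normK (num_real a)) -(real_normK (num_real b)); nra.
Qed.

End complex_kernel.

Local Open Scope complex_scope.

Theorem proposition3p3 (R : realType) (d : nat) (hd : (1 <= d)%N)
    (psi : R -> R[i]) (hpsi : test_function psi) :
  exists C N : R, 0 < N /\
    forall (kappa eps : R) (x : Rn R d) (t : R), 0 < eps ->
      ((Normc.normc (kappa%:C * calJ psi kappa eps x t))%:E
         <= dispersive_bound d C N kappa t)%E.
Proof.
case: d hd => [//|n] _.
have [C1 [N1 [C10 H1]]] := kernel_bound_all n (cutoff_Re hpsi).
have [C2 [N2 [C20 H2]]] := kernel_bound_all n (cutoff_Im hpsi).
pose N := (N1 + N2).+1.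
exists (2 ^+ N * (C1 + C2)), N%:R; split; first by rewrite ltr0n.
move=> kappa eps x t eps0; rewrite /dispersive_bound.
case: ifPn => [_|nt]; first exact: leey.
have {}nt : n = 0%N \/ t != 0.
  move: nt; rewrite negb_and -leqNgt => /orP[|]; last by right.
  by rewrite ltnS leqn0 => /eqP; left.
rewrite lee_fin calJ_kernel//; apply: (le_trans (normc_le_norm _ _ _)).
have k2 : `|kappa| = 2^-1 * `|2 * kappa| by rewrite normrM ger0_norm// mulKf.
rewrite powR_mulrn ?addr_ge0//=.
set T := _ `^ _; have T0 : 0 <= T by exact: powR_ge0.
(* Replacing [2 * kappa] by [kappa] costs a factor [2 ^ N]. *)
have pw N' : (N' <= N)%N -> (1 + `|2 * kappa|) ^+ N' <= 2 ^+ N * (1 + `|kappa|) ^+ N.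
  move=> leN; rewrite -exprMn; apply: (@le_trans _ _ ((1 + `|2 * kappa|) ^+ N)).
    by rewrite ler_weXn2l// lerDl.
  by rewrite lerXn2r ?nnegrE ?addr_ge0 ?mulr_ge0// normrM ger0_norm//; have := normr_ge0 kappa; lra.
have b1 th : `|2 * kappa| * `|\int[lebesgue_measure_Rn R n.+1]_xi
    kernel (n%:R / 2) (fun s => complex.Re (psi s)) eps 1 t (2 * kappa) th x xi| <=
    C1 * (2 ^+ N * (1 + `|kappa|) ^+ N) * T.
  apply: (le_trans (H1 x eps t (2 * kappa) th eps0 nt)).
  by rewrite ler_wpM2r// ler_wpM2l// pw// /N -addnS leq_addr.
have b2 th : `|2 * kappa| * `|\int[lebesgue_measure_Rn R n.+1]_xi
    kernel (n%:R / 2) (fun s => complex.Im (psi s)) eps 1 t (2 * kappa) th x xi| <=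
    C2 * (2 ^+ N * (1 + `|kappa|) ^+ N) * T.
  apply: (le_trans (H2 x eps t (2 * kappa) th eps0 nt)).
  by rewrite ler_wpM2r// ler_wpM2l// pw// /N -addSn leq_addl.
have := b1 0; have := b1 (- (pi / 2)); have := b2 0; have := b2 (pi / 2).
have -> : 2 ^+ N * (C1 + C2) * (1 + `|kappa|) ^+ N * T =
  (C1 + C2) * (2 ^+ N * (1 + `|kappa|) ^+ N) * T by ring.
move: (2 ^+ N * _) => P; rewrite k2.
set I1 := \int[_]_xi _; set I2 := \int[_]_xi _; set I3 := \int[_]_xi _; set I4 := \int[_]_xi _.
have k0 : 0 <= `|2 * kappa| by exact: normr_ge0.
have := ler_wpM2l k0 (ler_normD I4 I1); have := ler_wpM2l k0 (ler_normD I2 I3).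
by rewrite !mulrDr; lra.
Qed.
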